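(* Let $\Sigma$ and $\Omega$ be finite sets. The set of hypotheses $\mathcal{H}_{\mathrm{katc}}$ over the alphabet $2(\Sigma+T_{\mathrm{BA}})$ reduces to the empty set; moreover $\mathsf{KA}_{\mathcal{H}_{\mathrm{katc}}}$ is complete and the relation $\{(e,f)\mid\mathsf{KA}_{\mathcal{H}_{\mathrm{katc}}}\vdash e=f\}$ is decidable.
   Context: Regular expressions $T(X)$ over an alphabet $X$: $e,f::=e+f\mid e\cdot f\mid e^*\mid 0\mid 1\mid a$ ($a\in X$), with usual language $\llbracket e\rrbracket$. Kleene algebra axioms: idempotent semiring axioms plus $1+xx^*\le x^*$, $x+yz\le z\Rightarrow y^*x\le z$, $x+yz\le y\Rightarrow xz^*\le y$. A hypothesis is a pair $e\le f$; an equation as hypothesis stands for two inequations. $\mathsf{KA}_H\vdash e=f$ means derivable in equational logic from all instances of the Kleene algebra axioms and the hypotheses in $H$, letters being constants (no substitution rule); $\mathsf{KA}_H\vdash H'$ means all inequations of $H'$ are derivable. The $H$-closure $H^\star(L)$ is the smallest language containing $L$ such that for all $e\le f\in H$ and words $u,v$, $u\llbracket f\rrbracket v\subseteq H^\star(L)$ implies $u\llbracket e\rrbracket v\subseteq H^\star(L)$. $\mathsf{KA}_H$ is complete if $H^\star(\llbracket e\rrbracket)=H^\star(\llbracket f\rrbracket)$ implies $\mathsf{KA}_H\vdash e=f$. For $\Gamma\subseteq\Sigma'$, $H$ over $\Sigma'$, $H'$ over $\Gamma$: $H$ reduces to $H'$ if $\mathsf{KA}_H\vdash H'$ and there is $r:T(\Sigma')\to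 T(\Gamma)$ with $\mathsf{KA}_H\vdash e=r(e)$ and $H^\star(\llbracket e\rrbracket)\cap\Gamma^*\subseteq H'^\star(\llbracket r(e)\rrbracket)$ for all $e$; ''reduces to the empty set'' means $H'=\emptyset$ for some such $\Gamma$. For a set $X$, $2X=X+X$; the left copy of $x$ is written $x$, the right copy $x^\bullet$; the involution ${}^\circ$ on $2X$ is $x^\circ=x^\bullet$, $x^{\bullet\circ}=x$, extended to $T(2X)$ by applying it to letters and swapping arguments of products (so $(ef)^\circ=f^\circ e^\circ$). $T_{\mathrm{BA}}$ is the set of Boolean expressions over $\Omega$, each a single letter. $\mathcal{H}_{\mathrm{kat}}=\mathcal{H}_{\mathrm{bool}}\cup\{\phi\wedge\psi=\phi\cdot\psi,\ \phi\vee\psi=\phi+\psi\mid\phi,\psi\in T_{\mathrm{BA}}\}\cup\{\bot=0,\top=1\}$ ($\mathcal{H}_{\mathrm{bool}}$: all instances of Boolean algebra axioms), viewed over $2(\Sigma+T_{\mathrm{BA}})$ via the left injection. $\mathcal{H}_{\mathrm{cnv}}=\{e\le e\cdot e^\circ\cdot e\mid e\in T(2(\Sigma+T_{\mathrm{BA}}))\}$, $\mathcal{H}_{\mathrm{i}}=\{\boldsymbol\phi^\circ\le\boldsymbol\phi\mid\boldsymbol\phi\in 2T_{\mathrm{BA}}\}$, and $\mathcal{H}_{\mathrm{katc}}=\mathcal{H}_{\mathrm{kat}}\cup\mathcal{H}_{\mathrm{cnv}}\cup\mathcal{H}_{\mathrm{i}}$. Atoms (complete conjunctions of literals over $\Omega$)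 are regarded as elements of $T_{\mathrm{BA}}$. *)

(* Defs.v *)
From mathcomp Require Import all_boot.

Set Implicit Arguments.
Unset Strict Implicit.
Unset Printing Implicit Defensive.

(** * Regular expressions and languages *)

Inductive regex (X : Type) : Type :=
| re_zero
| re_one
| re_letter of X
| re_plus of regex X & regex X
| re_dot of regex X & regex X
| re_star of regex X.

Arguments re_zero {X}.
Arguments re_one {X}.

Fixpoint re_map (X Y : Type) (g : X -> Y) (e : regex X) : regex Y :=
  match e with
  | re_zero => re_zero
  | re_one => re_one
  | re_letter a => re_letter (g a)
  | re_plus e1 e2 => re_plus (re_map g e1) (re_map g e2)
  | re_dot e1 e2 => re_dot (re_map g e1) (re_map g e2)
  | re_star e1 => re_star (re_map g e1)
  end.

Definition language (X : Type) := seq X -> Prop.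

Inductive lang_star (X : Type) (L : language X) : language X :=
| lang_star_nil : lang_star L [::]
| lang_star_cat u v : L u -> lang_star L v -> lang_star L (u ++ v).

Fixpoint lang (X : Type) (e : regex X) : language X :=
  match e with
  | re_zero => fun _ => False
  | re_one => fun w => w = [::]
  | re_letter a => fun w => w = [:: a]
  | re_plus e1 e2 => fun w => lang e1 w \/ lang e2 w
  | re_dot e1 e2 => fun w => exists u v, [/\ w = u ++ v, lang e1 u & lang e2 v]
  | re_star e1 => lang_star (lang e1)
  end.

(** * Kleene algebra with hypotheses *)

(* [H e f] means that the inequation e <= f is one of the hypotheses. *)
Definition hypotheses (X : Type) := regex X -> regex X -> Prop.

Definition no_hyp (X : Type) : hypotheses X := fun _ _ => False.

(* An equation used as a hypothesis stands for two inequations. *)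
Definition both_ways (X : Type) (E : regex X -> regex X -> Prop) :
  hypotheses X := fun e f => E e f \/ E f e.

Definition hyp_map (X Y : Type) (g : X -> Y) (H : hypotheses X) :
  hypotheses Y :=
  fun e f => exists e' f', [/\ H e' f', e = re_map g e' & f = re_map g f'].

(* [ka_eq H e f] is KA_H |- e = f; an inequation x <= y is x + y = y.  There is
   no substitution rule: the letters are constants. *)
Inductive ka_eq (X : Type) (H : hypotheses X) : regex X -> regex X -> Prop :=
| ka_refl e : ka_eq H e e
| ka_sym e f : ka_eq H e f -> ka_eq H f e
| ka_trans e f g : ka_eq H e f -> ka_eq H f g -> ka_eq H e g
| ka_plus_congr e e' f f' : ka_eq H e e' -> ka_eq H f f' ->
    ka_eq H (re_plus e f) (re_plus e' f')
| ka_dot_congr e e' f f' : ka_eq H e e' -> ka_eq H f f' ->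
    ka_eq H (re_dot e f) (re_dot e' f')
| ka_star_congr e e' : ka_eq H e e' -> ka_eq H (re_star e) (re_star e')
| ka_plusA e f g :
    ka_eq H (re_plus e (re_plus f g)) (re_plus (re_plus e f) g)
| ka_plusC e f : ka_eq H (re_plus e f) (re_plus f e)
| ka_plus0 e : ka_eq H (re_plus e re_zero) e
| ka_plus_idem e : ka_eq H (re_plus e e) e
| ka_dotA e f g : ka_eq H (re_dot e (re_dot f g)) (re_dot (re_dot e f) g)
| ka_dot1 e : ka_eq H (re_dot e re_one) e
| ka_1dot e : ka_eq H (re_dot re_one e) e
| ka_dot0 e : ka_eq H (re_dot e re_zero) re_zero
| ka_0dot e : ka_eq H (re_dot re_zero e) re_zero
| ka_dotDl e f g :
    ka_eq H (re_dot (re_plus e f) g) (re_plus (re_dot e g) (re_dot f g))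
| ka_dotDr e f g :
    ka_eq H (re_dot e (re_plus f g)) (re_plus (re_dot e f) (re_dot e g))
| ka_star_unfold x :
    ka_eq H (re_plus (re_plus re_one (re_dot x (re_star x))) (re_star x))
            (re_star x)
| ka_star_indl x y z :
    ka_eq H (re_plus (re_plus x (re_dot y z)) z) z ->
    ka_eq H (re_plus (re_dot (re_star y) x) z) z
| ka_star_indr x y z :
    ka_eq H (re_plus (re_plus x (re_dot y z)) y) y ->
    ka_eq H (re_plus (re_dot x (re_star z)) y) y
| ka_hyp e f : H e f -> ka_eq H (re_plus e f) f.

Definition ka_le (X : Type) (H : hypotheses X) (e f : regex X) : Prop :=
  ka_eq H (re_plus e f) f.

Definition ka_derives (X : Type) (H H' : hypotheses X) : Prop :=
  forall e f, H' e f -> ka_le H e f.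

Inductive closure (X : Type) (H : hypotheses X) (L : language X) : language X :=
| closure_base w : L w -> closure H L w
| closure_step e f u v w : H e f ->
    (forall w', lang f w' -> closure H L (u ++ w' ++ v)) ->
    lang e w -> closure H L (u ++ w ++ v).

Definition ka_complete (X : Type) (H : hypotheses X) : Prop :=
  forall e f : regex X,
    (forall w, closure H (lang e) w <-> closure H (lang f) w) -> ka_eq H e f.

(* The sub-alphabet is the subtype of letters satisfying G, and T(G) and the
   words over G are included in those over X along [sval]. *)
Definition reduces (X : Type) (G : pred X) (H : hypotheses X)
    (H' : hypotheses {x : X | G x}) : Prop :=
  ka_derives H (hyp_map sval H') /\
  exists r : regex X -> regex {x : X | G x},
    forall e, ka_eq H e (re_map sval (r e)) /\
      forall w : seq {x : X | G x},
        closure H (lang e) (map sval w) -> closure H' (lang (r e)) w.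

Definition reduces_to_empty (X : Type) (H : hypotheses X) : Prop :=
  exists G : pred X, reduces H (@no_hyp {x : X | G x}).

(** * Boolean expressions and tests *)

Inductive bexp (O : Type) : Type :=
| b_var of O
| b_top
| b_bot
| b_not of bexp O
| b_and of bexp O & bexp O
| b_or of bexp O & bexp O.

Arguments b_top {O}.
Arguments b_bot {O}.

Inductive ba_axiom (O : Type) : bexp O -> bexp O -> Prop :=
| ba_andC p q : ba_axiom (b_and p q) (b_and q p)
| ba_orC p q : ba_axiom (b_or p q) (b_or q p)
| ba_andA p q r : ba_axiom (b_and p (b_and q r)) (b_and (b_and p q) r)
| ba_orA p q r : ba_axiom (b_or p (b_or q r)) (b_or (b_or p q) r)
| ba_andK p q : ba_axiom (b_and p (b_or p q)) p
| ba_orK p q : ba_axiom (b_or p (b_and p q)) p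
| ba_and_or p q r :
    ba_axiom (b_and p (b_or q r)) (b_or (b_and p q) (b_and p r))
| ba_or_and p q r :
    ba_axiom (b_or p (b_and q r)) (b_and (b_or p q) (b_or p r))
| ba_and_top p : ba_axiom (b_and p b_top) p
| ba_or_bot p : ba_axiom (b_or p b_bot) p
| ba_and_not p : ba_axiom (b_and p (b_not p)) b_bot
| ba_or_not p : ba_axiom (b_or p (b_not p)) b_top.

(* A whole Boolean expression is a single letter. *)
Definition re_test (S O : Type) (p : bexp O) : regex (S + bexp O) :=
  re_letter (inr p).

Inductive kat_eqn (S O : Type) :
    regex (S + bexp O) -> regex (S + bexp O) -> Prop :=
| kat_bool p q : ba_axiom p q -> kat_eqn (re_test S p) (re_test S q)
| kat_and p q :
    kat_eqn (re_test S (b_and p q)) (re_dot (re_test S p) (re_test S q))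
| kat_or p q :
    kat_eqn (re_test S (b_or p q)) (re_plus (re_test S p) (re_test S q))
| kat_bot : kat_eqn (re_test S b_bot) re_zero
| kat_top : kat_eqn (re_test S b_top) re_one.

Arguments kat_eqn : clear implicits.

Definition H_kat (S O : Type) : hypotheses (S + bexp O) :=
  both_ways (kat_eqn S O).

Arguments H_kat : clear implicits.

(** * Converse *)

Definition dbl (X : Type) : Type := (X + X)%type.

Definition conv_letter (X : Type) (x : dbl X) : dbl X :=
  match x with inl a => inr a | inr a => inl a end.

Fixpoint conv (X : Type) (e : regex (dbl X)) : regex (dbl X) :=
  match e with
  | re_zero => re_zero
  | re_one => re_one
  | re_letter a => re_letter (conv_letter a)
  | re_plus e1 e2 => re_plus (conv e1) (conv e2)
  | re_dot e1 e2 => re_dot (conv e2) (conv e1)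
  | re_star e1 => re_star (conv e1)
  end.

Inductive H_cnv (X : Type) : hypotheses (dbl X) :=
| H_cnv_intro e : H_cnv e (re_dot (re_dot e (conv e)) e).

Definition dbl_test (S O : Type) (p : dbl (bexp O)) :
    dbl (S + bexp O) :=
  match p with inl q => inl (inr q) | inr q => inr (inr q) end.

Inductive H_i (S O : Type) : hypotheses (dbl (S + bexp O)) :=
| H_i_intro (p : dbl (bexp O)) :
    H_i (re_letter (dbl_test S (conv_letter p)))
        (re_letter (dbl_test S p)).

Definition H_katc (S O : Type) : hypotheses (dbl (S + bexp O)) :=
  fun e f => [\/ hyp_map inl (H_kat S O) e f, H_cnv e f | H_i e f].

Arguments H_katc : clear implicits.

(** * Decidability *)

(* Decidability is in the sense of computability theory: classical axioms yield
   a Boolean-valued function deciding any relation whatsoever.  The model is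
   the weak call-by-value lambda-calculus of Forster and Smolka (ITP 2017): de
   Bruijn terms, with a substitution that need not lift its argument since
   evaluation from a closed term only ever substitutes closed abstractions. *)
Inductive tm : Type :=
| tm_var of nat
| tm_app of tm & tm
| tm_lam of tm.

Fixpoint tm_subst (s : tm) (k : nat) (u : tm) : tm :=
  match s with
  | tm_var n => if n == k then u else tm_var n
  | tm_app s1 s2 => tm_app (tm_subst s1 k u) (tm_subst s2 k u)
  | tm_lam s1 => tm_lam (tm_subst s1 k.+1 u)
  end.

Definition tm_closed (s : tm) : Prop := forall k u, tm_subst s k u = s.

Inductive tm_eval : tm -> tm -> Prop :=
| tm_eval_lam s : tm_eval (tm_lam s) (tm_lam s)
| tm_eval_app s t s' t' v :
    tm_eval s (tm_lam s') -> tm_eval t t' -> tm_eval (tm_subst s' 0 t') v ->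
    tm_eval (tm_app s t) v.

(* Scott encoding of the k-th of n constructors (counted from 0), applied to
   the closed encodings [args]:  \x_0 ... x_{n-1}. x_k args. *)
Definition scott (n k : nat) (args : seq tm) : tm :=
  iter n tm_lam (foldl tm_app (tm_var (n - k.+1)) args).

Definition enc_bool (b : bool) : tm := scott 2 (if b then 0 else 1) [::].

Fixpoint enc_nat (n : nat) : tm :=
  if n is m.+1 then scott 2 1 [:: enc_nat m] else scott 2 0 [::].

Definition enc_fin (T : finType) (x : T) : tm := enc_nat (enum_rank x).

Definition enc_sum (X Y : Type) (encX : X -> tm) (encY : Y -> tm)
    (z : X + Y) : tm :=
  match z with
  | inl x => scott 2 0 [:: encX x]
  | inr y => scott 2 1 [:: encY y]
  end.

Fixpoint enc_bexp (O : Type) (enc : O -> tm) (p : bexp O) : tm :=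
  match p with
  | b_var o => scott 6 0 [:: enc o]
  | b_top => scott 6 1 [::]
  | b_bot => scott 6 2 [::]
  | b_not q => scott 6 3 [:: enc_bexp enc q]
  | b_and q r => scott 6 4 [:: enc_bexp enc q; enc_bexp enc r]
  | b_or q r => scott 6 5 [:: enc_bexp enc q; enc_bexp enc r]
  end.

Fixpoint enc_regex (X : Type) (enc : X -> tm) (e : regex X) : tm :=
  match e with
  | re_zero => scott 6 0 [::]
  | re_one => scott 6 1 [::]
  | re_letter a => scott 6 2 [:: enc a]
  | re_plus f g => scott 6 3 [:: enc_regex enc f; enc_regex enc g]
  | re_dot f g => scott 6 4 [:: enc_regex enc f; enc_regex enc g]
  | re_star f => scott 6 5 [:: enc_regex enc f]
  end.

Definition decidable_rel (A : Type) (enc : A -> tm) (R : A -> A -> Prop) :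
  Prop :=
  exists2 d : tm, tm_closed d &
    forall x y : A, exists2 b : bool,
      tm_eval (tm_app (tm_app d (enc x)) (enc y)) (enc_bool b) &
      (R x y <-> b = true).

Definition enc_katc_letter (S O : finType) : dbl (S + bexp O) -> tm :=
  let enc := enc_sum (@enc_fin S) (enc_bexp (@enc_fin O)) in enc_sum enc enc.

Arguments enc_katc_letter : clear implicits.

(* Main.v *)
(* A guarded string is a path whose vertices carry atoms and whose edges carry
   directed letters of [Sigma]; it is a relational model of tests and converse,
   in which every hypothesis is valid. Hence derivable equations relate the ends
   of the same guarded strings.

   Conversely, tests are sums of atoms and the atoms sum to 1, so expressions may
   be taken over the finite alphabet of atoms and directed letters. If an
   expression relates the ends of a guarded string, an automaton for it walks
   along that string from one end to the other, and may be assumed to visit each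
   position at most once in each state. The word read by such a walk is
   straightened in a number of rounds that depends only on the number of states,
   each round replacing disjoint factors x x° x by x and inserting atoms, all in
   parallel. One round maps regular languages to regular languages and, by
   completeness of Kleene algebra, e <= e e° e and a <= 1, it maps every
   expression to a provably equal one. Thus finitely many rounds turn e into r(e),
   whose plain language contains the words of the closure of e.

   For decidability, the two-way behaviours of an automaton on guarded strings
   form a finite set on which extension by an edge acts, so that two expressions
   which differ do so on a guarded string of computably bounded length. The
   exhaustive search for it is built from encoded data by folds and case
   analysis, which lambda-terms can express. *)

From HB Require Import structures.
Require Import Defs.
From mathcomp Require Import all_boot zify.
From Stdlib Require Import Setoid Morphisms.

Set Implicit Arguments.
Unset Strict Implicit.
Unset Printing Implicit Defensive.

(* The obstacle is e <= e e° e: on words it removes one zigzag at a time, and a single language may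
   call for unboundedly many removals. Two facts tame it. A walk visiting each position at most m +
   1 times straightens in 2m parallel rounds, whatever its length: cut at its turning points, it
   falls into pieces with m visits, and what they straighten to is a staircase that two rounds
   flatten. And a round is sound for a whole regular language: the words x for which x, x° and x
   lead through prescribed states form a regular language B, and B B° B still leads through these
   states although its three factors may be different words.

   The expression r(e) is chosen semantically: its words are those all of whose compatible guarded
   strings are accepted by e. Equivalent expressions thus get the same language, and words of the
   closure lie in it by validity of the hypotheses. The rounds serve to derive r(e) <= e: once
   padded with atoms, a word of r(e) either contains two conflicting atoms, hence is below 0, or
   spells one guarded string, and an accepting walk along it can be straightened. *)
Declare Scope regex_scope.
Delimit Scope regex_scope with RE.
Notation "e + f" := (re_plus e f) : regex_scope.
Notation "e * f" := (re_dot e f) : regex_scope.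
Notation "0" := re_zero : regex_scope.
Notation "1" := re_one : regex_scope.

(** * Kleene algebra *)

Section KleeneAlgebra.
Variables (X : Type) (H : hypotheses X).
Implicit Types e f g : regex X.

Local Open Scope regex_scope.
Local Notation "e ≡ f" := (ka_eq H e f) (at level 70).
Local Notation "e ≦ f" := (ka_le H e f) (at level 70).
Local Notation "e ^*" := (re_star e).

#[local] Hint Resolve ka_refl : core.

#[export] Instance ka_eq_equiv : Equivalence (ka_eq H).
Proof. by split; [exact: ka_refl | exact: ka_sym | exact: ka_trans]. Qed.

#[export] Instance re_plus_proper :
  Proper (ka_eq H ==> ka_eq H ==> ka_eq H) (@re_plus X).
Proof. by move=> e e' he f f' hf; apply: ka_plus_congr. Qed.

#[export] Instance re_dot_proper :
  Proper (ka_eq H ==> ka_eq H ==> ka_eq H) (@re_dot X).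
Proof. by move=> e e' he f f' hf; apply: ka_dot_congr. Qed.

#[export] Instance re_star_proper : Proper (ka_eq H ==> ka_eq H) (@re_star X).
Proof. by move=> e e' he; apply: ka_star_congr. Qed.

#[export] Instance ka_le_proper :
  Proper (ka_eq H ==> ka_eq H ==> iff) (ka_le H).
Proof. by move=> e e' he f f' hf; rewrite /ka_le he hf. Qed.

Lemma ka_eq_le e f : e ≡ f -> e ≦ f.
Proof. by move=> h; rewrite /ka_le h; apply: ka_plus_idem. Qed.

Lemma ka_le_refl e : e ≦ e. Proof. exact: ka_plus_idem. Qed.

Lemma ka_le_trans f e g : e ≦ f -> f ≦ g -> e ≦ g.
Proof. by rewrite /ka_le => h1 h2; rewrite -h2 ka_plusA h1. Qed.

#[export] Instance ka_le_preorder : PreOrder (ka_le H).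
Proof. by split=> [e|e f g]; [exact: ka_le_refl | exact: ka_le_trans]. Qed.

#[local] Hint Resolve ka_le_refl : core.

Lemma ka_le_anti e f : e ≦ f -> f ≦ e -> e ≡ f.
Proof. by rewrite /ka_le => h1 h2; rewrite -h1 ka_plusC h2. Qed.

Lemma ka_le_plusl e f : e ≦ e + f.
Proof. by rewrite /ka_le ka_plusA ka_plus_idem. Qed.

Lemma ka_le_plusr e f : f ≦ e + f.
Proof. by rewrite ka_plusC; apply: ka_le_plusl. Qed.

Lemma ka_plus_lub e f g : e ≦ g -> f ≦ g -> e + f ≦ g.
Proof. by rewrite /ka_le => h1 h2; rewrite -ka_plusA h2. Qed.

Lemma ka_le_plus e e' f f' : e ≦ e' -> f ≦ f' -> e + f ≦ e' + f'.
Proof.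
move=> h1 h2; apply: ka_plus_lub.
  by apply: (ka_le_trans h1); apply: ka_le_plusl.
by apply: (ka_le_trans h2); apply: ka_le_plusr.
Qed.

Lemma ka_le_dotl e e' f : e ≦ e' -> e * f ≦ e' * f.
Proof. by rewrite /ka_le -ka_dotDl => ->. Qed.

Lemma ka_le_dotr e f f' : f ≦ f' -> e * f ≦ e * f'.
Proof. by rewrite /ka_le -ka_dotDr => ->. Qed.

Lemma ka_le_dot e e' f f' : e ≦ e' -> f ≦ f' -> e * f ≦ e' * f'.
Proof.
by move=> h1 h2; apply: (ka_le_trans (ka_le_dotl _ h1)); apply: ka_le_dotr.
Qed.

Lemma ka_le0 e : 0 ≦ e.
Proof. by rewrite /ka_le ka_plusC ka_plus0. Qed.

Lemma ka_star_lub e : 1 + e * e^* ≦ e^*.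
Proof. exact: ka_star_unfold. Qed.

Lemma ka_le1_star e : 1 ≦ e^*.
Proof. by apply: ka_le_trans (ka_star_lub e); apply: ka_le_plusl. Qed.

Lemma ka_dot_star e : e * e^* ≦ e^*.
Proof. by apply: ka_le_trans (ka_star_lub e); apply: ka_le_plusr. Qed.

Lemma ka_le_star e : e ≦ e^*.
Proof.
apply: ka_le_trans (ka_dot_star e); rewrite -{1}(ka_dot1 H e).
by apply: ka_le_dotr; apply: ka_le1_star.
Qed.

Lemma ka_star_ind_l e f g : f ≦ g -> e * g ≦ g -> e^* * f ≦ g.
Proof. by move=> h1 h2; apply: ka_star_indl; apply: ka_plus_lub. Qed.

Lemma ka_star_ind_r e f g : f ≦ g -> g * e ≦ g -> f * e^* ≦ g.
Proof. by move=> h1 h2; apply: ka_star_indr; apply: ka_plus_lub. Qed.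

Lemma ka_star_star e : e^* * e^* ≦ e^*.
Proof. by apply: ka_star_ind_l => //; apply: ka_dot_star. Qed.

Lemma ka_star_dot e : e^* * e ≦ e^*.
Proof.
by apply: ka_le_trans (ka_star_star e); apply: ka_le_dotr; apply: ka_le_star.
Qed.

Fixpoint re_sum (T : Type) (F : T -> regex X) (s : seq T) : regex X :=
  if s is x :: s' then F x + re_sum F s' else 0.

Lemma ka_sum_lub (T : eqType) (F : T -> regex X) (s : seq T) g :
  (forall x, x \in s -> F x ≦ g) -> re_sum F s ≦ g.
Proof.
elim: s => [|x s ih] hs /=; first exact: ka_le0.
apply: ka_plus_lub; first by apply: hs; rewrite mem_head.
by apply: ih => y ys; apply: hs; rewrite inE ys orbT.
Qed.

Lemma ka_le_sum (T : eqType) (F : T -> regex X) (s : seq T) x :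
  x \in s -> F x ≦ re_sum F s.
Proof.
elim: s => //= y s ih; rewrite inE => /orP[/eqP->|/ih h].
  exact: ka_le_plusl.
by apply: (ka_le_trans h); apply: ka_le_plusr.
Qed.

Lemma ka_dot_sumr (T : Type) (F : T -> regex X) (s : seq T) e :
  e * re_sum F s ≡ re_sum (fun x => e * F x) s.
Proof. by elim: s => [|x s ih] /=; rewrite ?ka_dot0 // ka_dotDr ih. Qed.

Lemma ka_dot_suml (T : Type) (F : T -> regex X) (s : seq T) e :
  re_sum F s * e ≡ re_sum (fun x => F x * e) s.
Proof. by elim: s => [|x s ih] /=; rewrite ?ka_0dot // ka_dotDl ih. Qed.

Lemma lang_sum (T : eqType) (F : T -> regex X) (s : seq T) w :
  lang (re_sum F s) w <-> exists2 x, x \in s & lang (F x) w.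
Proof.
elim: s => [|x s ih] /=; first by split=> // -[].
rewrite ih; split=> [[h|[y ys h]]|[y]].
- by exists x; rewrite ?mem_head.
- by exists y; rewrite // inE ys orbT.
by rewrite inE => /orP[/eqP->|ys] h; [left | right; exists y].
Qed.

(* Kleene's algorithm: [kl M s] is the matrix of the paths whose intermediate
   vertices are in [s]. *)
Section Matrix.
Variables (Q : finType) (M : Q -> Q -> regex X).

Fixpoint kl (s : seq Q) (p q : Q) : regex X :=
  if s is r :: s' then
    kl s' p q + kl s' p r * ((kl s' r r)^* * kl s' r q)
  else (if p == q then 1 else 0) + M p q.

Definition mx_star := kl (enum Q).

Lemma kl_one s p : 1 ≦ kl s p p.
Proof.
elim: s => [|r s ih] /=; first by rewrite eqxx; apply: ka_le_plusl.
by apply: (ka_le_trans ih); apply: ka_le_plusl.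
Qed.

Lemma kl_edge s p q : M p q ≦ kl s p q.
Proof.
elim: s => [|r s ih] /=; first exact: ka_le_plusr.
by apply: (ka_le_trans ih); apply: ka_le_plusl.
Qed.

Lemma kl_trans s r p q : r \in s -> kl s p r * kl s r q ≦ kl s p q.
Proof.
elim: s r p q => // t s ih r p q; rewrite inE => /=.
set K := kl s; case: eqP => [->|_] /= rs.
  (* Here [r] is the vertex just added: every path to it or from it is a path of [K] with loops at
     [t] attached. *)
  have h1 x : K x t + K x t * ((K t t)^* * K t t) ≦ K x t * (K t t)^*.
    apply: ka_plus_lub; last by apply: ka_le_dotr; apply: ka_star_dot.
    by rewrite -{1}(ka_dot1 H (K x t)); apply: ka_le_dotr; apply: ka_le1_star.
  have h2 x : K t x + K t t * ((K t t)^* * K t x) ≦ (K t t)^* * K t x.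
    apply: ka_plus_lub; last by rewrite ka_dotA; apply: ka_le_dotl; apply: ka_dot_star.
    by rewrite -{1}(ka_1dot H (K t x)); apply: ka_le_dotl; apply: ka_le1_star.
  apply: (ka_le_trans (ka_le_dot (h1 p) (h2 q))).
  apply: ka_le_trans (ka_le_plusr _ _).
  rewrite -ka_dotA; apply: ka_le_dotr; rewrite ka_dotA; apply: ka_le_dotl.
  exact: ka_star_star.
have {}ih p' q' : K p' r * K r q' ≦ K p' q' by apply: ih.
rewrite ka_dotDl !ka_dotDr; apply: ka_plus_lub; apply: ka_plus_lub.
- by apply: (ka_le_trans (ih _ _)); apply: ka_le_plusl.
- rewrite ka_dotA; apply: ka_le_trans (ka_le_plusr _ _).
  by apply: ka_le_dotl; apply: ih.
- rewrite -!ka_dotA; apply: ka_le_trans (ka_le_plusr _ _).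
  by do 2!apply: ka_le_dotr; apply: ih.
apply: ka_le_trans (ka_le_plusr _ _); rewrite -!ka_dotA; apply: ka_le_dotr.
rewrite !ka_dotA; apply: ka_le_dotl.
apply: ka_le_trans (ka_star_star _); apply: ka_le_dotl.
rewrite -ka_dotA; apply: ka_le_trans (ka_star_dot _); apply: ka_le_dotr.
exact: ih.
Qed.

Lemma kl_least s (g : Q -> regex X) :
  (forall p q, M p q * g q ≦ g p) -> forall p q, kl s p q * g q ≦ g p.
Proof.
move=> hg; elim: s => [|r s ih] p q /=; rewrite ka_dotDl.
  apply: ka_plus_lub => //; case: eqP => [->|_]; first by rewrite ka_1dot.
  by rewrite ka_0dot; apply: ka_le0.
apply: ka_plus_lub => //; rewrite -!ka_dotA.
apply: ka_le_trans (ih p r); apply: ka_le_dotr.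
by apply: ka_star_ind_l.
Qed.

Lemma mx_star_one p : 1 ≦ mx_star p p. Proof. exact: kl_one. Qed.

Lemma mx_star_edge p q : M p q ≦ mx_star p q. Proof. exact: kl_edge. Qed.

Lemma mx_star_trans r p q : mx_star p r * mx_star r q ≦ mx_star p q.
Proof. by apply: kl_trans; rewrite mem_enum. Qed.

Lemma mx_star_least (g : Q -> regex X) :
  (forall p q, M p q * g q ≦ g p) -> forall p q, mx_star p q * g q ≦ g p.
Proof. exact: kl_least. Qed.

End Matrix.
End KleeneAlgebra.

#[export] Hint Resolve ka_refl ka_le_refl : core.

(** * Languages as a model of Kleene algebra *)

Section Languages.
Local Open Scope regex_scope.
Variable X : Type.
Implicit Types (e f : regex X) (L : language X) (w : seq X).

Lemma lang_star_trans L u v :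
  lang_star L u -> lang_star L v -> lang_star L (u ++ v).
Proof. by elim=> // u1 u2 h1 _ ih hv; rewrite -catA; constructor; auto. Qed.

Lemma lang_star_sub L1 L2 w :
  (forall v, L1 v -> L2 v) -> lang_star L1 w -> lang_star L2 w.
Proof. by move=> h; elim=> [|u v hu _ ih]; constructor; auto. Qed.

Lemma lang_sound e f w :
  ka_eq (@no_hyp X) e f -> lang e w <-> lang f w.
Proof.
move=> h; elim: h w => {e f} //=.
- by move=> e f _ ih w; rewrite ih.
- by move=> e f g _ ih1 _ ih2 w; rewrite ih1.
- by move=> e e' f f' _ ih1 _ ih2 w; rewrite ih1 ih2.
- by move=> e e' f f' _ ih1 _ ih2 w; split=> -[u [v [-> /ih1 hu /ih2 hv]]];
    exists u, v.
- by move=> e e' _ ih w; split; apply: lang_star_sub => v /ih.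
- by move=> *; tauto.
- by move=> *; tauto.
- by move=> *; tauto.
- by move=> *; tauto.
- move=> e f g w; split.
    move=> [u [_ [-> hu [v [v' [-> hv hv']]]]]]; exists (u ++ v), v'.
    by split; rewrite ?catA //; exists u, v.
  move=> [_ [v' [-> [u [v [-> hu hv]]] hv']]]; exists u, (v ++ v').
  by split; rewrite ?catA //; exists v, v'.
- move=> e w; split=> [[u [v [-> hu ->]]]|hw]; first by rewrite cats0.
  by exists w, [::]; rewrite cats0.
- move=> e w; split=> [[u [v [-> -> hv]]]|hw] //.
  by exists [::], w.
- by move=> e w; split=> // -[u [v []]].
- by move=> e w; split=> // -[u [v []]].
- move=> e f g w; split.
    by move=> [u [v [-> [hu|hu] hv]]]; [left|right]; exists u, v.
  by move=> [] [u [v [-> hu hv]]]; exists u, v; split=> //; [left|right].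
- move=> e f g w; split.
    by move=> [u [v [-> hu [hv|hv]]]]; [left|right]; exists u, v.
  by move=> [] [u [v [-> hu hv]]]; exists u, v; split=> //; [left|right].
- move=> e w; split=> [[[->|[u [v [-> hu hv]]]]|]|] //; by [constructor | right].
- move=> x y z _ ih w; split=> [[[u [v [-> hu hv]]]|]|] //; last by right.
  elim: hu => [|u1 u2 h1 _ h2]; first by apply: (proj1 (ih _)); left; left.
  by apply: (proj1 (ih _)); left; right; exists u1, (u2 ++ v); rewrite catA.
move=> x y z _ ih w; split=> [[[u [v [-> hu hv]]]|]|] //; last by right.
have {}hu : lang y u by apply/ih; left; left.
elim: hv u hu => [|u1 u2 h1 _ h2] u hu; first by rewrite cats0.
by rewrite catA; apply: h2; apply/ih; left; right; exists u, u1.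
Qed.

Lemma lang_le e f w : ka_le (@no_hyp X) e f -> lang e w -> lang f w.
Proof. by move=> h hw; apply/(lang_sound w h); left. Qed.

Lemma ka_eq_weaken (H H' : hypotheses X) e f :
  (forall e f, H e f -> ka_le H' e f) -> ka_eq H e f -> ka_eq H' e f.
Proof.
move=> hH h; elim: h => *;
  try by [constructor | apply: ka_sym | apply: hH].
by apply: ka_trans; eassumption.
Qed.

Lemma ka_le_no_hyp (H : hypotheses X) e f :
  ka_le (@no_hyp X) e f -> ka_le H e f.
Proof. exact: ka_eq_weaken. Qed.

Lemma lang_dot e f u v : lang e u -> lang f v -> lang (e * f) (u ++ v).
Proof. by exists u, v. Qed.

Section MatrixStar.
Variables (Q : finType) (M : Q -> Q -> regex X).

Lemma lang_mx_star_nil p : lang (mx_star M p p) [::].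
Proof. exact: lang_le (mx_star_one _ M p) _. Qed.

Lemma lang_mx_star_step p q r u v :
  lang (M p q) u -> lang (mx_star M q r) v -> lang (mx_star M p r) (u ++ v).
Proof.
move=> hu hv; apply: lang_le (mx_star_trans (@no_hyp X) M q p r) _.
by apply: lang_dot => //; apply: lang_le (mx_star_edge _ M p q) _.
Qed.

Lemma lang_mx_star_least (P : Q -> Q -> language X) :
  (forall p, P p p [::]) ->
  (forall p q w, lang (M p q) w -> P p q w) ->
  (forall p q r u v, P p q u -> P q r v -> P p r (u ++ v)) ->
  forall p q w, lang (mx_star M p q) w -> P p q w.
Proof.
move=> h1 hM ht; rewrite /mx_star; elim: (enum Q) => [|r s ih] p q w /=.
  by case: eqP => [->|_] /= []; [move=> -> | exact: hM | | exact: hM].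
case=> [/ih //|[u [_ [-> /ih hu [v [v' [-> hv /ih hv']]]]]]].
apply: (ht _ _ _ _ _ hu); apply: (ht _ r) hv'.
by elim: hv => [|v1 v2 /ih h _]; [exact: h1 | exact: ht].
Qed.
End MatrixStar.
End Languages.

Fixpoint nrun (X : Type) (Q : finType) (tr : Q -> X -> Q -> bool) (p q : Q)
    (w : seq X) : bool :=
  if w is a :: w' then [exists r, tr p a r && nrun tr r q w'] else p == q.

Lemma nrun_cat (X : Type) (Q : finType) (tr : Q -> X -> Q -> bool) p q r u v :
  nrun tr p q u -> nrun tr q r v -> nrun tr p r (u ++ v).
Proof.
elim: u p => [|a u ih] p /=; first by move=> /eqP->.
move=> /existsP[s /andP[h1 h2]] h3; apply/existsP; exists s.
by rewrite h1 (ih _ h2).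
Qed.

Lemma card_set_type (T : finType) : #|{: {set T}}| = 2 ^ #|T|.
Proof. by rewrite -!cardsT -powersetT card_powerset cardsT. Qed.

(** * Automata and completeness of Kleene algebra *)

Section FiniteAlphabet.
Local Open Scope regex_scope.
Variable X : finType.
Implicit Types (e f : regex X) (w : seq X).

Definition nmx (Q : finType) (tr : Q -> X -> Q -> bool) (p q : Q) : regex X :=
  re_sum (@re_letter X) [seq a <- enum X | tr p a q].

Lemma lang_nmx (Q : finType) (tr : Q -> X -> Q -> bool) p q w :
  lang (nmx tr p q) w <-> exists2 a, tr p a q & w = [:: a].
Proof.
rewrite lang_sum; split=> [[a]|[a h ->]].
  by rewrite mem_filter => /andP[h _] ->; exists a.
by exists a; rewrite // mem_filter h mem_enum.
Qed.

Lemma lang_nfa (Q : finType) (tr : Q -> X -> Q -> bool) p q w :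
  lang (mx_star (nmx tr) p q) w <-> nrun tr p q w.
Proof.
split.
  move: p q w; apply: lang_mx_star_least => [p|p q w|p q r u v] /=.
  - exact: eqxx.
  - by move=> /lang_nmx[a h ->] /=; apply/existsP; exists q; rewrite h eqxx.
  exact: nrun_cat.
elim: w p => [|a w ih] p /=; first by move=> /eqP->; apply: lang_mx_star_nil.
move=> /existsP[r /andP[h /ih hr]]; rewrite -cat1s; apply: lang_mx_star_step hr.
by apply/lang_nmx; exists a.
Qed.

Lemma nmx_le H (Q : finType) (tr : Q -> X -> Q -> bool) (g : Q -> regex X) :
  (forall p a q, tr p a q -> ka_le H (re_letter a * g q) (g p)) ->
  forall p q, ka_le H (nmx tr p q * g q) (g p).
Proof.
move=> h p q; rewrite /nmx ka_dot_suml; apply: ka_sum_lub => a.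
by rewrite mem_filter => /andP[/h].
Qed.

Definition det (Q : finType) (d : Q -> X -> Q) q a q' := d q a == q'.

Lemma nrun_det (Q : finType) (d : Q -> X -> Q) q q' w :
  nrun (det d) q q' w = (foldl d q w == q').
Proof.
elim: w q => //= a w ih q; apply/existsP/idP => [[r /andP[/eqP<-]]|h].
  by rewrite ih.
by exists (d q a); rewrite /det eqxx ih.
Qed.

Definition dfa_re (Q : finType) (d : Q -> X -> Q) (F : pred Q) (q : Q) :=
  re_sum (mx_star (nmx (det d)) q) (enum F).

Lemma lang_dfa_re (Q : finType) (d : Q -> X -> Q) (F : pred Q) q w :
  lang (dfa_re d F q) w <-> F (foldl d q w).
Proof.
rewrite lang_sum; split=> [[q']|h].
  by rewrite mem_enum => h /lang_nfa; rewrite nrun_det => /eqP->.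
exists (foldl d q w); first by rewrite mem_enum.
by apply/lang_nfa; rewrite nrun_det.
Qed.

(** Bounds the number of states of the automaton built below: two for a letter, one extra initial
    state for a star. It must be computable, because the length of the guarded strings to be
    searched is derived from it. *)
Fixpoint nsize (Y : Type) (e : regex Y) : nat :=
  match e with
  | re_zero => 0
  | re_one => 1
  | re_letter _ => 2
  | re_plus e1 e2 | re_dot e1 e2 => nsize e1 + nsize e2
  | re_star e1 => (nsize e1).+1
  end.

(* An automaton for [e] together with, for each state, an expression for what
   remains to be read. *)
Record nfa_for e := NfaFor {
  st : finType;
  ini : pred st;
  tr : st -> X -> st -> bool;
  fin : pred st;
  rest : st -> regex X;
  st_card : #|st| <= nsize e;
  rest_ini : forall q, ini q -> ka_le (@no_hyp X) (rest q) e;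
  rest_fin : forall q, fin q -> ka_le (@no_hyp X) 1 (rest q);
  rest_tr : forall p a q,
    tr p a q -> ka_le (@no_hyp X) (re_letter a * rest q) (rest p);
  nfa_complete : forall w, lang e w ->
    exists p q, [/\ ini p, fin q & nrun tr p q w] }.

Definition nfa_zero : nfa_for 0.
Proof.
by refine (@NfaFor 0 void pred0 (fun _ _ _ => false) pred0 (fun _ => 0)
  _ _ _ _ _) => //; rewrite card_void.
Defined.

Definition nfa_one : nfa_for 1.
Proof.
refine (@NfaFor 1 unit predT (fun _ _ _ => false) predT (fun _ => 1)
  _ _ _ _ _) => //=; first by rewrite card_unit.
by move=> w ->; exists tt, tt.
Defined.

Definition nfa_letter a : nfa_for (re_letter a).
Proof.
refine (@NfaFor (re_letter a) bool id (fun p b q => [&& p, b == a & ~~ q]) negb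
  (fun b => if b then re_letter a else 1) _ _ _ _ _) => //=.
- by rewrite card_bool.
- by case.
- by case.
- by move=> [] b [] //= /andP[/eqP->] // _; rewrite ka_dot1.
move=> w ->; exists true, false; split=> //=; apply/existsP; exists false.
by rewrite !eqxx.
Defined.

Definition nfa_plus e f (A : nfa_for e) (B : nfa_for f) : nfa_for (e + f).
Proof.
refine (@NfaFor (e + f) (st A + st B)%type
  (fun x => match x with inl p => ini p | inr p => ini p end)
  (fun x a y => match x, y with
     | inl p, inl q => tr p a q | inr p, inr q => tr p a q | _, _ => false end)
  (fun x => match x with inl p => fin p | inr p => fin p end)
  (fun x => match x with inl p => rest p | inr p => rest p end) _ _ _ _ _).
- by rewrite card_sum leq_add ?st_card.
- case=> q /rest_ini h; apply: (ka_le_trans h).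
    exact: ka_le_plusl.
  exact: ka_le_plusr.
- by case=> q; apply: rest_fin.
- by case=> p a [q|q] //; apply: rest_tr.
move=> w /= [/(nfa_complete A)|/(nfa_complete B)] [p [q [hp hq h]]].
  exists (inl p), (inl q); split=> //.
  elim: w p {hp} h => [|a w ih] p /=; first by move=> /eqP->.
  move=> /existsP[r /andP[h1 /ih h2]]; apply/existsP; exists (inl r).
  by rewrite h1.
exists (inr p), (inr q); split=> //.
elim: w p {hp} h => [|a w ih] p /=; first by move=> /eqP->.
move=> /existsP[r /andP[h1 /ih h2]]; apply/existsP; exists (inr r).
by rewrite h1.
Defined.

(** There are no empty transitions: a final state of [A] directly takes a first step of [B]. The
    empty word of either factor is accounted for in the initial and final states. *)
Definition nfa_dot e f (A : nfa_for e) (B : nfa_for f) : nfa_for (e * f).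
Proof.
pose nB := [exists q : st B, ini q && fin q].
refine (@NfaFor (e * f) (st A + st B)%type
  (fun x => match x with
     | inl p => ini p
     | inr p => ini p && [exists q : st A, ini q && fin q] end)
  (fun x a y => match x, y with
     | inl p, inl q => tr p a q
     | inr p, inr q => tr p a q
     | inl p, inr q => fin p && [exists r, ini r && tr r a q]
     | _, _ => false end)
  (fun x => match x with inl p => fin p && nB | inr p => fin p end)
  (fun x => match x with inl p => rest p * f | inr p => rest p end) _ _ _ _ _).
- by rewrite card_sum leq_add ?st_card.
- case=> q /= => [/rest_ini h|/andP[/rest_ini h /existsP[p /andP[hp hq]]]].
    exact: ka_le_dotl.
  apply: (ka_le_trans h); rewrite -{1}(ka_1dot (@no_hyp X) f).
  apply: ka_le_dotl; apply: (ka_le_trans (rest_fin hq)).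
  exact: rest_ini.
- case=> q /= => [/andP[hq /existsP[p /andP[hp hf]]]|/rest_fin //].
  rewrite -(ka_1dot (@no_hyp X) 1); apply: ka_le_dot; first exact: rest_fin.
  by apply: (ka_le_trans (rest_fin hf)); apply: rest_ini.
- case=> p a [q|q] //=; last exact: rest_tr.
    by move=> h; rewrite ka_dotA; apply: ka_le_dotl; apply: rest_tr.
  move=> /andP[hp /existsP[r /andP[hr h]]].
  apply: (ka_le_trans (rest_tr h)); apply: (ka_le_trans (rest_ini hr)).
  rewrite -{1}(ka_1dot (@no_hyp X) f); apply: ka_le_dotl.
  exact: rest_fin.
set trd := (X in nrun X).
have hr (p q : st B) w : nrun (@tr f B) p q w -> nrun trd (inr p) (inr q) w.
  elim: w p => [|a w ih] p /=; first by move=> /eqP->.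
  move=> /existsP[r /andP[h1 /ih h2]]; apply/existsP; exists (inr r).
  by rewrite h1.
have hl (p q : st A) w : nrun (@tr e A) p q w -> nrun trd (inl p) (inl q) w.
  elim: w p => [|a w ih] p /=; first by move=> /eqP->.
  move=> /existsP[r /andP[h1 /ih h2]]; apply/existsP; exists (inl r).
  by rewrite h1.
move=> _ [u [v [-> /(nfa_complete A)[p [q [hp hq h]]]
  /(nfa_complete B)[p' [q' [hp' hq' h']]]]]].
case: v h' => [|a v] h'.
  exists (inl p), (inl q); split=> //; last by rewrite cats0; apply: hl.
  rewrite hq /=; apply/existsP; exists p'; rewrite hp'.
  by move: h' => /eqP->.
exists (inl p), (inr q'); split=> //.
apply: (nrun_cat (hl _ _ _ h)) => /=.
move: h' => /= /existsP[r /andP[h1 h2]]; apply/existsP; exists (inr r).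
by rewrite hr // andbT hq; apply/existsP; exists p'; rewrite hp'.
Defined.

(** [None] is a fresh initial state that is never re-entered, so that accepting the empty word there
    adds no other word. *)
Definition nfa_star e (A : nfa_for e) : nfa_for (re_star e).
Proof.
refine (@NfaFor (re_star e) (option (st A)) (fun x => x == None)
  (fun x a y => match x, y with
     | None, Some q => [exists r : st A, ini r && tr r a q]
     | Some p, Some q => tr p a q || (fin p && [exists r, ini r && tr r a q])
     | _, None => false end)
  (fun x => if x is Some p then fin p else true)
  (fun x => if x is Some p then rest p * re_star e else re_star e) _ _ _ _ _).
- by rewrite card_option ltnS st_card.
- by move=> q /eqP->.
- case=> [q /rest_fin h|_]; last exact: ka_le1_star.
  rewrite -(ka_1dot (@no_hyp X) 1); apply: ka_le_dot => //.
  exact: ka_le1_star.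
- have h0 (q : st A) a : [exists r : st A, ini r && tr r a q] ->
      ka_le (@no_hyp X) (re_letter a * (rest q * re_star e)) (re_star e).
    move=> /existsP[r /andP[hr h]]; apply: ka_le_trans (ka_dot_star _ e).
    rewrite ka_dotA; apply: ka_le_dotl.
    by apply: (ka_le_trans (rest_tr h)); apply: rest_ini.
  case=> [p|] a [q|] // => [/orP[h|/andP[hp hq]]|]; last exact: h0.
    by rewrite ka_dotA; apply: ka_le_dotl; apply: rest_tr.
  apply: (ka_le_trans (h0 _ _ hq)); rewrite -{1}(ka_1dot (@no_hyp X) (re_star e)).
  by apply: ka_le_dotl; apply: rest_fin.
set trd := (X in nrun X).
pose fino (x : option (st A)) := if x is Some p then fin p else true.
pose acc p w := exists q, fino q /\ nrun trd p q w.
suff h w : lang (re_star e) w -> acc None w.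
  by move=> w /h[q [hq hn]]; exists None, q; split; [exact: eqxx | exact: hq | exact: hn].
have hl (p q : st A) u v : fin q -> nrun (@tr e A) p q u -> acc None v ->
    acc (Some p) (u ++ v).
  move=> hq; elim: u p => [|a u ih] p /=.
    move=> /eqP-> [r]; case: v => [|a v] [hr].
      by exists (Some q); split=> //; apply: eqxx.
    move=> /= /existsP[[s|] /andP[h1 h2]] //.
    by exists r; split=> //=; apply/existsP; exists (Some s); rewrite h2 hq h1 orbT.
  move=> /existsP[r /andP[h1 h2]] /(ih _ h2)[s [hs h]]; exists s; split=> //.
  by apply/existsP; exists (Some r); apply/andP; split; rewrite //= h1.
elim=> [|u v /(nfa_complete A)[p [q [hp hq hpq]]] _ ih].
  by exists None; split=> //=; apply: eqxx.
case: u hpq => [//|a u] /= /existsP[r /andP[h1 h2]].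
have [s [hs h]] := hl _ _ _ _ hq h2 ih; exists s; split=> //=.
apply/existsP; exists (Some r); apply/andP; split=> //=; apply/existsP; exists p.
by rewrite hp.
Defined.

Fixpoint nfa_of e : nfa_for e :=
  match e with
  | re_zero => nfa_zero
  | re_one => nfa_one
  | re_letter a => nfa_letter a
  | re_plus e1 e2 => nfa_plus (nfa_of e1) (nfa_of e2)
  | re_dot e1 e2 => nfa_dot (nfa_of e1) (nfa_of e2)
  | re_star e1 => nfa_star (nfa_of e1)
  end.

Section Subset.
Variable e : regex X.
Let A := nfa_of e.

Definition dst : finType := {set st A}.
Definition dini : dst := [set q | ini q].
Definition dtr (P : dst) (a : X) : dst := [set q | [exists p in P, tr p a q]].
Definition dfin (P : dst) : bool := [exists q in P, fin q].
Definition drest (P : dst) : regex X := re_sum (@rest e A) (enum P).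

Lemma card_dst : #|dst| <= 2 ^ nsize e.
Proof. by rewrite card_set_type leq_exp2l // st_card. Qed.

Lemma drest_ini : ka_le (@no_hyp X) (drest dini) e.
Proof.
by apply: ka_sum_lub => q; rewrite mem_enum inE; apply: rest_ini.
Qed.

Lemma drest_fin P : dfin P -> ka_le (@no_hyp X) 1 (drest P).
Proof.
move=> /existsP[q /andP[hq /rest_fin h]]; apply: (ka_le_trans h).
by apply: ka_le_sum; rewrite mem_enum.
Qed.

Lemma drest_tr P a : ka_le (@no_hyp X) (re_letter a * drest (dtr P a)) (drest P).
Proof.
rewrite /drest ka_dot_sumr; apply: ka_sum_lub => q; rewrite mem_enum inE.
move=> /existsP[p /andP[hp /rest_tr h]]; apply: (ka_le_trans h).
by apply: ka_le_sum; rewrite mem_enum.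
Qed.

Lemma dfa_lang w : lang e w <-> dfin (foldl dtr dini w).
Proof.
split.
  move=> /(nfa_complete A)[p [q [hp hq]]].
  have: p \in dini by rewrite inE.
  elim: w p dini {hp} => [|a w ih] p P hp /=.
    by move=> /eqP hpq; apply/existsP; exists q; rewrite hq -hpq hp.
  move=> /existsP[r /andP[h1 /(ih _ _)]]; apply; rewrite inE.
  by apply/existsP; exists p; rewrite hp.
move=> h; apply: (lang_le drest_ini).
elim: w dini h => [|a w ih] P /=; first by move=> /drest_fin/lang_le; apply.
move=> /ih h; apply: (lang_le (drest_tr P a)).
by rewrite -cat1s; apply: lang_dot.
Qed.

Definition dresid : dst -> regex X := dfa_re dtr dfin.

(** [drest] solves the linear system of the subset automaton, and [mx_star] gives its least
    solution. *)
Lemma dresid_le H : ka_le H (dresid dini) e.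
Proof.
apply: ka_le_no_hyp; apply: ka_le_trans drest_ini.
apply: ka_sum_lub => P; rewrite mem_enum => hP.
have h := @mx_star_least _ (@no_hyp X) dst (nmx (det dtr)) drest.
apply: ka_le_trans (h _ dini P); last first.
  by apply: nmx_le => R a R' /eqP<-; apply: drest_tr.
rewrite -{1}(ka_dot1 (@no_hyp X) (mx_star _ _ _)); apply: ka_le_dotr.
exact: drest_fin.
Qed.
End Subset.

Fixpoint reach (Q : finType) (d : Q -> X -> Q) (f : regex X) : rel Q :=
  match f with
  | re_zero => fun _ _ => false
  | re_one => fun q r => q == r
  | re_letter a => fun q r => d q a == r
  | re_plus f1 f2 => fun q r => reach d f1 q r || reach d f2 q r
  | re_dot f1 f2 => fun q r => [exists s, reach d f1 q s && reach d f2 s r]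
  | re_star f1 => connect (reach d f1)
  end.

Lemma reach_lang (Q : finType) (d : Q -> X -> Q) f q r :
  reach d f q r -> exists2 w, lang f w & foldl d q w = r.
Proof.
elim: f q r => [|||f1 ih1 f2 ih2|f1 ih1 f2 ih2|f ih] //=.
- by move=> q r /eqP->; exists [::].
- by move=> a q r /eqP<-; exists [:: a].
- by move=> q r /orP[/ih1|/ih2] [w]; exists w; auto.
- move=> q r /existsP[s /andP[/ih1[u hu <-] /ih2[v hv <-]]].
  by exists (u ++ v); rewrite ?foldl_cat //; exists u, v.
move=> q r /connectP[p hp ->]; elim: p q hp => [|s p IH] q /=.
  by exists [::]; first constructor.
move=> /andP[/ih[u hu <-] /IH[v hv <-]].
by exists (u ++ v); rewrite ?foldl_cat //; constructor.
Qed.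

(** By induction on [f], since the automaton's matrix star is reflexive and transitive: [f] is split
    according to the states to which its words lead from [q]. *)
Lemma le_reach H (Q : finType) (d : Q -> X -> Q) f q :
  ka_le H f (re_sum (mx_star (nmx (det d)) q)
                    [seq r <- enum Q | reach d f q r]).
Proof.
set E := mx_star _.
have hE q' (S : pred Q) r : S r ->
    ka_le H (E q' r) (re_sum (E q') [seq r <- enum Q | S r]).
  by move=> h; apply: (@ka_le_sum _ _ _ (E q')); rewrite mem_filter h mem_enum.
elim: f q => [|||f1 ih1 f2 ih2|f1 ih1 f2 ih2|f ih] /= q.
- exact: ka_le0.
- by apply: ka_le_trans (hE q (eq_op q) q _) => //; exact: mx_star_one.
- move=> r; apply: ka_le_trans (hE r (eq_op (d r q)) _ (eqxx _)).
  apply: ka_le_trans (mx_star_edge _ _ _ _); rewrite /nmx.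
  by apply: (@ka_le_sum _ _ _ (@re_letter X)); rewrite mem_filter /det eqxx mem_enum.
- by apply: ka_plus_lub; [apply: (ka_le_trans (ih1 q)) | apply: (ka_le_trans (ih2 q))];
    apply: ka_sum_lub => r; rewrite mem_filter => /andP[hr _];
    apply: (hE q (fun r => reach d f1 q r || reach d f2 q r)); rewrite hr ?orbT.
- apply: (ka_le_trans (ka_le_dotl _ (ih1 q))).
  rewrite ka_dot_suml; apply: ka_sum_lub => s; rewrite mem_filter => /andP[hs _].
  apply: (ka_le_trans (ka_le_dotr _ (ih2 s))).
  rewrite ka_dot_sumr; apply: ka_sum_lub => r; rewrite mem_filter => /andP[hr _].
  apply: (ka_le_trans (mx_star_trans _ _ s q r)).
  apply: (hE q (fun r => [exists s, reach d f1 q s && reach d f2 s r])).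
  by apply/existsP; exists s; apply/andP.
rewrite -(ka_1dot H (re_star f)); apply: ka_star_ind_r.
  apply: ka_le_trans (hE q (connect (reach d f) q) q _) => //.
  exact: mx_star_one.
rewrite ka_dot_suml; apply: ka_sum_lub => s; rewrite mem_filter => /andP[hs _].
apply: (ka_le_trans (ka_le_dotr _ (ih s))).
rewrite ka_dot_sumr; apply: ka_sum_lub => r; rewrite mem_filter => /andP[hr _].
apply: (ka_le_trans (mx_star_trans _ _ s q r)).
apply: (hE q (connect (reach d f) q)).
exact: connect_trans hs (connect1 hr).
Qed.

(** Only [f] is determinised. Each state to which [e] leads is reached by an actual word of [e],
    hence of [f], so it is final; the pieces of [e] given by [le_reach] therefore all lie below
    [dresid] at the initial state. *)
Theorem ka_completeness H e f :
  (forall w, lang e w -> lang f w) -> ka_le H e f.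
Proof.
move=> hef; apply: (ka_le_trans (le_reach H (@dtr f) e (dini f))).
apply: ka_le_trans (dresid_le f H); apply: ka_sum_lub => P.
rewrite mem_filter => /andP[/reach_lang[w /hef/dfa_lang hw hP] _].
by apply: (@ka_le_sum _ _ _ (mx_star (nmx (det (@dtr f))) _)); rewrite mem_enum -hP.
Qed.

End FiniteAlphabet.

(** * Zigzag reductions of words *)

Section Zigzag.
Variables (X : Type) (c : X -> X) (isa : pred X).
Hypothesis cK : involutive c.
Hypothesis isac : forall a, isa (c a) = isa a.
Implicit Types (x y z w : seq X).

Definition rc w := rev (map c w).

Lemma rc_cat u v : rc (u ++ v) = rc v ++ rc u.
Proof. by rewrite /rc map_cat rev_cat. Qed.

Lemma rcK : involutive rc.
Proof. by move=> w; rewrite /rc map_rev revK mapK. Qed.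

(* One parallel round of reductions: disjoint factors [x (rc x) x] become [x],
   and letters satisfying [isa] may be inserted. *)
Inductive zz : seq X -> seq X -> Prop :=
| zz_nil : zz [::] [::]
| zz_cons a z w : zz z w -> zz (a :: z) (a :: w)
| zz_ins a z w : isa a -> zz z w -> zz z (a :: w)
| zz_zig x z w : zz z w -> zz (x ++ rc x ++ x ++ z) (x ++ w).

Lemma zz_refl w : zz w w.
Proof. by elim: w => [|a w ih]; constructor. Qed.

Lemma zz_cat z w z' w' : zz z w -> zz z' w' -> zz (z ++ z') (w ++ w').
Proof.
elim=> // [a y v _ ih|a y v ha _ ih|x y v _ ih] /ih h.
- exact: zz_cons.
- exact: zz_ins.
by rewrite -!catA; apply: zz_zig.
Qed.

Lemma zz_cat2l x z w : zz z w -> zz (x ++ z) (x ++ w).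
Proof. exact: zz_cat (zz_refl x). Qed.

Lemma zz_rc z w : zz z w -> zz (rc z) (rc w).
Proof.
elim=> [|a y v _ ih|a y v ha _ ih|x y v _ ih]; first exact: zz_nil.
- by rewrite /rc !map_cons !rev_cons -!cats1; apply: zz_cat => //; apply: zz_refl.
- rewrite /rc map_cons rev_cons -cats1 -[rev (map c y)]cats0.
  by apply: zz_cat => //; apply: zz_ins; [rewrite isac | exact: zz_nil].
rewrite !rc_cat rcK -!catA; apply: (zz_cat ih).
by have := zz_zig (rc x) zz_nil; rewrite rcK !cats0.
Qed.

Fixpoint stepN N z w : Prop :=
  if N is N'.+1 then exists2 y, zz z y & stepN N' y w else z = w.

Lemma stepN_refl N w : stepN N w w.
Proof. by elim: N => //= N ih; exists w; [exact: zz_refl|]. Qed.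

Lemma stepN_trans N N' y z w : stepN N z y -> stepN N' y w -> stepN (N + N') z w.
Proof.
elim: N z => [|N ih] z /=; first by move=> ->.
by move=> [x h1 /ih h2 /h2 h3]; exists x.
Qed.

Lemma stepN_cat N z w z' w' :
  stepN N z w -> stepN N z' w' -> stepN N (z ++ z') (w ++ w').
Proof.
elim: N z z' => [|N ih] z z' /=; first by move=> -> ->.
by move=> [x h1 h2] [y h3 h4]; exists (x ++ y); [exact: zz_cat | exact: ih].
Qed.

Lemma stepN_rc N z w : stepN N z w -> stepN N (rc z) (rc w).
Proof.
elim: N z => [|N ih] z /=; first by move=> ->.
by move=> [x /zz_rc h1 /ih h2]; exists (rc x).
Qed.

Section Walks.
Variable w : seq X.

Definition seg i j := take (j - i) (drop i w).

Lemma seg_nil i j : j <= i -> seg i j = [::].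
Proof. by rewrite -subn_eq0 /seg => /eqP->; rewrite take0. Qed.

Lemma seg_cat i j k : i <= j -> j <= k -> seg i j ++ seg j k = seg i k.
Proof.
move=> ij jk; have -> : seg j k = take (k - j) (drop (j - i) (drop i w)).
  by rewrite drop_drop subnK.
by rewrite /seg -takeD; congr take; lia.
Qed.

Lemma seg_full : seg 0 (size w) = w.
Proof. by rewrite /seg subn0 drop0 take_size. Qed.

(* Straight forms of walks: each [St_cons] goes down from level [P] to level
   [b], then up to [P']; the bounds [l] on this descent and [L] on the next one
   make every other descent disjoint. *)
Inductive staircase (t : nat) : nat -> nat -> nat -> seq X -> Prop :=
| St_end l L : staircase t l L t [::]
| St_cons l L b P L' P' z :
    l <= b -> b <= P -> L <= P -> P <= L' -> L' <= P' -> P' <= t ->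
    staircase t (maxn L b) L' P' z ->
    staircase t l L P (rc (seg b P) ++ seg b P' ++ z).

(** Consecutive zigzags may share letters, so they are reduced in alternate rounds. The first clause
    treats the current descent in the first round, the second clause in the second round. The
    prefixes [seg l P] and [seg L P] are the stretches of the preceding ascent left at the disposal
    of the round concerned. *)
Lemma staircase_reduce t l L P z : staircase t l L P z ->
  l <= P -> L <= P -> P <= t ->
  (exists2 y, zz (seg l P ++ z) (seg l P ++ y) & zz (seg L P ++ y) (seg L t)) /\
  (exists2 y, zz z y & zz (seg l P ++ y) (seg l t)).
Proof.
elim=> {l L P z} [l L|l L b P L' P' z lb bP LP PL' LP' Pt _ ih] h1 h2 h3.
  by split; exists [::]; rewrite ?cats0; try exact: zz_refl; apply: zz_nil.
(* Each clause uses the other clause for the tail: the next descent belongs to the other round. *)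
have [||//|[y1 ya ya'] [y2 yb yb']] := ih; try lia.
have zig v v' : zz v v' ->
    zz (seg l P ++ rc (seg b P) ++ seg b P' ++ v) (seg l P ++ seg P P' ++ v').
  move=> hv; rewrite -(seg_cat lb bP) -(@seg_cat b P P') ?(leq_trans PL') //.
  rewrite -!catA; apply: zz_cat2l; apply: zz_zig.
  exact: zz_cat2l.
split.
  exists (seg P P' ++ y2); first exact: zig.
  rewrite catA seg_cat; try lia.
  rewrite -(@seg_cat L (maxn L b) P'); try lia.
  rewrite -(@seg_cat L (maxn L b) t); try lia.
  by rewrite -catA; apply: zz_cat2l.
exists (rc (seg b P) ++ seg b P' ++ y1).
  apply: zz_cat2l; rewrite -(@seg_cat b (maxn L b) P'); try lia.
  by rewrite -!catA; apply: zz_cat2l.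
rewrite -(@seg_cat l P t); try lia.
rewrite -(seg_cat lb bP) -(@seg_cat b P P'); try lia.
rewrite -!catA; apply: zz_cat2l; apply: zz_zig.
rewrite -(@seg_cat P L' P'); try lia.
rewrite -(@seg_cat P L' t); try lia.
by rewrite -catA; apply: zz_cat2l.
Qed.

Definition adj (i j : nat) := (j == i.+1) || (i == j.+1).

(** At most one factor is nonempty: the letters read going up, or their converse read going down. *)
Definition labs i j := seg i j ++ rc (seg j i).
Definition labp p h := flatten (pairmap labs p h).

Lemma labp_cat p h1 h2 : labp p (h1 ++ h2) = labp p h1 ++ labp (last p h1) h2.
Proof. by rewrite /labp pairmap_cat flatten_cat. Qed.

Lemma labp_rev p h : labp (last p h) (rev (belast p h)) = rc (labp p h).
Proof.
elim: h p => [|q h ih] p //=.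
rewrite rev_cons -cats1 labp_cat ih /labp /= rc_cat; congr (_ ++ _).
have -> : last (last q h) (rev (belast q h)) = q.
  by case: h {ih} => //= r h; rewrite rev_cons last_rcons.
by rewrite cats0 /labs rc_cat rcK.
Qed.

Lemma path_ivt p h i : path adj p h ->
  (p <= i <= last p h) || (last p h <= i <= p) -> i \in p :: h.
Proof.
elim: h p => [|q h ih] p /=; first by rewrite inE; lia.
rewrite {1}/adj => /andP[h1 /ih h2] h3.
case: (eqVneq i p) => [->|ip]; first exact: mem_head.
by rewrite inE h2 ?orbT //; lia.
Qed.

Lemma path_above p h i : path adj p h -> i \notin h -> i < last p h ->
  i <= p -> all (fun j => i < j) h.
Proof.
elim: h p => [|q h ih] p //= /andP[h1 h2]; rewrite inE negb_or => /andP[iq ih'] il ip.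
have qi : i < q.
  rewrite ltn_neqAle iq leqNgt; apply/negP => qi.
  have : i \in q :: h by apply: path_ivt => //; rewrite (ltnW qi) (ltnW il).
  by rewrite inE (negPf iq) (negPf ih').
rewrite qi; apply: (ih q) => //; exact: ltnW.
Qed.

Lemma mem_split_last (T : eqType) (a : T) (s : seq T) : a \in s ->
  exists s1 s2, s = s1 ++ a :: s2 /\ a \notin s2.
Proof.
elim: s => // b s ih; rewrite inE; case: (boolP (a \in s)) => [/ih|ns].
  by move=> [s1 [s2 [-> h]]] _; exists (b :: s1), s2.
by rewrite orbF => /eqP ab; exists [::], s; rewrite -ab ns.
Qed.

Lemma mem_split_first (T : eqType) (a : T) (s : seq T) : a \in s ->
  exists s1 s2, s = s1 ++ a :: s2 /\ a \notin s1.
Proof.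
elim: s => // b s ih; rewrite inE; case: eqVneq => [->|ab] /=.
  by exists [::], s.
move=> /ih[s1 [s2 [-> h]]]; exists (b :: s1), s2; split=> //.
by rewrite inE negb_or ab.
Qed.

Lemma exists_max (s : seq nat) : s != [::] ->
  exists2 M, M \in s & all (fun i => i <= M) s.
Proof.
elim: s => // a [|b s] ih _; first by exists a; rewrite ?mem_head //= leqnn.
have [//|M Ms hM] := ih; case: (leqP a M) => aM.
  exists M; first by rewrite in_cons Ms orbT.
  by apply/allP => i; rewrite in_cons => /orP[/eqP->|/(allP hM)].
exists a; first exact: mem_head.
apply/allP => i; rewrite in_cons => /orP[/eqP->//|/(allP hM) iM].
exact: leq_trans iM (ltnW aM).
Qed.

Lemma exists_min (s : seq nat) : s != [::] ->
  exists2 M, M \in s & all (fun i => M <= i) s.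
Proof.
elim: s => // a [|b s] ih _; first by exists a; rewrite ?mem_head //= leqnn.
have [//|M Ms hM] := ih; case: (leqP M a) => aM.
  exists M; first by rewrite in_cons Ms orbT.
  by apply/allP => i; rewrite in_cons => /orP[/eqP->|/(allP hM)].
exists a; first exact: mem_head.
apply/allP => i; rewrite in_cons => /orP[/eqP->//|/(allP hM) iM].
exact: leq_trans (ltnW aM) iM.
Qed.

Lemma cat_eq_tail (T : eqType) (s1 s2 t1 t2 : seq T) a :
  s1 ++ s2 = t1 ++ a :: t2 -> a \notin s1 ->
  exists t, s2 = t ++ a :: t2.
Proof.
elim: s1 t1 => [|b s1 ih] t1 /=; first by move=> -> _; exists t1.
case: t1 => [|d t1] /= [e1 e2]; first by rewrite e1 mem_head.
by rewrite inE negb_or => /andP[_]; apply: ih e2.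
Qed.

Definition straightens m N := forall p h, path adj p h ->
  all (fun i => p <= i <= last p h) h ->
  (forall i, count_mem i (p :: h) <= m) ->
  stepN N (labp p h) (seg p (last p h)).

(** The reversed walk ascends, reads the converse word, and rounds commute with [rc]. *)
Lemma straightens_down m N p h : straightens m N -> path adj p h ->
  all (fun i => last p h <= i <= p) h ->
  (forall i, count_mem i (p :: h) <= m) ->
  stepN N (labp p h) (rc (seg (last p h) p)).
Proof.
move=> hm hp hl hc; rewrite -[labp p h]rcK -labp_rev; apply: stepN_rc.
set q := last p h; set r := rev (belast p h).
have er : q :: r = rev (p :: h) by rewrite (lastI p h) rev_rcons.
have eq_p : last q r = p.
  by rewrite /q /r; case: (h) => //= a s; rewrite rev_cons last_rcons.
rewrite -eq_p; apply: hm.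
- rewrite rev_path; apply: sub_path hp => i j; rewrite /adj; lia.
- rewrite eq_p; apply/allP => i hi.
  have : i \in q :: r by rewrite inE hi orbT.
  rewrite er mem_rev inE => /orP[/eqP->|/(allP hl) //].
  rewrite leqnn andbT /q; case: (h) hl => [|a s] // hl.
  by have /andP[] := allP hl _ (mem_last a s).
by move=> i; rewrite er count_rev.
Qed.

(** With one visit per level the walk cannot turn, so the word it reads is already straight. *)
Lemma straightens1 : straightens 1 0.
Proof.
move=> p h; elim: h p => [|q h ih] p /=; first by rewrite seg_nil.
move=> /andP[hq hp] /andP[/andP[pq _] hl] hc.
have eq_q : q = p.+1 by move: hq; rewrite /adj; lia.
have np i : i \in q :: h -> p < i.
  move=> hi; rewrite ltn_neqAle; apply/andP; split.
    apply/eqP => ei; move: (hc p) hi; rewrite eqxx -ei -has_pred1 has_count.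
    by rewrite /= ; lia.
  by move: hi; rewrite inE => /orP[/eqP->//|/(allP hl)/andP[]].
rewrite -[labp _ _]/(labs p q ++ labp q h) ih //; last 2 first.
- apply/allP => i hi; have /andP[_ ->] := allP hl _ hi; rewrite andbT eq_q.
  by apply: np; rewrite inE hi orbT.
- by move=> i; apply: leq_trans (leq_addl _ _) (hc i).
rewrite /labs (@seg_nil q p) // cats0 seg_cat //.
by have := np _ (mem_last q h); rewrite {2}eq_q.
Qed.

Lemma count_gt0 (T : eqType) (i : T) s : (0 < count_mem i s) = (i \in s).
Proof. by rewrite -has_count has_pred1. Qed.

(* Walks that visit each level at most [m + 1] times are cut at turning points
   into monotone-in-the-large pieces that visit each level at most [m] times:
   from [P], reached for the first time, go down to the lowest level [b] still
   to be visited, then up to the highest level [P'] visited before the last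
   visit to [P]. *)
Lemma straighten_staircase m N : 0 < m -> straightens m N ->
  forall k h P l L, size h <= k -> path adj P h ->
  all (fun i => i <= last P h) (P :: h) -> all (fun i => l <= i) (P :: h) ->
  L <= P ->
  (forall h1 j h2, h = h1 ++ j :: h2 -> P < j -> all (fun i => L <= i) (j :: h2)) ->
  has (fun i => i < L) h || all (fun i => P <= i) h ->
  (forall i, i < P -> count_mem i (P :: h) <= m) ->
  (forall i, count_mem i (P :: h) <= m.+1) ->
  exists2 z, staircase (last P h) l L P z & stepN N (labp P h) z.
Proof.
move=> m0 hm; elim=> [|k IH] h P l L.
  case: h => // _ _ _ _ _ _ _ _ _; exists [::]; first exact: St_end.
  exact: stepN_refl.
move=> hk hp ht hl LP hex hdisj hc1 hc2; set t := last P h.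
case: (eqVneq h [::]) => [h0|hn0].
  rewrite /t h0; exists [::]; first exact: St_end.
  exact: stepN_refl.
have Pt : P <= t by move: ht => /andP[].
(* Either [h] never goes below [P] and the descent is empty, or it goes below [L]. In the latter
   case its lowest level [b] is below [L], so [hex] keeps everything before the last visit to [b] at
   or below [P]. *)
have [b [hB [hA [eh lB bP aB [aA cases]]]]] : exists b hB hA,
    [/\ h = hB ++ hA, last P hB = b, b <= P, all (fun i => b <= i <= P) hB &
     all (fun i => b <= i) hA /\ (b = P /\ hB = [::] \/ b < P)].
  case: (boolP (all (fun i => P <= i) h)) hdisj => [hall _|_].
    by exists P, [::], h; split=> //; split=> //; left.
  rewrite orbF => /hasP[i0 hi0 iL].
  have [b bh hb] := exists_min hn0.
  have bL : b < L by apply: leq_ltn_trans iL; apply: (allP hb).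
  have [h1 [h2 [eh nb]]] := mem_split_last bh.
  exists b, (rcons h1 b), h2; split; rewrite ?cat_rcons ?last_rcons //.
  - exact: ltnW (leq_trans bL LP).
  - apply/allP => i; rewrite mem_rcons inE => hi; apply/andP; split.
      by apply: (allP hb); rewrite eh mem_cat inE; case/orP: hi => ->; rewrite ?orbT.
    case/orP: hi => [/eqP->|hi]; first exact: ltnW (leq_trans bL LP).
    rewrite leqNgt; apply/negP => Pi.
    have [u [v [eu _]]] := mem_split_last hi.
    have := hex u i (v ++ b :: h2); rewrite eh eu -catA => /(_ erefl Pi).
    by rewrite -cat_cons all_cat /= => /and3P[_]; rewrite leqNgt bL.
  split; last by right; apply: leq_trans bL LP.
  by apply/allP => i hi; apply: (allP hb); rewrite eh mem_cat inE hi !orbT.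
have eP : P :: h = belast P hB ++ b :: hA.
  by rewrite eh -cat_cons lastI lB cat_rcons.
have pA : path adj b hA by move: hp; rewrite eh cat_path lB => /andP[].
have pB : path adj P hB by move: hp; rewrite eh cat_path => /andP[].
have tA : last b hA = t by rewrite /t eh last_cat lB.
have cntA i : count_mem i (b :: hA) <= count_mem i (P :: h).
  by rewrite eP count_cat leq_addl.
have PA : P \in b :: hA by apply: path_ivt => //; rewrite tA bP Pt.
have ltA i : i \in b :: hA -> i <= t.
  by move=> hi; apply: (allP ht); rewrite eP mem_cat hi orbT.
have cB : stepN N (labp P hB) (rc (seg b P)).
  case: cases => [[-> ->]|bltP]; first by rewrite seg_nil //; apply: stepN_refl.
  have := straightens_down hm pB; rewrite lB; apply=> // i.
  have eh' : P :: h = (P :: hB) ++ hA by rewrite eh.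
  have [iP|Pi|->] := ltngtP i P.
  - by apply: leq_trans (hc1 i iP); rewrite eh' count_cat leq_addr.
  - have /count_memPn-> : i \notin P :: hB.
      apply/negP; rewrite inE => /orP[/eqP ei|/(allP aB)/andP[_]].
        by move: Pi; rewrite ei ltnn.
      by rewrite leqNgt Pi.
    by [].
  (* [P] is passed again after [b], on the way up to [t]; this leaves at most [m] of its visits to
     the descent. *)
  have : P \in hA by move: PA; rewrite inE; case: eqVneq bltP => // ->; rewrite ltnn.
  rewrite -count_gt0 => hPA.
  by have := hc2 P; rewrite eh' count_cat; move: hPA; clear; lia.
have cPA : b < P -> count_mem P (b :: hA) <= m.
  move=> bltP; have := hc2 P; rewrite eP count_cat.
  case: (hB) lB => [|j s] /=; first by move=> ePb; rewrite ePb ltnn in bltP.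
  by rewrite eqxx; clear; lia.
(* It remains to cut what follows [b] into an ascent [a] to [P'], with at most [m] visits per level,
   and a shorter tail [h'] that meets the conditions of the induction. *)
suff [P' [L' [a [h' [eA nP' [PL' LP' P't] aa [ca h'1 h'2 h'3 [h'4 h'5]]]]]]] :
  exists P' L' a h', [/\ hA = a ++ h', last b a = P',
    [/\ P <= L', L' <= P' & P' <= t], all (fun i => b <= i <= P') a &
    [/\ forall i, count_mem i (b :: a) <= m,
     all (fun i => maxn L b <= i) (P' :: h'),
     (forall h1 j h2, h' = h1 ++ j :: h2 -> P' < j ->
        all (fun i => L' <= i) (j :: h2)),
     has (fun i => i < L') h' || all (fun i => P' <= i) h' &
     (forall i, i < P' -> count_mem i (P' :: h') <= m) /\ size h' <= k]].
  have eA' : b :: hA = belast b a ++ P' :: h'.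
    by rewrite eA -cat_cons lastI nP' cat_rcons.
  have th' : last P' h' = t by rewrite -tA eA last_cat nP'.
  have [z hz sz] :
      exists2 z, staircase t (maxn L b) L' P' z & stepN N (labp P' h') z.
    rewrite -th'; apply: IH => //.
    - by move: pA; rewrite eA cat_path nP' => /andP[].
    - rewrite th'; apply/allP => i hi; apply: ltA.
      by rewrite eA' mem_cat hi orbT.
    - move=> i; apply: leq_trans (hc2 i).
      by rewrite eP eA' !count_cat addnA leq_addl.
  exists (rc (seg b P) ++ seg b P' ++ z).
    apply: (St_cons _ bP LP PL' LP' P't hz).
    by apply: (allP hl); rewrite eP mem_cat mem_head orbT.
  rewrite eh labp_cat lB eA labp_cat nP'; apply: stepN_cat => //.
  apply: stepN_cat => //; rewrite -nP'; apply: hm => //; last by rewrite nP'.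
  by move: pA; rewrite eA cat_path => /andP[].
have hA_gt i : i < P -> count_mem i (b :: hA) <= m.
  by move=> iP; apply: leq_trans (cntA i) (hc1 i iP).
have maxP i : P <= i -> maxn L b <= i.
  by move=> Pi; rewrite geq_max !(leq_trans _ Pi).
(* If [P] is already the top level, the ascent takes all that remains. *)
have [Plt|tP] := ltnP P t; last first.
  have ePt : P = t by apply/eqP; rewrite eqn_leq Pt.
  exists t, P, hA, [::]; rewrite cats0 ePt; split=> //.
    by apply/allP => i hi; rewrite (allP aA _ hi) ltA // inE hi orbT.
  split=> //.
  + move=> i; have [iP|Pi|->] := ltngtP i P; first exact: hA_gt.
      have /count_memPn-> // : i \notin b :: hA.
      by apply/negP => /ltA; rewrite -ePt leqNgt Pi.
    case: cases => [[ebP hB0]|/cPA //].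
    move: hp hn0 ltA aA; rewrite eh hB0 ebP -ePt /=.
    case: (hA) => //= j s /andP[hj _] _ /(_ j); rewrite !inE eqxx orbT => /(_ isT).
    by move: hj; rewrite /adj; clear; lia.
  + by rewrite /= -ePt maxP.
  + by move=> h1 j h2; case: h1.
  by split=> // i it; rewrite /= gtn_eqF.
(* After its last visit to [P] the walk stays strictly above [P], since it ends at [t]. *)
have [s1 [s2 [e12 nPs2]]] := mem_split_last PA.
have ps2 : path adj P s2.
  have : path adj b hA by [].
  case: (s1) e12 => [|j s] [-> ->] //.
  by rewrite cat_path /= => /and3P[].
have ls2 : last P s2 = t.
  by rewrite -tA -[last b hA]/(last b (b :: hA)) e12 last_cat.
have as2 : all (fun i => P < i) s2 by apply: (@path_above P) => //; rewrite ls2.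
(* If nothing above [P] precedes this last visit, the cut comes one step after it, with [P'] and
   [L'] both equal to [P + 1]. *)
case: (boolP (all (fun i => i <= P) s1)) => hs1.
  case: s2 => [|q s2] in e12 nPs2 ps2 ls2 as2.
    by move: Plt; rewrite -ls2 ltnn.
  have eq_q : q = P.+1.
    by move: ps2 as2 => /andP[+ _] /andP[+ _]; rewrite /adj; clear; lia.
  have [al [eal eA]] : exists al, b :: al = rcons s1 P /\ hA = al ++ q :: s2.
    case: (s1) e12 => [|j s] [-> ->]; first by exists [::].
    by exists (rcons s P); rewrite cat_rcons.
  have alP i : i \in b :: al -> i <= P.
    by rewrite eal mem_rcons inE => /orP[/eqP->|/(allP hs1)].
  have qs2 i : i \in q :: s2 -> P < i by move/(allP as2).
  exists q, P.+1, (rcons al q), s2; rewrite cat_rcons last_rcons; split=> //.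
  - by rewrite eq_q.
  - apply/allP => i; rewrite mem_rcons inE => /orP[/eqP->|hi].
      by rewrite leqnn eq_q (leq_trans bP).
    rewrite (allP aA) ?eA ?mem_cat ?hi // eq_q ltnW // ltnS.
    by apply: alP; rewrite inE hi orbT.
  split=> //.
  - move=> i; rewrite -rcons_cons -cats1 count_cat /= addn0.
    rewrite -[_ + count_mem i al]/(count_mem i (b :: al)).
    have le_al : count_mem i (b :: al) <= count_mem i (b :: hA).
      by rewrite eA -cat_cons count_cat leq_addr.
    have [iP|Pi|eiP] := ltngtP i P.
    + rewrite [q == i]gtn_eqF ?eq_q ?addn0; last by rewrite ltnS ltnW.
      exact: leq_trans le_al (hA_gt i iP).
    + have /count_memPn-> : i \notin b :: al by apply/negP => /alP; rewrite leqNgt Pi.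
      by rewrite add0n; case: (q == i).
    rewrite [q == i]gtn_eqF ?eq_q ?eiP ?addn0 //.
    case: cases => [[ebP hB0]|/cPA h1]; last by rewrite -eiP; apply: leq_trans le_al _; rewrite eiP.
    suff -> : al = [::] by rewrite /= ebP eqxx addn0.
    case: (al) alP eA => // j s alP eA.
    have := alP j; rewrite !inE eqxx orbT => /(_ isT).
    move: pA aA; rewrite eA /= => /andP[hj _] /andP[bj _].
    by move: hj bj; rewrite /adj ebP; clear; lia.
  - by apply/allP => i /qs2/ltnW/maxP.
  - move=> h1 j h2 es2 _; apply/allP => i hi; apply: qs2.
    by rewrite inE es2 mem_cat hi !orbT.
  - by apply/orP; right; apply/allP => i hi; rewrite eq_q; apply: qs2; rewrite inE hi orbT.
  split; last by move: hk; rewrite eh eA !size_cat /=; clear; lia.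
  move=> i; rewrite eq_q ltnS => iP.
  have /count_memPn-> // : i \notin P.+1 :: s2.
  by rewrite -eq_q; apply/negP => /qs2; rewrite ltnNge iP.
have s1n0 : s1 != [::] by case: (s1) hs1.
(* Otherwise the cut is at the first visit to the highest level [M] seen before the last visit to
   [P]. The tail then returns to [P], which is below [L' = P + 1]. *)
have [M Ms1 hM] := exists_max s1n0.
have PM : P < M.
  rewrite ltnNge; apply: contra hs1 => MP.
  by apply/allP => i /(allP hM) iM; apply: leq_trans iM MP.
have [s3 [s4 [e34 nM]]] := mem_split_first Ms1.
have [al [es3 eA]] : exists al, s3 = b :: al /\ hA = al ++ M :: (s4 ++ P :: s2).
  case: (s3) e34 e12 => [|j s] -> /=; last by move=> [<- ->]; exists s; rewrite -catA.
  by move=> [eb]; move: PM; rewrite -eb ltnNge bP.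
set h' := s4 ++ P :: s2 in eA *.
have cntE i : count_mem i (b :: hA) = count_mem i (b :: al) + count_mem i (M :: h').
  by rewrite eA -cat_cons count_cat.
have alM i : i \in b :: al -> i <= M.
  by rewrite -es3 => hi; apply: (allP hM); rewrite e34 mem_cat hi.
have pM : path adj M h'.
  by move: pA; rewrite eA cat_path /= => /and3P[].
have paM : path adj b (rcons al M).
  by move: pA; rewrite eA -cat_rcons cat_path => /andP[].
(* Levels from [P] up to [M] are met on the way up to [M] and again on the way back to [P]; so each
   side of the cut has at most [m] of their [m + 1] visits. *)
have visit i : P <= i -> i < M -> (i \in b :: al) /\ (i \in h').
  move=> Pi iM; split.
    have : i \in b :: rcons al M.
      by apply: path_ivt => //; rewrite last_rcons (leq_trans bP Pi) ltnW.
    by rewrite -rcons_cons mem_rcons inE ltn_eqF.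
  have : i \in M :: rcons s4 P.
    apply: path_ivt; last by rewrite last_rcons Pi (ltnW iM) orbT.
    by move: pM; rewrite /h' -cat_rcons cat_path => /andP[].
  by rewrite inE ltn_eqF //= /h' -cat_rcons mem_cat => ->.
exists M, P.+1, (rcons al M), h'; rewrite cat_rcons last_rcons; split=> //.
- split; [exact: leqnSn | exact: PM | apply: ltA].
  by rewrite eA inE mem_cat mem_head !orbT.
- apply/allP => i; rewrite mem_rcons inE => /orP[/eqP->|hi].
    by rewrite leqnn (leq_trans bP (ltnW PM)).
  by rewrite (allP aA) ?eA ?mem_cat ?hi // alM // inE hi orbT.
split=> //.
- move=> i; rewrite -rcons_cons -cats1 count_cat /= addn0.
  rewrite -[_ + count_mem i al]/(count_mem i (b :: al)).
  have := cntE i => ci.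
  have [iM|Mi|->] := ltngtP i M.
  + rewrite addn0; case: (leqP P i) => [Pi|/hA_gt]; last by move: ci; clear; lia.
    have [_] := visit i Pi iM; rewrite -count_gt0 => hi.
    by have := hc2 i; have := cntA i; move: ci hi; rewrite /=; clear; lia.
  + have /count_memPn-> : i \notin b :: al by apply/negP => /alM; rewrite leqNgt Mi.
    by [].
  by have /count_memPn-> : M \notin b :: al; rewrite -?es3.
- apply/allP => i hi; rewrite geq_max; apply/andP; split; last first.
    by apply: (allP aA); rewrite eA mem_cat hi orbT.
  have := hex (hB ++ al) M h'; rewrite eh eA catA => /(_ erefl PM).
  by move/allP; apply.
(* Levels above [M] occur only after the last visit to [P], where the walk remains above [P]. *)
- move=> h1 j h2 ej Mj.
  have [|t0 et0] := cat_eq_tail ej.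
    apply/negP => js4; move: Mj; rewrite ltnNge (allP hM) //.
    by rewrite e34 mem_cat inE js4 !orbT.
  case: t0 et0 => [|j' t0] [eP' es2].
    by move: Mj PM; rewrite eP'; clear; lia.
  by apply/allP => i hi; apply: (allP as2); rewrite es2 mem_cat hi orbT.
- by apply/orP; left; apply/hasP; exists P; rewrite // /h' mem_cat mem_head orbT.
split; last by move: hk; rewrite eh eA (size_cat hB) (size_cat al) [size (_ :: _)]/=; clear; lia.
move=> i iM; case: (leqP P i) => [Pi|/hA_gt]; last first.
  by apply: leq_trans; rewrite cntE leq_addl.
have [hi _] := visit i Pi iM; move: hi; rewrite -count_gt0 => hi.
rewrite -ltnS; apply: leq_trans (hc2 i); apply: leq_trans (cntA i).
by rewrite cntE; move: hi; case: (count_mem i (b :: al)) => // n _; rewrite addSn ltnS leq_addl.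
Qed.

Lemma straightens_step m N : 0 < m -> straightens m N -> straightens m.+1 (N + 2).
Proof.
move=> m0 hm p h hp hl hc; set t := last p h.
have pt : p <= t.
  rewrite /t; case: (h) hl => // a s hl.
  by have /andP[] := allP hl _ (mem_last a s).
have lo : all (fun i => p <= i) h by apply: sub_all hl => i /andP[].
have [z hz sz] : exists2 z, staircase t p p p z & stepN N (labp p h) z.
  apply: (straighten_staircase m0 hm (leqnn _) hp) => //.
  - by rewrite -/t /= pt; apply: sub_all hl => i /andP[].
  - by rewrite /= leqnn.
  - move=> h1 j h2 e _; apply/allP => i hi; apply: (allP lo).
    by rewrite e mem_cat hi orbT.
  - by rewrite lo orbT.
  - move=> i ip; have /count_memPn-> // : i \notin p :: h.
    by apply/negP; rewrite inE => /orP[/eqP|/(allP lo)]; move: ip; clear; lia.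
apply: stepN_trans sz _.
(* With [l], [L] and [P] all equal to [p] the prefixes are empty, and the first clause gives exactly
   two rounds from [z] to the straight word. *)
have [[y h1 h2] _] := staircase_reduce hz (leqnn p) (leqnn p) pt.
rewrite !(@seg_nil p p) // in h1 h2.
by exists y; [exact: h1 | exists (seg p t)].
Qed.

Lemma straightensP m : straightens m.+1 (m * 2).
Proof.
elim: m => [|m ih]; first exact: straightens1.
by rewrite mulSn addnC; apply: straightens_step.
Qed.

End Walks.
End Zigzag.

(** * Rounds of reduction as operations on expressions *)

Section Converse.
Local Open Scope regex_scope.
Variables (X : finType) (c : X -> X) (isa : pred X).
Hypothesis cK : involutive c.

Fixpoint re_conv (e : regex X) : regex X :=
  match e with
  | re_zero => 0
  | re_one => 1
  | re_letter a => re_letter (c a)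
  | re_plus e1 e2 => re_conv e1 + re_conv e2
  | re_dot e1 e2 => re_conv e2 * re_conv e1
  | re_star e1 => re_star (re_conv e1)
  end.

Lemma lang_conv e w : lang (re_conv e) w -> lang e (rc c w).
Proof.
elim: e w => [|||e1 ih1 e2 ih2|e1 ih1 e2 ih2|e ih] w //=.
- by move->.
- by move=> a ->; rewrite /rc /= cK.
- by case=> [/ih1|/ih2]; [left | right].
- move=> [u [v [-> /ih2 hu /ih1 hv]]]; rewrite rc_cat.
  by exists (rc c v), (rc c u).
elim=> [|u v /ih hu _ hv]; first exact: lang_star_nil.
rewrite rc_cat; apply: lang_star_trans hv _.
by rewrite -[rc c u]cats0; constructor => //; constructor.
Qed.

Variable H : hypotheses X.
Hypothesis Hcnv : forall e, ka_le H e (e * re_conv e * e).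
Hypothesis Hisa : forall a, isa a -> ka_le H (re_letter a) 1.

Section Step.
Variable e : regex X.
Let Q := dst e.
Let d : Q -> X -> Q := @dtr X e.

(* Reading [x] computes the actions of [x] and of its converse on [Q]. *)
Let act := ({ffun Q -> Q} * {ffun Q -> Q})%type.
Definition act_step (m : act) (a : X) : act :=
  ([ffun q => d (m.1 q) a], [ffun q => m.2 (d q (c a))]).
Definition act_one : act := ([ffun q => q], [ffun q => q]).

Lemma act_run x :
  foldl act_step act_one x =
  ([ffun q => foldl d q x], [ffun q => foldl d q (rc c x)]).
Proof.
elim/last_ind: x => [|x a ih]; first by [].
rewrite foldl_rcons ih /act_step /=; congr (_, _); apply/ffunP => q.
  by rewrite !ffunE foldl_rcons.
by rewrite !ffunE /rc map_rcons rev_rcons.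
Qed.

(** Its words are the [x] such that [x], [rc x] and [x] lead from [p] through [p1] and [p2] to [q].
    Prescribing the intermediate states is what makes this a regular condition. *)
Definition block (p p1 p2 q : Q) : regex X :=
  dfa_re act_step
    (fun m : act => [&& m.1 p == p1, m.2 p1 == p2 & m.1 p2 == q]) act_one.

Lemma lang_block p p1 p2 q x : lang (block p p1 p2 q) x <->
  [&& foldl d p x == p1, foldl d p1 (rc c x) == p2 & foldl d p2 x == q].
Proof. by rewrite lang_dfa_re act_run /= !ffunE. Qed.

Definition step_mx (p q : Q) : regex X :=
  nmx (det d) p q +
  (if p == q then re_sum (@re_letter X) (enum isa) else 0) +
  re_sum (fun r : Q * Q => block p r.1 r.2 q) (enum {: Q * Q}).

(** For a block B the hypothesis gives B <= B B° B. The three factors may contribute three different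
    words, but the first leads from [p] to [p1], the second from [p1] to [p2] and the third from
    [p2] to [q]; so the product is below the residual by completeness. *)
Lemma step_mx_le p q : ka_le H (step_mx p q * dresid q) (dresid p).
Proof.
have hd r w : lang (dresid r) w <-> dfin (foldl d r w) by apply: lang_dfa_re.
rewrite !ka_dotDl; apply: ka_plus_lub; first apply: ka_plus_lub.
- apply: ka_completeness => _ [u [v [-> /lang_nmx[a /eqP ha ->] /hd hv]]].
  by apply/hd; rewrite foldl_cat /= ha.
- case: eqP => [->|_]; last by rewrite ka_0dot; apply: ka_le0.
  rewrite ka_dot_suml; apply: ka_sum_lub => a; rewrite mem_enum => /Hisa ha.
  by apply: (ka_le_trans (ka_le_dotl _ ha)); rewrite ka_1dot.
rewrite ka_dot_suml; apply: ka_sum_lub => -[p1 p2] _ /=.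
apply: (ka_le_trans (ka_le_dotl _ (Hcnv _))).
apply: ka_completeness => _ [_ [v [-> [_ [x3 [-> [x1 [x2 [-> h1 h2]]] h3]]] /hd hv]]].
move: h1 h2 h3 => /lang_block/and3P[/eqP h1 _ _].
move=> /lang_conv/lang_block/and3P[_ +] _; rewrite rcK // => /eqP h2.
move=> /lang_block/and3P[_ _ /eqP h3].
by apply/hd; rewrite !foldl_cat h1 h2 h3.
Qed.

Lemma step_mx_zz z w p :
  zz c isa z w -> lang (mx_star step_mx p (foldl d p z)) w.
Proof.
move=> h; elim: h p => {z w} [|a z w _ ih|a z w ha _ ih|x z w _ ih] p.
- exact: lang_mx_star_nil.
- rewrite -[a :: w]cat1s; apply: lang_mx_star_step _ (ih (d p a)).
  by left; left; apply/lang_nmx; exists a; rewrite // /det.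
- rewrite -[a :: w]cat1s; apply: lang_mx_star_step _ (ih p).
  by left; right; rewrite eqxx; apply/lang_sum; exists a; rewrite // mem_enum.
rewrite !foldl_cat; apply: lang_mx_star_step _ (ih _).
right; apply/lang_sum; exists (foldl d p x, foldl d (foldl d p x) (rc c x)).
  by rewrite mem_enum.
by apply/lang_block; rewrite !eqxx.
Qed.

End Step.

Lemma step_regex e : exists2 f, ka_le H f e &
  forall z w, lang e z -> zz c isa z w -> lang f w.
Proof.
exists (re_sum (mx_star (@step_mx e) (dini e)) (enum (@dfin X e))).
  apply: ka_le_trans (dresid_le e H); apply: ka_sum_lub => q.
  rewrite mem_enum => hq.
  apply: ka_le_trans (mx_star_least (@step_mx_le e) (dini e) q).
  rewrite -{1}(ka_dot1 H (mx_star _ _ _)); apply: ka_le_dotr.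
  by apply: ka_completeness => w ->; apply/lang_dfa_re.
move=> z w /dfa_lang hz hzw; apply/lang_sum.
exists (foldl (@dtr X e) (dini e) z); first by rewrite mem_enum.
exact: step_mx_zz.
Qed.

Lemma stepN_regex N e : exists2 f, ka_le H f e &
  forall z w, lang e z -> stepN c isa N z w -> lang f w.
Proof.
elim: N e => [|N ih] e; first by exists e => // z w hz <-.
have [f fe hf] := step_regex e; have [g gf hg] := ih f.
exists g; first exact: ka_le_trans gf fe.
by move=> z w hz [y /(hf _ _ hz) hy]; apply: hg.
Qed.

Local Open Scope nat_scope.

(* A shortest walk of an automaton visits each position at most once in each
   state. *)
Lemma simple_walk (Q : finType) (d : Q -> X -> Q) w q0 h :
  path adj 0 h -> last 0 h = size w -> all (fun i => i <= size w) h ->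
  exists h', [/\ path adj 0 h', last 0 h' = size w,
    all (fun i => i <= size w) h',
    forall i, count_mem i (0 :: h') <= #|Q| &
    foldl d q0 (labp c w 0 h') = foldl d q0 (labp c w 0 h)].
Proof.
pose nxt i q j := foldl d q (labs c w i j).
pose cadj (x y : nat * Q) := adj x.1 y.1 && (y.2 == nxt x.1 x.2 y.1).
have run s i q : path cadj (i, q) s ->
    path adj i (map fst s) /\
    last (i, q) s = (last i (map fst s), foldl d q (labp c w i (map fst s))).
  elim: s i q => //= -[j r] s ih i q /=.
  move=> /andP[/andP[/= -> /eqP->] /ih[hp hl]]; split=> //.
  by rewrite hl /labp /= foldl_cat.
have lift h1 i q : path adj i h1 ->
    exists2 s, path cadj (i, q) s & map fst s = h1.
  elim: h1 i q => [|j h1 ih] i q; first by exists [::].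
  move=> /= /andP[ij /(ih _ (nxt i q j))[s hs <-]].
  by exists ((j, nxt i q j) :: s); rewrite //= {1}/cadj /= ij eqxx.
move=> hp hl ha; have [s hs eh] := lift h 0 q0 hp.
have [_ ls] := run _ _ _ hs; rewrite eh hl in ls.
move: ls; case/shortenP: hs => s' hs' us' sub ls'.
have [hp' ls''] := run _ _ _ hs'; rewrite ls' in ls''; case: ls'' => e1 e2.
exists (map fst s'); split=> //.
- apply/allP => i /mapP[y /(mem_subseq (subseq_refl _)) ys' ->].
  apply: (allP ha); rewrite -eh; apply: map_f; exact: sub.
move=> i; rewrite -[0 :: _]/(map fst ((0, q0) :: s')) count_map -size_filter.
set s1 := filter _ _; have u1 : uniq (map snd s1).
  rewrite map_inj_in_uniq ?filter_uniq // => -[j r] [j' r'].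
  rewrite !mem_filter /= => /andP[/eqP-> _] /andP[/eqP-> _] -> //.
by rewrite -(size_map snd) -(card_uniqP u1) max_card.
Qed.

Lemma walk_regex (isac : forall a, isa (c a) = isa a) e :
  exists2 f, ka_le H f e & forall w h,
    path adj 0 h -> last 0 h = size w -> all (fun i => i <= size w) h ->
    lang e (labp c w 0 h) -> lang f w.
Proof.
(* A simple walk visits each position at most as often as there are states, and [straightensP]
   handles m + 1 visits in 2m rounds. The subset automaton is deterministic, so a walk ending in the
   same state is accepted as well. *)
have [f fe hf] := stepN_regex (#|dst e| * 2) e.
exists f => // w h hp hl ha /dfa_lang hw.
have [h' [hp' hl' ha' hc hr]] := simple_walk (@dtr X e) (dini e) hp hl ha.
rewrite -hr in hw; move/dfa_lang: hw => /hf; apply.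
rewrite -{2}(seg_full w) -hl'; apply: straightensP => // [|i].
  by rewrite hl'.
exact: leq_trans (hc i) (leqnSn _).
Qed.

End Converse.

(** * Relational models *)

Section Relations.
Variables (Y D : Type).
Implicit Types (R : Y -> D -> D -> Prop) (e : regex Y) (w : seq Y).

Fixpoint wrel R w : D -> D -> Prop :=
  if w is a :: w' then fun i j => exists2 k, R a i k & wrel R w' k j
  else fun i j => i = j.

Definition rrel R e i j := exists2 w, lang e w & wrel R w i j.

Lemma wrel_cat R u v i j :
  wrel R (u ++ v) i j <-> exists2 k, wrel R u i k & wrel R v k j.
Proof.
elim: u i => [|a u ih] i /=; first by split=> [h|[k ->]]; first exists i.
split=> [[k h /ih[l h1 h2]]|[l [k h h1] h2]].
  by exists l => //; exists k.
by exists k => //; apply/ih; exists l.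
Qed.

Lemma rrel_plus R e f i j : rrel R (re_plus e f) i j <-> rrel R e i j \/ rrel R f i j.
Proof.
split=> [[w [h|h] hw]|[] [w h hw]]; [left|right|..]; exists w => //.
  by left.
by right.
Qed.

Lemma rrel_dot R e f i j :
  rrel R (re_dot e f) i j <-> exists2 k, rrel R e i k & rrel R f k j.
Proof.
split=> [[_ [u [v [-> hu hv]]] /wrel_cat[k h1 h2]]|[k [u hu h1] [v hv h2]]].
  by exists k; [exists u | exists v].
by exists (u ++ v); [exists u, v | apply/wrel_cat; exists k].
Qed.

Lemma rrel_one R i j : rrel R re_one i j <-> i = j.
Proof. by split=> [[w ->]|->] //; exists [::]. Qed.

Lemma rrel_zero R i j : rrel R re_zero i j <-> False.
Proof. by split=> // -[]. Qed.

Lemma rrel_letter R a i j : rrel R (re_letter a) i j <-> R a i j.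
Proof. by split=> [[w -> [k h <-]]|h] //; exists [:: a] => //; exists j. Qed.

Lemma rrel_star_ind R e (P : D -> D -> Prop) :
  (forall i, P i i) -> (forall i j k, rrel R e i j -> P j k -> P i k) ->
  forall i j, rrel R (re_star e) i j -> P i j.
Proof.
move=> h1 hs i j [w hw]; elim: hw i => [|u v hu _ ih] i /=; first by move->.
by move=> /wrel_cat[k hk /ih]; apply: hs; exists u.
Qed.

Lemma rrel_star_nil R e i : rrel R (re_star e) i i.
Proof. by exists [::]; first constructor. Qed.

Lemma rrel_star_cons R e i j k :
  rrel R e i j -> rrel R (re_star e) j k -> rrel R (re_star e) i k.
Proof.
move=> [u hu h1] [v hv h2]; exists (u ++ v); first by constructor.
by apply/wrel_cat; exists j.
Qed.

Lemma rrel_sound R (H : hypotheses Y) e f :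
  (forall e f, H e f -> forall i j, rrel R e i j -> rrel R f i j) ->
  ka_eq H e f -> forall i j, rrel R e i j <-> rrel R f i j.
Proof.
move=> hH; elim=> {e f}.
- by [].
- by move=> e f _ ih i j; rewrite ih.
- by move=> e f g _ ih1 _ ih2 i j; rewrite ih1.
- by move=> e e' f f' _ ih1 _ ih2 i j; rewrite !rrel_plus ih1 ih2.
- move=> e e' f f' _ ih1 _ ih2 i j; rewrite !rrel_dot.
  by split=> -[k /ih1 h1 /ih2 h2]; exists k.
- move=> e e' _ ih i j; split; move: i j; apply: rrel_star_ind => [|i j k /ih h];
    try exact: rrel_star_nil; exact: rrel_star_cons.
- by move=> e f g i j; rewrite !rrel_plus; tauto.
- by move=> e f i j; rewrite !rrel_plus; tauto.
- by move=> e i j; rewrite !rrel_plus rrel_zero; tauto.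
- by move=> e i j; rewrite !rrel_plus; tauto.
- move=> e f g i j; rewrite !rrel_dot; split.
    move=> [k h1 /rrel_dot[l h2 h3]]; exists l => //.
    by apply/rrel_dot; exists k.
  move=> [k /rrel_dot[l h1 h2] h3]; exists l => //.
  by apply/rrel_dot; exists k.
- move=> e i j; rewrite rrel_dot; split=> [[k h /rrel_one <-]|h] //.
  by exists j; last exact/rrel_one.
- move=> e i j; rewrite rrel_dot; split=> [[k /rrel_one -> h]|h] //.
  by exists i; first exact/rrel_one.
- by move=> e i j; rewrite rrel_dot; split=> [[k _ /rrel_zero]|/rrel_zero].
- by move=> e i j; rewrite rrel_dot; split=> [[k /rrel_zero]|/rrel_zero].
- move=> e f g i j; rewrite rrel_plus !rrel_dot; split.
    by move=> [k /rrel_plus[h|h] h']; [left | right]; exists k.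
  by move=> [] [k h h']; exists k => //; apply/rrel_plus; [left | right].
- move=> e f g i j; rewrite rrel_plus !rrel_dot; split.
    by move=> [k h' /rrel_plus[h|h]]; [left | right]; exists k.
  by move=> [] [k h h']; exists k => //; apply/rrel_plus; [left | right].
- move=> e i j; rewrite !rrel_plus rrel_one rrel_dot.
  split=> [[[->|[k h1 h2]]|//]|]; last by right.
    exact: rrel_star_nil.
  exact: rrel_star_cons h1 h2.
- move=> x y z _ ih i j; rewrite rrel_plus; split=> [[|//]|]; last by right.
  move=> /rrel_dot[k h h']; move: i k h h'; apply: rrel_star_ind => [i h|i k l h ihl h'].
    by apply/ih; rewrite !rrel_plus; left; left.
  by apply/ih; rewrite !rrel_plus rrel_dot; left; right; exists k => //; apply: ihl.
- move=> x y z _ ih i j; rewrite rrel_plus; split=> [[|//]|]; last by right.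
  move=> /rrel_dot[k h h'].
  have {}h : rrel R y i k by apply/ih; rewrite !rrel_plus; left; left.
  move: k j h' h; apply: rrel_star_ind => // k l m h1 h2 h3; apply: h2.
  by apply/ih; rewrite !rrel_plus rrel_dot; left; right; exists k.
move=> e f h i j; rewrite rrel_plus; split=> [[/(hH _ _ h)|]|] //; by right.
Qed.

(** Validity turns each closure step around: a run of a word of [e] yields a run of some word of
    [f]. This bounds the closure without any analysis of its derivations. *)
Lemma wrel_closure R (H : hypotheses Y) (L : language Y) w i j :
  (forall e f, H e f -> forall i j, rrel R e i j -> rrel R f i j) ->
  Defs.closure H L w -> wrel R w i j -> exists2 z, L z & wrel R z i j.
Proof.
move=> hH hw; elim: hw i j => {w} [w hw|e f u v w hef _ ih hw] i j h.
  by exists w.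
move: h => /wrel_cat[k h1 /wrel_cat[l h2 h3]].
have [w' hw' h4] := hH _ _ hef k l (ex_intro2 _ _ w hw h2).
by apply: (ih w' hw'); apply/wrel_cat; exists k => //; apply/wrel_cat; exists l.
Qed.
End Relations.

Lemma wrel_map (Y Z D : Type) (g : Y -> Z) (R : Z -> D -> D -> Prop) w i j :
  wrel R (map g w) i j <-> wrel (fun a => R (g a)) w i j.
Proof.
elim: w i => //= a w ih i.
by split=> -[k h /ih h']; exists k.
Qed.

Lemma lang_map (Y Z : Type) (g : Y -> Z) (e : regex Y) w :
  lang (re_map g e) w <-> exists2 v, lang e v & w = map g v.
Proof.
elim: e w => [|||e1 ih1 e2 ih2|e1 ih1 e2 ih2|e ih] w /=.
- by split=> // -[].
- by split=> [->|[v -> ->]] //; exists [::].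
- by move=> w0; split=> [->|[v -> ->]] //; exists [:: w].
- rewrite ih1 ih2; split=> [[] [v h ->]|[v [h|h] ->]].
  + by exists v => //; left.
  + by exists v => //; right.
  + by left; exists v.
  by right; exists v.
- split=> [[u [v [-> /ih1[u' hu ->] /ih2[v' hv ->]]]]|[_ [u [v [-> hu hv]]] ->]].
    by exists (u' ++ v'); rewrite ?map_cat //; exists u', v'.
  exists (map g u), (map g v); rewrite map_cat; split=> //.
    by apply/ih1; exists u.
  by apply/ih2; exists v.
split.
  elim=> [|u v /ih[u' hu ->] _ [v' hv ->]]; first by exists [::]; first constructor.
  by exists (u' ++ v'); [constructor | rewrite map_cat].
move=> [v hv ->]; elim: hv => [|u u' hu _ h]; first by constructor.
by rewrite map_cat; constructor => //; apply/ih; exists u.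
Qed.

Lemma rrel_map (Y Z D : Type) (g : Y -> Z) (R : Z -> D -> D -> Prop) e i j :
  rrel R (re_map g e) i j <-> rrel (fun a => R (g a)) e i j.
Proof.
split=> [[_ /lang_map[v hv ->] /wrel_map h]|[v hv h]]; first by exists v.
by exists (map g v); [apply/lang_map; exists v | apply/wrel_map].
Qed.

Fixpoint beval (O : Type) (v : O -> bool) (p : bexp O) : bool :=
  match p with
  | b_var o => v o
  | b_top => true
  | b_bot => false
  | b_not q => ~~ beval v q
  | b_and q r => beval v q && beval v r
  | b_or q r => beval v q || beval v r
  end.

Section KatcModel.
Variables (S O D : Type) (la : S -> D -> D -> Prop) (va : D -> O -> bool).

Definition katc_rel (a : dbl (S + bexp O)) (i j : D) : Prop :=
  match a with
  | inl (inl s) => la s i j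
  | inr (inl s) => la s j i
  | inl (inr p) | inr (inr p) => i = j /\ beval (va i) p
  end.

Lemma rrel_conv e i j :
  rrel katc_rel e i j -> rrel katc_rel (conv e) j i.
Proof.
elim: e i j => [|||e1 ih1 e2 ih2|e1 ih1 e2 ih2|e ih] i j //=.
- by move=> /rrel_zero.
- by move=> /rrel_one->; apply/rrel_one.
- move=> a /rrel_letter h; apply/rrel_letter.
  by case: i h => -[s|p] //= [-> ->].
- by move=> /rrel_plus[/ih1|/ih2] h; apply/rrel_plus; [left | right].
- by move=> /rrel_dot[k /ih1 h1 /ih2 h2]; apply/rrel_dot; exists k.
move: i j; apply: rrel_star_ind => [i|i j k /ih h hs].
  exact: rrel_star_nil.
(* The converse reverses the order of the iterations, so the new step has to be appended at the far
   end of the star. *)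
apply: (rrel_star_ind (P := fun k j => rrel katc_rel (re_star (conv e)) j i ->
   rrel katc_rel (re_star (conv e)) k i) _ _ hs).
- by [].
- by move=> a b d h1 h2 /h2; apply: rrel_star_cons.
apply: rrel_star_cons h _; exact: rrel_star_nil.
Qed.

Lemma katc_valid e f : H_katc S O e f ->
  forall i j, rrel katc_rel e i j -> rrel katc_rel f i j.
Proof.
have key e' f' : kat_eqn S O e' f' -> forall i j,
    rrel katc_rel (re_map inl e') i j <-> rrel katc_rel (re_map inl f') i j.
  case=> [p q h|p q|p q||] i j; rewrite /= ?rrel_letter ?rrel_dot ?rrel_plus
    ?rrel_zero ?rrel_one ?rrel_letter /=.
  - suff -> : beval (va i) p = beval (va i) q by [].
    case: h => * /=; do ?case: (beval _ _) => //.
  - split=> [[-> /andP[h1 h2]]|[k /rrel_letter[<- h1] /rrel_letter[<- h2]]].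
      by exists j; apply/rrel_letter.
    by rewrite h1 h2.
  - split=> [[-> /orP[h|h]]|[[-> h]|[-> h]]]; rewrite ?h ?orbT //.
      by left.
    by right.
  - by split=> // -[].
  - by split=> [[]|].
case=> [[e' [f' [[] h -> ->]]]|[]|[[]]] /=.
- by move=> i j /(key _ _ h).
- by move=> i j /(key _ _ h).
- move=> e' i j h; apply/rrel_dot; exists i => //; apply/rrel_dot; exists j => //.
  exact: rrel_conv.
- by move=> p i j /rrel_letter h; apply/rrel_letter.
by move=> p i j /rrel_letter h; apply/rrel_letter.
Qed.

End KatcModel.

Section Substitution.
Local Open Scope regex_scope.

Fixpoint re_subst (Y Z : Type) (s : Y -> regex Z) (e : regex Y) : regex Z :=
  match e with
  | re_zero => 0
  | re_one => 1
  | re_letter a => s a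
  | re_plus e1 e2 => re_subst s e1 + re_subst s e2
  | re_dot e1 e2 => re_subst s e1 * re_subst s e2
  | re_star e1 => re_star (re_subst s e1)
  end.

End Substitution.

Lemma re_map_sum (Y Z T : Type) (g : Y -> Z) (F : T -> regex Y) s :
  re_map g (re_sum F s) = re_sum (fun x => re_map g (F x)) s.
Proof. by elim: s => //= x s ->. Qed.

Lemma ka_eq_map (Y Z : Type) (g : Y -> Z) (H : hypotheses Z) e f :
  ka_eq (fun e f => ka_le H (re_map g e) (re_map g f)) e f ->
  ka_eq H (re_map g e) (re_map g f).
Proof.
move=> h; elim: h => {e f} /=; intros;
  solve [by constructor | by apply: ka_sym | by apply: ka_trans; eassumption | by []].
Qed.

(** * Tests as sums of atoms *)

Section Tests.
Local Open Scope regex_scope.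
Variables (S O : finType).

Notation atom := {ffun O -> bool}.
Notation gam := (atom + bool * S)%type.
Notation letter := (dbl (S + bexp O)).
Notation H := (H_katc S O).
Local Notation "e ≡ f" := (ka_eq H e f) (at level 70).
Local Notation "e ≦ f" := (ka_le H e f) (at level 70).

Definition tst (p : bexp O) : regex letter := re_letter (inl (inr p)).

Lemma kat_eqnP e f : kat_eqn S O e f -> re_map inl e ≡ re_map inl f.
Proof.
move=> h; apply: ka_le_anti; apply: ka_hyp; apply: Or31.
  by exists e, f; split=> //; left.
by exists f, e; split=> //; right.
Qed.

Lemma tst_ba p q : ba_axiom p q -> tst p ≡ tst q.
Proof. by move=> h; have := kat_eqnP (kat_bool S h). Qed.

Lemma tst_and p q : tst (b_and p q) ≡ tst p * tst q.
Proof. exact: (kat_eqnP (kat_and S p q)). Qed.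

Lemma tst_or p q : tst (b_or p q) ≡ tst p + tst q.
Proof. exact: (kat_eqnP (kat_or S p q)). Qed.

Lemma tst_bot : tst b_bot ≡ 0.
Proof. exact: (kat_eqnP (kat_bot S O)). Qed.

Lemma tst_top : tst b_top ≡ 1.
Proof. exact: (kat_eqnP (kat_top S O)). Qed.

Lemma tst_comm p q : tst p * tst q ≡ tst q * tst p.
Proof. by rewrite -!tst_and; apply: tst_ba; constructor. Qed.

Lemma tst_and_not p : tst p * tst (b_not p) ≡ 0.
Proof. by rewrite -tst_and -tst_bot; apply: tst_ba; constructor. Qed.

Lemma tst_or_not p : tst p + tst (b_not p) ≡ 1.
Proof. by rewrite -tst_or -tst_top; apply: tst_ba; constructor. Qed.

Lemma tst_idem p : tst p * tst p ≡ tst p.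
Proof.
rewrite -{3}(ka_dot1 H (tst p)) -(tst_or_not p) ka_dotDr tst_and_not.
by rewrite ka_plus0.
Qed.

Lemma tst_le1 p : tst p ≦ 1.
Proof. by rewrite -(tst_or_not p); apply: ka_le_plusl. Qed.

Lemma tst_conv p : re_letter (inr (inr p)) ≡ tst p.
Proof.
apply: ka_le_anti; apply: ka_hyp; apply: Or33.
  exact: (@H_i_intro S O (inl p)).
exact: (@H_i_intro S O (inr p)).
Qed.

(** The negation case is the point: [a * tst p] equal to [a] or to [0] determines
    [a * tst (b_not p)] through the two complement laws. *)
Lemma tst_decide a (v : O -> bool) :
  (forall o, a * tst (b_var o) ≡ if v o then a else 0) ->
  forall p, a * tst p ≡ if beval v p then a else 0.
Proof.
move=> hv; elim=> [o|||p ih|p ihp q ihq|p ihp q ihq] //=.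
- by rewrite tst_top ka_dot1.
- by rewrite tst_bot ka_dot0.
- case: (beval v p) ih => /= ih.
    by rewrite -{1}ih -ka_dotA tst_and_not ka_dot0.
  rewrite -(ka_plus0 H (a * _)) -ih ka_plusC -ka_dotDr tst_or_not.
  exact: ka_dot1.
- rewrite tst_and ka_dotA ihp; case: (beval v p) => //=.
  exact: ka_0dot.
rewrite tst_or ka_dotDr ihp ihq; case: (beval v p); case: (beval v q) => /=.
- exact: ka_plus_idem.
- exact: ka_plus0.
- by rewrite ka_plusC ka_plus0.
exact: ka_plus_idem.
Qed.

Definition lit (v : O -> bool) (o : O) : bexp O :=
  if v o then b_var o else b_not (b_var o).

Definition conj_bexp (s : seq (bexp O)) : bexp O := foldr (@b_and O) b_top s.

Definition atom_bexp (v : atom) : bexp O := conj_bexp (map (lit v) (enum O)).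

Lemma beval_atom (v w : atom) : beval w (atom_bexp v) = (w == v).
Proof.
have -> : beval w (atom_bexp v) = all (fun o => w o == v o) (enum O).
  rewrite /atom_bexp; elim: (enum O) => //= o s ->; congr (_ && _).
  by rewrite /lit; case: (v o) => /=; case: (w o).
apply/allP/eqP => [h|-> //]; apply/ffunP => o; apply/eqP; apply: h.
by rewrite mem_enum.
Qed.

Lemma tst_conj_cat s1 s2 : tst (conj_bexp (s1 ++ s2)) ≡ tst (conj_bexp s1) * tst (conj_bexp s2).
Proof.
elim: s1 => [|p s1 ih] /=; first by rewrite tst_top ka_1dot.
by rewrite !tst_and ih ka_dotA.
Qed.

Lemma tst_atom_decide (v : atom) p :
  tst (atom_bexp v) * tst p ≡ if beval v p then tst (atom_bexp v) else 0.
Proof.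
apply: tst_decide => o; rewrite /atom_bexp.
have : o \in enum O by rewrite mem_enum.
elim: (enum O) => // o' s ih; rewrite inE => /orP[/eqP<-|/ih] /=.
  set C := conj_bexp _; rewrite /lit; case: (v o).
    by rewrite !tst_and -ka_dotA (tst_comm C) ka_dotA tst_idem.
  rewrite tst_and -ka_dotA (tst_comm C) ka_dotA (tst_comm (b_not _)).
  by rewrite tst_and_not ka_0dot.
by case: (v o) => h; rewrite !tst_and -ka_dotA h ?ka_dot0.
Qed.

Definition tst_atom (v : atom) := tst (atom_bexp v).

Lemma tst_atoms : 1 ≦ re_sum tst_atom (enum {: atom}).
Proof.
rewrite -tst_top; set sum := re_sum _ _.
(* [s1] lists the variables already decided by [v]. The next one is split by the excluded middle; as
   it is not in [s1], updating [v] there leaves the earlier literals unchanged. The initial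
   valuation is arbitrary. *)
suff key s2 s1 (v : atom) : s1 ++ s2 = enum O -> tst (conj_bexp (map (lit v) s1)) ≦ sum.
  by have := key (enum O) [::] [ffun=> true] erefl.
elim: s2 s1 v => [|o s2 ih] s1 v es.
  by rewrite cats0 in es; rewrite es; apply: ka_le_sum; rewrite mem_enum.
rewrite -(ka_dot1 H (tst _)) -(tst_or_not (b_var o)) ka_dotDr.
have os1 : o \notin s1.
  have := enum_uniq O; rewrite -es cat_uniq /= => /and3P[_].
  by rewrite negb_or => /andP[].
have upd b : tst (conj_bexp (map (lit v) s1)) * tst (lit (fun=> b) o) ≦ sum.
  pose v' := [ffun o' => if o' == o then b else v o'].
  apply: ka_le_trans (ih (rcons s1 o) v' _); last by rewrite cat_rcons.
  rewrite map_rcons -cats1.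
  have -> : map (lit v') s1 = map (lit v) s1.
    apply/eq_in_map => o' ho'; rewrite /lit ffunE; case: eqP => // e.
    by rewrite -e ho' in os1.
  have -> : lit v' o = lit (fun=> b) o by rewrite /lit ffunE eqxx.
  rewrite tst_conj_cat; apply: ka_le_dotr => /=.
  by rewrite tst_and tst_top ka_dot1.
by apply: ka_plus_lub; [exact: (upd true) | exact: (upd false)].
Qed.

Lemma tst_sum p : tst p ≡ re_sum tst_atom (enum [pred v : atom | beval v p]).
Proof.
apply: ka_le_anti; last first.
  apply: ka_sum_lub => v; rewrite mem_enum inE => hv.
  rewrite /tst_atom; have := tst_atom_decide v p; rewrite hv => <-.
  rewrite -{2}(ka_1dot H (tst p)); apply: ka_le_dotl; exact: tst_le1.
rewrite -{1}(ka_1dot H (tst p)); apply: (ka_le_trans (ka_le_dotl _ tst_atoms)).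
rewrite ka_dot_suml; apply: ka_sum_lub => v _; rewrite tst_atom_decide.
case: ifP => hv; last exact: ka_le0.
by apply: (@ka_le_sum _ _ _ tst_atom); rewrite mem_enum inE.
Qed.

(** The Boolean marks the converse copy. Atoms have no converse letter here, since a test and its
    converse are provably equal. *)
Definition ginj (a : gam) : letter :=
  match a with
  | inl v => inl (inr (atom_bexp v))
  | inr (false, s) => inl (inl s)
  | inr (true, s) => inr (inl s)
  end.

Definition expand (a : letter) : regex gam :=
  match a with
  | inl (inl s) => re_letter (inr (false, s))
  | inr (inl s) => re_letter (inr (true, s))
  | inl (inr p) | inr (inr p) =>
      re_sum (fun v => re_letter (inl v)) (enum [pred v : atom | beval v p])
  end.

Definition gexp (e : regex letter) : regex gam := re_subst expand e.

Lemma gexp_eq e : e ≡ re_map ginj (gexp e).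
Proof.
elim: e => [|||e1 ih1 e2 ih2|e1 ih1 e2 ih2|e ih] //=; last 3 first.
- by rewrite -ih1 -ih2.
- by rewrite -ih1 -ih2.
- by rewrite -ih.
by move=> [[s|p]|[s|p]] //=; rewrite re_map_sum ?tst_conv; apply: tst_sum.
Qed.

Definition gconv (a : gam) : gam :=
  match a with inl v => inl v | inr (b, s) => inr (~~ b, s) end.

Lemma gconvK : involutive gconv.
Proof. by move=> [v|[b s]] //=; rewrite negbK. Qed.

Definition isatom (a : gam) : bool := if a is inl _ then true else false.

Lemma isatom_conv a : isatom (gconv a) = isatom a.
Proof. by case: a => [|[]]. Qed.

(** All inequations over the finite alphabet that become derivable after renaming. Completeness of
    Kleene algebra and the rounds, both stated over finite alphabets, apply to it, and [Hgam_eq]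
    carries their conclusions back. *)
Definition Hgam : hypotheses gam :=
  fun e f => re_map ginj e ≦ re_map ginj f.

Lemma conv_ginj e : conv (re_map ginj e) ≡ re_map ginj (re_conv gconv e).
Proof.
elim: e => [|||e1 ih1 e2 ih2|e1 ih1 e2 ih2|e ih] //=; last 3 first.
- by rewrite ih1 ih2.
- by rewrite ih1 ih2.
- by rewrite ih.
by move=> [v|[[] s]] //=; apply: tst_conv.
Qed.

Lemma Hgam_cnv e : ka_le Hgam e (e * re_conv gconv e * e).
Proof.
apply: ka_hyp; rewrite /Hgam /= -conv_ginj; apply: ka_hyp; apply: Or32.
exact: H_cnv_intro.
Qed.

Lemma Hgam_le1 a : isatom a -> ka_le Hgam (re_letter a) 1.
Proof.
by case: a => // v _; apply: ka_hyp; apply: tst_le1.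
Qed.

Lemma Hgam_atoms :
  ka_le Hgam 1 (re_sum (fun v : atom => re_letter (inl v)) (enum {: atom})).
Proof. by apply: ka_hyp; rewrite /Hgam re_map_sum; apply: tst_atoms. Qed.

Lemma Hgam_zero (v w : atom) :
  v != w -> ka_le Hgam (re_letter (inl v) * re_letter (inl w)) 0.
Proof.
move=> vw; apply: ka_hyp; rewrite /Hgam /=; apply: ka_eq_le.
by have := tst_atom_decide v (atom_bexp w); rewrite beval_atom (negPf vw).
Qed.

Lemma Hgam_eq e f : ka_eq Hgam e f -> re_map ginj e ≡ re_map ginj f.
Proof. exact: ka_eq_map. Qed.

End Tests.

(** * Guarded strings *)

Section GuardedStrings.
Variables (S O : finType).

Notation atom := {ffun O -> bool}.
Notation sym := (bool * S)%type.
Notation gam := (atom + sym)%type.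
Notation letter := (dbl (S + bexp O)).
Notation H := (H_katc S O).
Notation Hg := (@Hgam S O).
Notation tail := (seq (sym * atom)).

Implicit Types (al be : atom) (t : tail) (x : sym) (v u : seq gam).

(* A guarded string [al], [t] is a path with edges labelled in [sym] and
   vertices labelled by atoms. *)
Fixpoint edge t (i : nat) x : bool :=
  match t, i with
  | [::], _ => false
  | (y, _) :: _, 0 => y == x
  | _ :: t', i'.+1 => edge t' i' x
  end.

(** Beyond the last vertex the value is the last atom; walks that start on the string never get
    there. *)
Fixpoint atm al t (i : nat) : atom :=
  match t, i with
  | (_, be) :: t', i'.+1 => atm be t' i'
  | _, _ => al
  end.

Definition xrev x : sym := (~~ x.1, x.2).

Lemma xrevK : involutive xrev.
Proof. by case=> b s; rewrite /xrev /= negbK. Qed.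

Definition grel al t (g : gam) (i j : nat) : bool :=
  match g with
  | inl be => (i == j) && (atm al t i == be)
  | inr x => (j == i.+1) && edge t i x || (i == j.+1) && edge t j (xrev x)
  end.

Definition gletter al t := @katc_rel S O nat
  (fun s i j => grel al t (inr (false, s)) i j) (fun i => atm al t i).

Definition gsem (e : regex letter) al t := rrel (gletter al t) e 0 (size t).

Lemma gletter_ginj al t (g : gam) i j : gletter al t (ginj g) i j <-> grel al t g i j.
Proof.
case: g => [be|[[] s]] /=; last by [].
  by rewrite beval_atom; split=> [[-> ->]|/andP[/eqP-> h]]; rewrite ?eqxx.
by rewrite orbC.
Qed.

Lemma wrel_ext (Y D : Type) (R R' : Y -> D -> D -> Prop) w i j :
  (forall a i j, R a i j <-> R' a i j) -> wrel R w i j -> wrel R' w i j.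
Proof. by move=> h; elim: w i => //= a w ih i [k /h h1 /ih]; exists k. Qed.

Lemma gsem_gexp e al t : gsem e al t <-> rrel (grel al t) (gexp e) 0 (size t).
Proof.
rewrite /gsem (rrel_sound (@katc_valid S O nat _ _) (gexp_eq e)) rrel_map.
split=> -[w hw h]; exists w => //; move: h; apply: wrel_ext => a i j.
  exact: gletter_ginj.
exact: iff_sym (gletter_ginj _ _ _ _ _).
Qed.

Lemma grel_shift al be t y g i j :
  grel al ((y, be) :: t) g i.+1 j.+1 = grel be t g i j.
Proof. by case: g. Qed.

Section Automaton.
Variable e : regex gam.
Let Q := dst e.
Let d : Q -> gam -> Q := @dtr gam e.

Definition creach al t (i : nat) (q : Q) (j : nat) (r : Q) :=
  exists2 z, wrel (grel al t) z i j & foldl d q z = r.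

Lemma creach_refl al t i q : creach al t i q i q.
Proof. by exists [::]. Qed.

Lemma creach_trans al t i q j r k s :
  creach al t i q j r -> creach al t j r k s -> creach al t i q k s.
Proof.
move=> [z h <-] [z' h' <-]; exists (z ++ z'); last exact: foldl_cat.
by apply/wrel_cat; exists j.
Qed.

Lemma creach_step al t i q j g : grel al t g i j -> creach al t i q j (d q g).
Proof. by exists [:: g] => //; exists j. Qed.

Lemma creach_ind al t (P : nat -> Q -> Prop) i q j r :
  (forall i q g j, P i q -> grel al t g i j -> P j (d q g)) ->
  P i q -> creach al t i q j r -> P j r.
Proof.
move=> hP + [z h <-]; elim: z i q h => [|g z ih] i q /=; first by move->.
by move=> [k h1 /ih h2] /hP/(_ h1)/h2.
Qed.

Lemma creach_shift al be y t i q j r :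
  creach be t i q j r -> creach al ((y, be) :: t) i.+1 q j.+1 r.
Proof.
move=> [z h <-]; exists z => //; elim: z i h => [|g z ih] i /=; first by move->.
by move=> [k h1 /ih h2]; exists k.+1; rewrite ?grel_shift.
Qed.

(* Which states the walks of the automaton connect from the first vertex to the
   last one, and from the first vertex to itself. *)
Definition gstate := ({set Q * Q} * {set Q * Q})%type.

Definition gbase al : gstate :=
  let c := [set p : Q * Q | connect (fun q r => r == d q (inl al)) p.1 p.2] in (c, c).

(** One excursion from the new first vertex: read its atom, or cross [x], loop at the next vertex
    and come back. These are the crossing tables used to turn two-way automata into one-way ones. *)
Definition gloop al x (s : gstate) : rel Q := fun q r =>
  (r == d q (inl al)) ||
  [exists q1 : Q, ((d q (inr x), q1) \in s.2) && (r == d q1 (inr (xrev x)))].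

Definition gext al x (s : gstate) : gstate :=
  ([set p : Q * Q | [exists q1 : Q, connect (gloop al x s) p.1 q1 &&
                                    ((d q1 (inr x), p.2) \in s.1)]],
   [set p : Q * Q | connect (gloop al x s) p.1 p.2]).

Fixpoint gst al t : gstate :=
  if t is (x, be) :: t' then gext al x (gst be t') else gbase al.

Lemma connect_creach al t i (r : rel Q) q q' :
  (forall q q', r q q' -> creach al t i q i q') ->
  connect r q q' -> creach al t i q i q'.
Proof.
move=> hr /connectP[s hs ->]; elim: s q hs => [|q1 s ih] q /=.
  by move=> _; apply: creach_refl.
by move=> /andP[/hr h1 /ih]; apply: creach_trans.
Qed.

Lemma gbaseP al q r : creach al [::] 0 q 0 r <->
  connect (fun q r => r == d q (inl al)) q r.
Proof.
set R := (X in connect X); split=> [h|]; last first.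
  by apply: connect_creach => p p' /eqP->; apply: creach_step; rewrite /= !eqxx.
suff [] : 0 = 0 /\ connect R q r by [].
move: h; apply: (creach_ind (P := fun i p => i = 0 /\ connect R q p)) => //.
move=> i p [be|x] j [-> hp]; last by rewrite /= !andbF.
move=> /andP[/eqP<- /eqP<-]; split=> //; apply: connect_trans hp (connect1 _).
exact: eqxx.
Qed.

(* A walk from the first vertex is, since its last visit to this vertex, a walk
   of the shorter guarded string. *)
Lemma creach_cons al be x t (s : gstate) q i r :
  (forall q r, (q, r) \in s.2 <-> creach be t 0 q 0 r) ->
  creach al ((x, be) :: t) 0 q i r ->
  match i return Prop with
  | 0 => connect (gloop al x s) q r
  | i'.+1 => exists2 q1, connect (gloop al x s) q q1 &
                         creach be t 0 (d q1 (inr x)) i' r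
  end.
Proof.
move=> hs; pose P' i r := match i return Prop with
  | 0 => connect (gloop al x s) q r
  | i'.+1 => exists2 q1, connect (gloop al x s) q q1 &
                         creach be t 0 (d q1 (inr x)) i' r
  end.
rewrite -[X in _ -> X]/(P' i r).
apply: (creach_ind (P := P')); last exact: connect0.
move=> {i r} -[|i] r g [|j] /=.
- move=> hr h; apply: connect_trans hr (connect1 _).
  by case: g h => [be' /= /eqP->|y] //; rewrite /gloop eqxx.
- move=> hr h; case: g h => [//|y] /=; rewrite !orbF => /andP[/eqP[->] /eqP<-].
  by exists r => //; apply: creach_refl.
- move=> [q1 h1 h2]; case: g => [//|y] /= /andP[/eqP[e0] /eqP ey].
  apply: connect_trans h1 (connect1 _); apply/orP; right; apply/existsP.
  exists r; rewrite ey xrevK eqxx andbT; apply/hs.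
  by rewrite -ey; move: h2; rewrite e0.
move=> [q1 h1 h2] h; exists q1 => //; apply: (creach_trans h2).
by apply: creach_step; rewrite -(grel_shift al be t x).
Qed.

Lemma gloopP al be x t (s : gstate) q r :
  (forall q r, (q, r) \in s.2 <-> creach be t 0 q 0 r) ->
  connect (gloop al x s) q r <-> creach al ((x, be) :: t) 0 q 0 r.
Proof.
move=> hs; split.
  apply: connect_creach => p p' /orP[/eqP->|].
    by apply: creach_step; rewrite /= !eqxx.
  move=> /existsP[p1 /andP[/hs h /eqP->]].
  apply: (creach_trans (creach_step (j := 1) (g := inr x) p _)).
    by rewrite /= eqxx.
  apply: (creach_trans (creach_shift al x h)); apply: creach_step.
  by rewrite /= xrevK eqxx.
exact: creach_cons hs.
Qed.

Lemma gstP al t q r :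
  ((q, r) \in (gst al t).2 <-> creach al t 0 q 0 r) /\
  ((q, r) \in (gst al t).1 <-> creach al t 0 q (size t) r).
Proof.
elim: t al q r => [|[x be] t ih] al q r.
  by rewrite /= !inE; split; rewrite gbaseP.
have hs q1 r1 : (q1, r1) \in (gst be t).2 <-> creach be t 0 q1 0 r1.
  by have [] := ih be q1 r1.
rewrite [gst _ _]/(gext al x (gst be t)) !inE; split; first exact: gloopP.
split.
  move=> /existsP[q1 /andP[/(gloopP _ _ _ _ hs) h1 h2]].
  have {}h2 := (ih be (d q1 (inr x)) r).2.1 h2.
  apply: (creach_trans h1); apply: creach_trans (creach_shift al x h2).
  by apply: creach_step; rewrite /= !eqxx.
move=> /(creach_cons hs)[q1 h1 h2]; apply/existsP; exists q1; rewrite h1.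
exact: (ih be _ r).2.2.
Qed.

Definition gacc (s : gstate) : bool := [exists q : Q, dfin q && ((dini e, q) \in s.1)].

Lemma gaccP al t : gacc (gst al t) <-> rrel (grel al t) e 0 (size t).
Proof.
split=> [/existsP[q /andP[hq h]]|[z /dfa_lang hz h]].
  have [z hz ez] := (gstP al t (dini e) q).2.1 h.
  by exists z => //; apply/dfa_lang; rewrite -[foldl _ _ _]/(foldl d _ _) ez.
apply/existsP; exists (foldl d (dini e) z); rewrite hz.
by apply/(gstP al t _ _).2; exists z.
Qed.

End Automaton.
End GuardedStrings.

(** * Normal forms and their padding with atoms *)

Section Compatibility.
Variables (S O : finType).

Notation atom := {ffun O -> bool}.
Notation sym := (bool * S)%type.
Notation gam := (atom + sym)%type.
Notation letter := (dbl (S + bexp O)).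
Notation H := (H_katc S O).
Notation Hg := (@Hgam S O).
Notation tail := (seq (sym * atom)).

Implicit Types (al be : atom) (t : tail) (x : sym) (v u : seq gam).

(* [compat v al t]: the guarded string is obtained from [v] by inserting atoms
   and merging equal ones. *)
Inductive compat : seq gam -> atom -> tail -> Prop :=
| compat_nil al : compat [::] al [::]
| compat_atom v al t : compat v al t -> compat (inl al :: v) al t
| compat_sym v al x be t : compat v be t -> compat (inr x :: v) al ((x, be) :: t).

Lemma wrel_shift al be t x v i j :
  wrel (grel be t) v i j -> wrel (grel al ((x, be) :: t)) v i.+1 j.+1.
Proof.
elim: v i => [|g v ih] i /=; first by move->.
by move=> [k h1 /ih h2]; exists k.+1; rewrite ?grel_shift.
Qed.

Lemma atm0 al t : atm al t 0 = al.
Proof. by case: t => [|[]]. Qed.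

Lemma compat_wrel v al t : compat v al t -> wrel (grel al t) v 0 (size t).
Proof.
elim=> {v al t} [//|v al t _ ih|v al x be t _ ih] /=.
  by exists 0; rewrite //= atm0 !eqxx.
by exists 1; [rewrite /= !eqxx | apply: wrel_shift].
Qed.

Section Automaton.
Variable e : regex gam.
Let cst := (gstate e * atom)%type.

(* Reading a word from right to left, the states of all its completions. *)
Definition cstep (g : gam) (P : {set cst}) : {set cst} :=
  match g with
  | inl al => [set p in P | p.2 == al]
  | inr x => [set p : cst | [exists p' in P, p.1 == gext p.2 x p'.1]]
  end.

Definition cbase : {set cst} := [set p : cst | p.1 == gbase e p.2].

Lemma cstepP v (s : gstate e) al :
  (s, al) \in foldr cstep cbase v <-> exists2 t, compat v al t & s = gst e al t.
Proof.
elim: v s al => [|[be|x] v ih] s al /=; rewrite !inE /=.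
- split=> [/eqP->|[t h ->]]; first by exists [::]; first constructor.
  by inversion h.
- split=> [/andP[/ih[t h ->] /eqP /= <-]|[t h ->]].
    by exists t => //; constructor.
  by inversion h; subst; rewrite eqxx andbT; apply/ih; exists t.
split=> [/existsP[[s' be] /andP[/ih[t h ->] /eqP /= ->]]|[t h ->]].
  by exists ((x, be) :: t) => //; constructor.
inversion h as [| |v' al' x' be t' h' e1 e2 e3]; subst.
apply/existsP; exists (gst e be t', be); rewrite /= eqxx andbT.
by apply/ih; exists t'.
Qed.

Definition call (P : {set cst}) : bool := [forall p in P, gacc p.1].

(** Quantifying over all compatible guarded strings makes this language depend only on the meaning
    of [e], and makes it the largest one with that meaning. Since [cstep] reads from right to left,
    the automaton runs backwards: it guesses a set [P] satisfying [call] and has to arrive at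
    [cbase]. *)
Definition creg : regex gam :=
  re_sum (fun P => mx_star (nmx (fun P' g P => P' == cstep g P)) P cbase) (enum call).

Lemma lang_creg v : lang creg v <-> forall al t, compat v al t -> gacc (gst e al t).
Proof.
have run P w : nrun (fun P' g P => P' == cstep g P) P cbase w =
    (P == foldr cstep cbase w).
  elim: w P => //= g w ih P; apply/existsP/eqP => [[P' /andP[/eqP-> ]]|->].
    by rewrite ih => /eqP->.
  by exists (foldr cstep cbase w); rewrite ih !eqxx.
rewrite lang_sum; split=> [[P]|h].
  rewrite mem_enum => hP /lang_nfa; rewrite run => /eqP eP al t hc.
  move/forallP/(_ (gst e al t, al))/implyP: hP; apply; rewrite eP.
  by apply/cstepP; exists t.
exists (foldr cstep cbase v); last by apply/lang_nfa; rewrite run.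
rewrite mem_enum; apply/forallP => -[s al]; apply/implyP => /cstepP[t hc ->].
exact: h.
Qed.

End Automaton.

(** Each vertex is spelt by a nonempty block of copies of its atom, because padding may put several
    equal atoms side by side. *)
Inductive guarded : seq gam -> atom -> tail -> Prop :=
| guarded_end al : guarded [:: inl al] al [::]
| guarded_atom u al t : guarded u al t -> guarded (inl al :: u) al t
| guarded_sym u al x be t :
    guarded u be t -> guarded (inl al :: inr x :: u) al ((x, be) :: t).

Definition inconsistent u := exists u1 al be u2,
  al != be /\ u = u1 ++ inl al :: inl be :: u2.

Lemma inconsistent_cat u1 u : inconsistent u -> inconsistent (u1 ++ u).
Proof.
move=> [u2 [al [be [u3 [h ->]]]]]; exists (u1 ++ u2), al, be, u3.
by rewrite catA.
Qed.

(** Atoms are put on both sides of every edge letter, so that padding acts letter by letter and is a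
    substitution on expressions; two unequal neighbours make the word inconsistent. *)
Inductive completion : seq gam -> seq gam -> Prop :=
| completion_nil : completion [::] [::]
| completion_atom al v u : completion v u -> completion (inl al :: v) (inl al :: u)
| completion_sym al x be v u :
    completion v u -> completion (inr x :: v) (inl al :: inr x :: inl be :: u).

Lemma completion_cat v u v' u' :
  completion v u -> completion v' u' -> completion (v ++ v') (u ++ u').
Proof. by move=> h h'; elim: h => //= *; constructor. Qed.

Lemma completion_guarded v u al be : completion v u ->
  inconsistent (inl al :: u ++ [:: inl be]) \/
  exists2 t, guarded (inl al :: u ++ [:: inl be]) al t & compat v al t.
Proof.
move=> h; elim: h al => {v u} [|ga v u _ ih|ga x de v u _ ih] al /=.
- case: (eqVneq al be) => [->|ab]; last by left; exists [::], al, be, [::].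
  by right; exists [::]; repeat constructor.
- case: (eqVneq al ga) => [->|ab]; last first.
    by left; exists [::], al, ga, (u ++ [:: inl be]).
  case: (ih ga) => [/(inconsistent_cat [:: inl ga])|[t h1 h2]]; first by left.
  by right; exists t; constructor.
case: (eqVneq al ga) => [->|ab]; last first.
  by left; exists [::], al, ga, (inr x :: inl de :: u ++ [:: inl be]).
case: (ih de) => [/(inconsistent_cat [:: inl ga; inl ga; inr x])|[t h1 h2]].
  by left.
right; exists ((x, de) :: t); last exact: compat_sym.
by apply: guarded_atom; apply: guarded_sym.
Qed.

Definition atoms : regex gam :=
  re_sum (fun v : atom => re_letter (inl v)) (enum {: atom}).

Lemma lang_atoms u : lang atoms u <-> exists al, u = [:: inl al].
Proof.
rewrite lang_sum; split=> [[al _ ->]|[al ->]]; first by exists al.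
by exists al; rewrite // mem_enum.
Qed.

Local Open Scope regex_scope.

Definition pad (g : gam) : regex gam :=
  match g with
  | inl al => re_letter (inl al)
  | inr x => atoms * re_letter (inr x) * atoms
  end.

Lemma lang_pad e u : lang (re_subst pad e) u -> exists2 v, lang e v & completion v u.
Proof.
elim: e u => [|||e1 ih1 e2 ih2|e1 ih1 e2 ih2|e ih] u //=.
- by move->; exists [::]; last constructor.
- case: u => [al|x] u /=; first by move=> ->; exists [:: inl al]; repeat constructor.
  move=> [_ [_ [-> [_ [_ [-> /lang_atoms[al ->] ->]]] /lang_atoms[be ->]]]].
  by exists [:: inr x]; repeat constructor.
- by case=> [/ih1|/ih2] [v hv h]; exists v; auto.
- move=> [u1 [u2 [-> /ih1[v1 h1 c1] /ih2[v2 h2 c2]]]].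
  by exists (v1 ++ v2); [exists v1, v2 | apply: completion_cat].
elim=> [|u1 u2 /ih[v1 h1 c1] _ [v2 h2 c2]].
  by exists [::]; constructor.
by exists (v1 ++ v2); [constructor | apply: completion_cat].
Qed.

Lemma le_pad e : ka_le Hg e (re_subst pad e).
Proof.
elim: e => [|||e1 ih1 e2 ih2|e1 ih1 e2 ih2|e ih] //=.
- move=> [al|x] //=; rewrite -{1}(ka_1dot Hg (re_letter _)) -{1}(ka_dot1 Hg (1 * _)).
  by do !apply: ka_le_dot => //; apply: Hgam_atoms.
- exact: ka_le_plus.
- exact: ka_le_dot.
rewrite -(ka_dot1 Hg (re_star e)); apply: ka_star_ind_l; first exact: ka_le1_star.
by apply: ka_le_trans (ka_dot_star _ _); apply: ka_le_dotl.
Qed.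

Definition conflicts : regex gam :=
  re_sum (fun p : atom * atom => re_letter (inl p.1) * re_letter (inl p.2))
    (enum [pred p : atom * atom | p.1 != p.2]).

Definition anything : regex gam := re_star (re_sum (@re_letter gam) (enum {: gam})).

Lemma lang_anything u : lang anything u.
Proof.
elim: u => [|g u ih]; first by constructor.
rewrite -cat1s; constructor => //; apply/lang_sum; exists g => //.
by rewrite mem_enum.
Qed.

Lemma inconsistent_le0 : ka_le Hg (anything * conflicts * anything) 0.
Proof.
rewrite -(ka_0dot Hg anything); apply: ka_le_dotl.
rewrite -(ka_dot0 Hg anything); apply: ka_le_dotr.
apply: ka_sum_lub => -[al be]; rewrite mem_enum inE /=; exact: Hgam_zero.
Qed.

Lemma lang_inconsistent u :
  inconsistent u -> lang (anything * conflicts * anything) u.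
Proof.
move=> [u1 [al [be [u2 [h ->]]]]].
rewrite -[_ :: _ :: u2]/([:: inl al; inl be] ++ u2) catA.
apply: lang_dot (lang_anything _); apply: lang_dot (lang_anything _) _.
apply/lang_sum; exists (al, be); first by rewrite mem_enum inE.
by exists [:: inl al], [:: inl be].
Qed.

End Compatibility.

Lemma zz_ins_all (X : Type) (c : X -> X) (isa : pred X) w z y :
  all isa w -> zz c isa z y -> zz c isa z (w ++ y).
Proof. by elim: w => //= a w ih /andP[ha /ih h] /h; apply: zz_ins. Qed.

(** * Completeness with respect to guarded strings *)

Section Lifting.
Variables (S O : finType).

Notation atom := {ffun O -> bool}.
Notation sym := (bool * S)%type.
Notation gam := (atom + sym)%type.
Notation letter := (dbl (S + bexp O)).
Notation H := (H_katc S O).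
Notation Hg := (@Hgam S O).
Notation tail := (seq (sym * atom)).

Implicit Types (al be : atom) (t : tail) (x : sym) (v u : seq gam).

Section Walk.
Variable g0 : gam.

(** The vertex of the guarded string at which position [k] of the word lies, found by counting the
    edge letters before it. *)
Definition vertex u (k : nat) := count (predC (@isatom S O)) (take k u).

Lemma vertexS u k : k < size u ->
  vertex u k.+1 = vertex u k + ~~ isatom (nth g0 u k).
Proof.
by move=> hk; rewrite /vertex (take_nth g0 hk) -cats1 count_cat /= addn0.
Qed.

Lemma vertex_mono u : {homo vertex u : i j / i <= j}.
Proof.
move=> i j ij; rewrite /vertex -(subnKC ij) takeD count_cat; exact: leq_addr.
Qed.

Lemma guarded_size u al t : guarded u al t -> vertex u (size u) = size t.
Proof. by rewrite /vertex take_size; elim=> //= {}u *; lia. Qed.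

Lemma guarded_atm u al t i : guarded u al t -> i <= size t ->
  exists2 k, k < size u & vertex u k = i /\ nth g0 u k = inl (atm al t i).
Proof.
rewrite /vertex => h; elim: h i => {u al t} [al|u al t _ ih|u al x be t _ ih] i.
- by rewrite leqn0 => /eqP->; exists 0.
- by move=> /ih[k hk [h1 h2]]; exists k.+1.
case: i => [_|i /ih[k hk [h1 h2]]]; first by exists 0.
by exists k.+2 => //; rewrite /= h1.
Qed.

Lemma guarded_edge u al t i x : guarded u al t -> edge t i x ->
  exists2 k, k < size u &
    [/\ vertex u k = i, vertex u k.+1 = i.+1 & nth g0 u k = inr x].
Proof.
rewrite /vertex => h; elim: h i => {u al t} [//|u al t _ ih|u al y be t _ ih] i.
  by move=> /ih[k hk [h1 h2 h3]]; exists k.+1.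
case: i => [/eqP<-|i /ih[k hk [h1 h2 h3]]].
  by exists 1 => //; rewrite /= take0.
by exists k.+2 => //; split=> //=; [rewrite h1 | rewrite -h2].
Qed.

Lemma labs_up u k : k < size u -> labs (@gconv S O) u k k.+1 = [:: nth g0 u k].
Proof.
move=> hk; rewrite /labs [seg u k.+1 k]seg_nil // cats0 /seg subSnn.
by rewrite (drop_nth g0 hk) /= take0.
Qed.

Lemma labs_down u k : k < size u ->
  labs (@gconv S O) u k.+1 k = [:: gconv (nth g0 u k)].
Proof.
move=> hk; rewrite /labs [seg u k.+1 k]seg_nil //= /seg subSnn.
by rewrite (drop_nth g0 hk) /= take0.
Qed.

Definition walk u k h k' :=
  [/\ path adj k h, last k h = k' & all (fun i => i <= size u) h].

Lemma walk_cat u k h k' h' k'' :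
  walk u k h k' -> walk u k' h' k'' -> walk u k (h ++ h') k''.
Proof.
move=> [h1 h2 h3] [h4 h5 h6]; split.
- by rewrite cat_path h1 h2.
- by rewrite last_cat h2.
by rewrite all_cat h3.
Qed.

Lemma move_up u k k' : k <= k' -> k' <= size u -> vertex u k = vertex u k' ->
  exists2 h, walk u k h k' & all (@isatom S O) (labp (@gconv S O) u k h).
Proof.
move=> kk'; rewrite -(subnKC kk'); move: (k' - k) => m {k' kk'}.
elim: m k => [|m ih] k hk hv.
  by exists [::]; rewrite // addn0.
have lk : k < size u by lia.
have atk : isatom (nth g0 u k).
  have : vertex u k.+1 <= vertex u (k + m.+1) by apply: vertex_mono; lia.
  by rewrite -hv (vertexS lk); case: isatom => //=; lia.
rewrite addnS -addSn in hk hv *.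
have [|h hw ha] := ih k.+1 hk; first by rewrite (vertexS lk) atk addn0.
exists (k.+1 :: h).
  by case: hw => h1 h2 h3; split; rewrite /= ?h1 ?h3 ?lk // /adj eqxx.
by rewrite /labp /= labs_up //= atk.
Qed.

(** Positions of the same vertex are separated by atoms only, and these may be inserted in a
    round. *)
Lemma move_vertex u k k' : k <= size u -> k' <= size u -> vertex u k = vertex u k' ->
  exists2 h, walk u k h k' & all (@isatom S O) (labp (@gconv S O) u k h).
Proof.
move=> hk hk' hv; case: (leqP k k') => kk'; first exact: move_up.
have [h [h1 h2 h3] ha] := move_up (ltnW kk') hk (esym hv).
exists (rev (belast k' h)).
  rewrite -h2; split.
  - rewrite rev_path; apply: sub_path h1 => i j; rewrite /adj; lia.
  - by case: (h) => //= a s; rewrite rev_cons last_rcons.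
  apply/allP => i; rewrite mem_rev => /mem_belast; rewrite inE => /orP[/eqP->//|].
  exact: (allP h3).
rewrite -h2 labp_rev ?/rc ?all_rev ?all_map; last exact: gconvK.
by apply: sub_all ha => g; rewrite /= isatom_conv.
Qed.

(* A walk of a guarded string lifts to a walk along a word for it, reading
   additional atoms. *)
Lemma lift_walk u al t z i k k' : guarded u al t ->
  wrel (grel al t) z i (vertex u k') -> vertex u k = i ->
  k <= size u -> k' <= size u ->
  exists2 h, walk u k h k' & zz (@gconv S O) (@isatom S O) z (labp (@gconv S O) u k h).
Proof.
move=> hg; elim: z i k => [|g z ih] i k /=.
  move=> -> hk h1 h2; have [h hw ha] := move_vertex h1 h2 hk.
  by exists h => //; rewrite -[labp _ _ _ _]cats0; apply: zz_ins_all ha (zz_nil _ _).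
move=> [l hgl hz] hk h1 h2.
(* A letter of [z] is read in one step between neighbouring positions, after a move among the
   positions of vertex [i]. *)
suff [k1 [k2 [lk1 lk2 e1 e2 [hadj hl]]]] : exists k1 k2,
    [/\ k1 <= size u, k2 <= size u, vertex u k1 = i, vertex u k2 = l &
     adj k1 k2 /\ labs (@gconv S O) u k1 k2 = [:: g]].
  have [h hw ha] := move_vertex h1 lk1 (etrans hk (esym e1)).
  have [h' hw' hz'] := ih l k2 hz e2 lk2 h2.
  exists (h ++ k2 :: h').
    apply: walk_cat hw _; case: hw' => w1 w2 w3.
    by split; rewrite /= ?hadj ?lk2.
  rewrite labp_cat; apply: zz_ins_all => //; case: hw => _ -> _.
  by rewrite /labp /= hl; apply: zz_cons.
have it : i <= size t by rewrite -(guarded_size hg) -hk; apply: vertex_mono.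
case: g hgl => [be /andP[/eqP<- /eqP eb]|x /orP[]/andP[/eqP el he]].
- have [k0 hk0 [v0 n0]] := guarded_atm hg it.
  exists k0, k0.+1; rewrite labs_up // n0 eb vertexS // n0 addn0.
  by split=> //; [exact: ltnW | split=> //; rewrite /adj eqxx].
- have [k0 hk0 [v0 v1 n0]] := guarded_edge hg he.
  exists k0, k0.+1; rewrite labs_up // n0 el.
  by split=> //; [exact: ltnW | split=> //; rewrite /adj eqxx].
have [k0 hk0 [v0 v1 n0]] := guarded_edge hg he.
exists k0.+1, k0; rewrite labs_down // n0 el.
split=> //; [exact: ltnW | split; first by rewrite /adj eqxx orbT].
by rewrite -[gconv _]/(inr (xrev (xrev x))) xrevK.
Qed.

End Walk.

Local Open Scope regex_scope.

(** A word of [creg e] alone does not determine the atoms that a walk should test. Padding supplies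
    them: every consistent padded word spells one guarded string, on which [gaccP] provides an
    accepting walk of [e]. *)
Lemma creg_le (e : regex gam) : ka_le Hg (creg e) e.
Proof.
(* One round accounts for the atoms inserted by [lift_walk]; those of [walk_regex] then straighten
   the lifted walk. *)
have [e1 le1 he1] := step_regex (@gconvK S O) (@Hgam_cnv S O) (@Hgam_le1 S O) e.
have [f fe1 hf] := walk_regex (@gconvK S O) (@Hgam_cnv S O) (@Hgam_le1 S O)
  (@isatom_conv S O) e1.
have pad_creg : ka_le Hg (creg e) (atoms S O * re_subst (@pad S O) (creg e) * atoms S O).
  rewrite -{1}(ka_1dot Hg (creg e)) -{1}(ka_dot1 Hg (1 * _)).
  by do !apply: ka_le_dot; [exact: Hgam_atoms | exact: le_pad | exact: Hgam_atoms].
apply: (ka_le_trans pad_creg).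
apply: (@ka_le_trans _ _ (f + anything S O * conflicts S O * anything S O)).
  apply: ka_completeness => _ [_ [_ [-> [_ [u [-> /lang_atoms[al ->] hu]]] /lang_atoms[be ->]]]].
  have [v /lang_creg hv cvu] := lang_pad hu.
  have [hi|[t hg /hv/gaccP[z hz hw]]] := completion_guarded al be cvu.
    by right; apply: lang_inconsistent.
  left; change (lang f (inl al :: u ++ [:: inl be])).
  move: hg; set w := _ :: _ => hg.
  have hs := guarded_size hg; rewrite -hs in hw.
  have [h [h1 h2 h3] hzz] := lift_walk (inl al) (k := 0) hg hw (erefl _) (leq0n _) (leqnn _).
  by apply: (hf w h) => //; apply: he1 hzz.
apply: ka_plus_lub; first exact: ka_le_trans fe1 le1.
by apply: (ka_le_trans (@inconsistent_le0 S O)); apply: ka_le0.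
Qed.

Lemma creg_ge (e : regex gam) : ka_le Hg e (creg e).
Proof.
apply: ka_completeness => v hv; apply/lang_creg => al t hc.
by apply/gaccP; exists v => //; apply: compat_wrel.
Qed.

Local Open Scope nat_scope.

Definition normal (e : regex letter) : regex gam := creg (gexp e).

Lemma normal_eq e : ka_eq H e (re_map (@ginj S O) (normal e)).
Proof.
rewrite {1}(gexp_eq e); apply: Hgam_eq.
by apply: ka_le_anti; [exact: creg_ge | exact: creg_le].
Qed.

Lemma lang_normal e v :
  lang (normal e) v <-> forall al t, compat v al t -> gsem e al t.
Proof.
by rewrite lang_creg; split=> h al t /h; rewrite gsem_gexp gaccP.
Qed.

Theorem ka_eq_gsem e f :
  ka_eq H e f <-> forall al t, gsem e al t <-> gsem f al t.
Proof.
split=> [h al t|h]; first exact: rrel_sound (@katc_valid S O nat _ _) h _ _.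
rewrite (normal_eq e) (normal_eq f); apply: Hgam_eq.
by apply: ka_le_anti; apply: ka_completeness => v /lang_normal hv;
  apply/lang_normal => al t /hv/h.
Qed.

Lemma closure_gsem e w al t :
  Defs.closure H (lang e) w -> wrel (gletter al t) w 0 (size t) -> gsem e al t.
Proof. by move=> h; apply: wrel_closure h; apply: katc_valid. Qed.

(** A language is contained in its closure, and closure words relate the ends of a guarded string
    only if the expression does; so equal closures give equal guarded-string semantics. *)
Lemma katc_complete : ka_complete H.
Proof.
move=> e f h; apply/ka_eq_gsem => al t.
by split=> -[w hw hr]; apply: closure_gsem hr; apply/h; apply: closure_base.
Qed.

Lemma closure_normal e v :
  Defs.closure H (lang e) (map (@ginj S O) v) -> lang (normal e) v.
Proof.
move=> hv; apply/lang_normal => al t /compat_wrel hw.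
apply: closure_gsem hv _; apply/wrel_map; apply: wrel_ext hw => a i j.
exact: iff_sym (gletter_ginj _ _ _ _ _).
Qed.

End Lifting.

Lemma re_map_comp (X Y Z : Type) (g : X -> Y) (h : Y -> Z) e :
  re_map h (re_map g e) = re_map (fun x => h (g x)) e.
Proof. by elim: e => //= [e1 -> e2 -> | e1 -> e2 -> | e1 ->]. Qed.

Section BexpEq.
Variable O : eqType.

Fixpoint bexp_eqb (p q : bexp O) : bool :=
  match p, q with
  | b_var x, b_var y => x == y
  | b_top, b_top | b_bot, b_bot => true
  | b_not p, b_not q => bexp_eqb p q
  | b_and p p', b_and q q' | b_or p p', b_or q q' => bexp_eqb p q && bexp_eqb p' q'
  | _, _ => false
  end.

Lemma bexp_eqP : Equality.axiom bexp_eqb.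
Proof.
move=> p q; apply: (iffP idP) => [|<-].
  elim: p q => [x|||p ih|p ihp p' ihp'|p ihp p' ihp'] [y|||q|q q'|q q'] //=.
  - by move=> /eqP->.
  - by move=> /ih->.
  - by move=> /andP[/ihp-> /ihp'->].
  - by move=> /andP[/ihp-> /ihp'->].
by elim: p {q} => //= [r -> r1 ->|r -> r1 ->].
Qed.

HB.instance Definition _ := hasDecEq.Build (bexp O) bexp_eqP.
End BexpEq.

(** * The reduction *)

Section Reduction.
Variables (S O : finType).
Notation gam := ({ffun O -> bool} + bool * S)%type.

(** The image of [ginj], as a Boolean predicate; this is why Boolean expressions are given decidable
    equality. *)
Definition reduced (a : dbl (S + bexp O)) : bool :=
  match a with
  | inl (inl _) | inr (inl _) => true
  | inl (inr p) => [exists v : {ffun O -> bool}, atom_bexp v == p]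
  | inr (inr _) => false
  end.

Lemma reduced_ginj (g : gam) : reduced (ginj g).
Proof. by case: g => [v|[[] s]] //=; apply/existsP; exists v. Qed.

Definition ginj_sub (g : gam) : {a | reduced a} := exist _ (ginj g) (reduced_ginj g).

Lemma ginj_sub_onto (a : {a | reduced a}) : exists g, a = ginj_sub g.
Proof.
suff [g eg] : exists g, sval a = ginj g.
  by exists g; apply: eq_sig_hprop => // x; exact: bool_irrelevance.
case: a => -[[s|p]|[s|p]] //= ha.
- by exists (inr (false, s)).
- by move/existsP: ha => [v /eqP<-]; exists (inl v).
by exists (inr (true, s)).
Qed.

Lemma katc_reduces : reduces_to_empty (H_katc S O).
Proof.
exists reduced; split; first by move=> e f [e' [f' []]].
exists (fun e => re_map ginj_sub (normal e)) => e; split.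
  by rewrite re_map_comp; apply: normal_eq.
move=> w hw; apply: closure_base; apply/lang_map.
have [v ev] : exists v, w = map ginj_sub v.
  elim: w {hw} => [|a w [v ->]]; first by exists [::].
  by have [g ->] := ginj_sub_onto a; exists (g :: v).
exists v => //; apply: closure_normal; move: hw.
by rewrite ev -map_comp.
Qed.
End Reduction.

(** * Realisers of functions in the lambda-calculus *)

Definition proc (t : tm) : Prop := (exists s, t = tm_lam s) /\ tm_closed t.

Lemma eval_proc t : proc t -> tm_eval t t.
Proof. by move=> [[s ->] _]; constructor. Qed.

Lemma eval_val s v : tm_eval (tm_lam s) v -> v = tm_lam s.
Proof. by move=> h; inversion h. Qed.

Lemma eval_beta s u v : proc u -> tm_eval (tm_subst s 0 u) v ->
  tm_eval (tm_app (tm_lam s) u) v.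
Proof.
by move=> hu h; apply: tm_eval_app h; [constructor | apply: eval_proc].
Qed.

Lemma eval_app s s' t t' v : tm_eval s s' -> tm_eval t t' -> proc s' -> proc t' ->
  tm_eval (tm_app s' t') v -> tm_eval (tm_app s t) v.
Proof.
move=> hs ht [[s1 es] _] [[t1 et] _]; subst => h.
inversion h as [|a b s2 t2 v' h1 h2 h3]; subst.
move/eval_val: h1 => [e1]; move/eval_val: h2 => e2; subst.
exact: tm_eval_app hs ht h3.
Qed.

(** A realisability relation: encoded data have one realiser, functions may have many. Realisers are
    closed abstractions, as required by a substitution that does not lift. *)
Class Rep (A : Type) := {
  rep : tm -> A -> Prop;
  rep_proc : forall t x, rep t x -> proc t }.

#[export] Instance Rep_fun (A B : Type) (RA : Rep A) (RB : Rep B) : Rep (A -> B).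
Proof.
refine {| rep t f := proc t /\
  forall u x, rep u x -> exists2 v, tm_eval (tm_app t u) v & rep v (f x) |}.
by move=> t f [].
Defined.

Definition computable (A : Type) (R : Rep A) (x : A) : Prop := exists t, rep t x.
Arguments computable {A R} x.

Definition Rep_enc (A : Type) (enc : A -> tm) (h : forall x, proc (enc x)) : Rep A.
Proof.
refine {| rep t x := t = enc x |}.
by move=> t x ->.
Defined.

Lemma computable_ext (A B : Type) (RA : Rep A) (RB : Rep B) (f g : A -> B) :
  (forall x, f x = g x) -> computable f -> computable g.
Proof.
move=> fg [t [ht h]]; exists t; split=> // u x /h[v hv hr].
by exists v; rewrite -?fg.
Qed.

(** * Lambda-terms *)

Section Combinators.
Variables (E A B : Type) (RE : Rep E) (RA : Rep A) (RB : Rep B).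

Lemma proc_lam s : (forall k u, tm_subst s k.+1 u = s) -> proc (tm_lam s).
Proof. by move=> h; split=> [|k u]; [exists s | rewrite /= h]. Qed.

Lemma computable_app (f : A -> B) (x : A) :
  computable f -> computable x -> computable (f x).
Proof. by move=> [t [_ h]] [u /h[v _ hv]]; exists v. Qed.

Lemma comp_const (c : B) : computable c -> computable (fun _ : E => c).
Proof.
move=> [t ht]; have [pt ct] := rep_proc ht; exists (tm_lam t); split.
  by apply: proc_lam => k u; apply: ct.
move=> u x hu; exists t => //; apply: eval_beta; first exact: rep_proc hu.
by rewrite ct; apply: eval_proc (rep_proc ht).
Qed.

Lemma comp_id : computable (fun x : E => x).
Proof.
exists (tm_lam (tm_var 0)); split; first exact: proc_lam.
move=> u x hu; exists u => //; apply: eval_beta; first exact: rep_proc hu.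
exact: eval_proc (rep_proc hu).
Qed.

Lemma comp_app (f : E -> A -> B) (g : E -> A) :
  computable f -> computable g -> computable (fun x => f x (g x)).
Proof.
move=> [t [pt ht]] [s [ps hs]].
exists (tm_lam (tm_app (tm_app t (tm_var 0)) (tm_app s (tm_var 0)))); split.
  by apply: proc_lam => k u /=; rewrite pt.2 ps.2.
move=> u x hu; have [v1 e1 r1] := ht _ _ hu; have [v2 e2 r2] := hs _ _ hu.
have [v e r] := r1.2 _ _ r2; exists v => //.
apply: eval_beta (rep_proc hu) _; rewrite /= pt.2 ps.2.
exact: eval_app e1 e2 (rep_proc r1) (rep_proc r2) e.
Qed.

Definition tm_pair (u v : tm) := tm_lam (tm_app (tm_app (tm_var 0) u) v).

Lemma proc_pair u v : proc u -> proc v -> proc (tm_pair u v).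
Proof. by move=> [_ hu] [_ hv]; apply: proc_lam => k w /=; rewrite hu hv. Qed.

#[export] Instance Rep_pair : Rep (A * B).
Proof.
refine {| rep t p := exists u v, [/\ t = tm_pair u v, rep u p.1 & rep v p.2] |}.
by move=> t p [u [v [-> hu hv]]]; apply: proc_pair; [exact: rep_proc hu | exact: rep_proc hv].
Defined.

Lemma computable_fst : computable (@fst A B).
Proof.
exists (tm_lam (tm_app (tm_var 0) (tm_lam (tm_lam (tm_var 1))))); split.
  exact: proc_lam.
move=> _ p [u [v [-> hu hv]]]; exists u => //.
have pu := rep_proc hu; have pv := rep_proc hv.
apply: eval_beta; first exact: proc_pair.
apply: eval_beta; first by do !apply: proc_lam.
rewrite /= pu.2 pv.2.
apply: (@eval_app _ (tm_lam u) _ v); last by apply: eval_beta; rewrite ?pu.2 //; apply: eval_proc.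
- by apply: eval_beta => //=; constructor.
- exact: eval_proc.
- by apply: proc_lam => k w; apply: pu.2.
by [].
Qed.

Lemma computable_snd : computable (@snd A B).
Proof.
exists (tm_lam (tm_app (tm_var 0) (tm_lam (tm_lam (tm_var 0))))); split.
  exact: proc_lam.
move=> _ p [u [v [-> hu hv]]]; exists v => //.
have pu := rep_proc hu; have pv := rep_proc hv.
apply: eval_beta; first exact: proc_pair.
apply: eval_beta; first by do !apply: proc_lam.
rewrite /= pu.2 pv.2.
apply: (@eval_app _ (tm_lam (tm_var 0)) _ v).
- by apply: eval_beta => //=; constructor.
- exact: eval_proc.
- exact: proc_lam.
- by [].
by apply: eval_beta => //=; apply: eval_proc.
Qed.

End Combinators.

Lemma comp_lam (E A B : Type) (RE : Rep E) (RA : Rep A) (RB : Rep B) (f : E * A -> B) :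
  computable f -> computable (fun x y => f (x, y)).
Proof.
move=> [t [pt ht]].
exists (tm_lam (tm_lam (tm_app t
  (tm_lam (tm_app (tm_app (tm_var 0) (tm_var 2)) (tm_var 1)))))); split.
  by apply: proc_lam => k u /=; rewrite pt.2.
move=> u x hu; have pu := rep_proc hu.
exists (tm_lam (tm_app t (tm_lam (tm_app (tm_app (tm_var 0) u) (tm_var 1))))).
  by apply: eval_beta => //=; rewrite pt.2; constructor.
split; first by apply: proc_lam => k w /=; rewrite pt.2 pu.2.
move=> w y hw; have pw := rep_proc hw.
have [|v e r] := ht (tm_pair u w) (x, y); first by exists u, w.
by exists v => //; apply: eval_beta => //=; rewrite pt.2 pu.2.
Qed.

(** The call-by-value fixed point. The extra abstractions delay the self-application until an
    argument arrives, and [g g] evaluates back to [tm_fix w]. *)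
Definition tm_fix (w : tm) : tm :=
  let g := tm_lam (tm_lam (tm_app (tm_app w (tm_app (tm_var 1) (tm_var 1))) (tm_var 0))) in
  tm_lam (tm_app (tm_app w (tm_app g g)) (tm_var 0)).

Lemma proc_fix w : proc w -> proc (tm_fix w).
Proof. by move=> [_ hw]; apply: proc_lam => k u /=; rewrite !hw. Qed.

Lemma eval_fix w u v : proc w -> proc u ->
  tm_eval (tm_app (tm_app w (tm_fix w)) u) v -> tm_eval (tm_app (tm_fix w) u) v.
Proof.
move=> pw pu h; apply: eval_beta => //=; rewrite !pw.2.
inversion h as [|a b s1 t1 v' h1 h2 h3]; subst.
apply: tm_eval_app h2 h3.
inversion h1 as [|a b s2 t2 v' h4 h5 h6]; subst.
have ef : t2 = tm_fix w by apply: eval_val h5.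
subst; apply: tm_eval_app h4 _ h6.
set g := tm_lam (tm_lam _); apply: (@eval_beta _ g).
  by apply: proc_lam => k z /=; rewrite pw.2.
by rewrite /= pw.2; constructor.
Qed.

#[export] Existing Instance Rep_pair.

Definition red (s t : tm) : Prop := forall v, tm_eval t v -> tm_eval s v.

Lemma red_trans t s u : red s t -> red t u -> red s u.
Proof. by move=> h1 h2 v /h2/h1. Qed.

Lemma red_appl s s' t : red s s' -> red (tm_app s t) (tm_app s' t).
Proof.
move=> h v hv; inversion hv as [|a b s1 t1 v' h1 h2 h3]; subst.
exact: tm_eval_app (h _ h1) h2 h3.
Qed.

Lemma red_beta s u : proc u -> red (tm_app (tm_lam s) u) (tm_subst s 0 u).
Proof. by move=> pu v; apply: eval_beta. Qed.

Lemma eval_red s v : tm_eval s v -> (exists b, v = tm_lam b) -> red s v.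
Proof. by move=> h [b eb] w; rewrite eb => /eval_val->; rewrite -eb. Qed.

Lemma red_fix w u : proc w -> proc u ->
  red (tm_app (tm_fix w) u) (tm_app (tm_app w (tm_fix w)) u).
Proof. by move=> hw hu v; apply: eval_fix. Qed.

Definition apps (s : tm) (ts : seq tm) : tm := foldl tm_app s ts.

Lemma red_apps s s' ts : red s s' -> red (apps s ts) (apps s' ts).
Proof. by elim: ts s s' => //= t ts ih s s' h; apply: ih; apply: red_appl. Qed.

Fixpoint substs (b : tm) (ts : seq tm) : tm :=
  if ts is t :: ts' then substs (tm_subst b (size ts') t) ts' else b.

Lemma red_lams b ts :
  foldr (fun t P => proc t /\ P) True ts ->
  red (apps (iter (size ts) tm_lam b) ts) (substs b ts).
Proof.
elim: ts b => [|t ts ih] b /=; first by move=> _ v.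
move=> [pt /ih{}ih].
have sub m j : tm_subst (iter m tm_lam b) j t = iter m tm_lam (tm_subst b (j + m) t).
  elim: m j => [|m IH] j /=; first by rewrite addn0.
  by rewrite IH addnS.
apply: red_trans (ih _); apply: red_apps.
by have := @red_beta (iter (size ts) tm_lam b) t pt; rewrite sub.
Qed.

Ltac proc_tac := repeat first
  [ assumption
  | apply: proc_lam => ? ? /=
  | match goal with h : proc ?t |- context [tm_subst ?t ?k ?u] => rewrite !(proj2 h k u) end
  | reflexivity ].

Class Enc (A : Type) := { enc : A -> tm; enc_proc : forall x, proc (enc x) }.

#[export] Instance Rep_Enc (A : Type) (e : Enc A) : Rep A := Rep_enc (@enc_proc A e).

Lemma computable_val (A : Type) (e : Enc A) (x : A) : computable x.
Proof. by exists (enc x). Qed.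

Lemma bool_proc b : proc (enc_bool b).
Proof. by case: b; proc_tac. Qed.

#[export] Instance Enc_bool : Enc bool := {| enc_proc := bool_proc |}.

Lemma nat_proc n : proc (enc_nat n).
Proof. by elim: n => [|n ih] /=; proc_tac. Qed.

#[export] Instance Enc_nat : Enc nat := {| enc_proc := nat_proc |}.

Lemma sum_proc (X Y : Type) (eX : Enc X) (eY : Enc Y) (z : X + Y) :
  proc (enc_sum (@enc X eX) (@enc Y eY) z).
Proof.
case: z => x /=; first by have p := @enc_proc _ eX x; proc_tac.
by have p := @enc_proc _ eY x; proc_tac.
Qed.

#[export] Instance Enc_sum (X Y : Type) (eX : Enc X) (eY : Enc Y) : Enc (X + Y) :=
  {| enc_proc := @sum_proc X Y eX eY |}.

Lemma bexp_proc (X : Type) (eX : Enc X) (p : bexp X) :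
  proc (enc_bexp (@enc X eX) p).
Proof.
elim: p => [x|||p ih|p ihp q ihq|p ihp q ihq] /=; proc_tac.
by have p := @enc_proc _ eX x; proc_tac.
Qed.

#[export] Instance Enc_bexp (X : Type) (eX : Enc X) : Enc (bexp X) :=
  {| enc_proc := @bexp_proc X eX |}.

Lemma regex_proc (X : Type) (eX : Enc X) (p : regex X) :
  proc (enc_regex (@enc X eX) p).
Proof.
elim: p => [||x|p ihp q ihq|p ihp q ihq|p ih] /=; proc_tac.
by have p := @enc_proc _ eX x; proc_tac.
Qed.

#[export] Instance Enc_regex (X : Type) (eX : Enc X) : Enc (regex X) :=
  {| enc_proc := @regex_proc X eX |}.

Definition ifb (A : Type) (b : bool) (x y : A) := if b then x else y.

Lemma computable_ifb (A : Type) (RA : Rep A) : computable (@ifb A).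
Proof.
exists (tm_lam (tm_lam (tm_lam (tm_app (tm_app (tm_var 2) (tm_var 1)) (tm_var 0))))).
split; first by proc_tac.
move=> _ b ->; have pb := bool_proc b.
have sel u w : proc u -> proc w ->
    red (tm_app (tm_app (enc_bool b) u) w) (if b then u else w).
  move=> pu pw; have := @red_lams (tm_var b) [:: u; w] (conj pu (conj pw I)).
  by case: b {pb}; rewrite /= ?pu.2.
rewrite /enc /=; move: (enc_bool b) pb sel => tb pb sel.
exists (tm_lam (tm_lam (tm_app (tm_app tb (tm_var 1)) (tm_var 0)))).
  by apply: red_beta => //=; constructor.
split; first by proc_tac.
move=> u x hu; have pu := rep_proc hu.
exists (tm_lam (tm_app (tm_app tb u) (tm_var 0))).
  by apply: red_beta => //=; rewrite pb.2; constructor.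
split; first by proc_tac.
move=> w y hw; have pw := rep_proc hw; exists (if b then u else w); last by case: b {sel}.
apply: red_beta => //=; rewrite pb.2 pu.2; apply: sel => //.
by apply: eval_proc; case: b.
Qed.

Definition sum_case (X Y A : Type) (f : X -> A) (g : Y -> A) (z : X + Y) :=
  match z with inl x => f x | inr y => g y end.

Lemma computable_sum_case (X Y A : Type) (eX : Enc X) (eY : Enc Y) (RA : Rep A) :
  computable (@sum_case X Y A).
Proof.
exists (tm_lam (tm_lam (tm_lam (tm_app (tm_app (tm_var 0) (tm_var 2)) (tm_var 1))))).
split; first by proc_tac.
move=> f' f hf; have pf := rep_proc hf.
exists (tm_lam (tm_lam (tm_app (tm_app (tm_var 0) f') (tm_var 1)))).
  by apply: red_beta => //=; constructor.
split; first by proc_tac.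
move=> g' g hg; have pg := rep_proc hg.
exists (tm_lam (tm_app (tm_app (tm_var 0) f') g')).
  by apply: red_beta => //=; rewrite pf.2; constructor.
split; first by proc_tac.
move=> _ z ->; have pz := sum_proc eX eY z.
case: z pz => [x|y] pz; [have px := @enc_proc _ eX x | have px := @enc_proc _ eY y].
  have [v hv rv] := hf.2 (enc x) x erefl; exists v => //.
  apply: red_beta => //=; rewrite pf.2 pg.2.
  apply: (@red_lams (tm_app (tm_var 1) (enc x)) [:: f'; g']) => //=.
  by rewrite !px.2 pf.2.
have [v hv rv] := hg.2 (enc y) y erefl; exists v => //.
apply: red_beta => //=; rewrite pf.2 pg.2.
apply: (@red_lams (tm_app (tm_var 0) (enc y)) [:: f'; g']) => //=.
by rewrite !px.2.
Qed.

Lemma red_fix_lam b u : proc (tm_lam (tm_lam b)) -> proc u ->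
  red (tm_app (tm_fix (tm_lam (tm_lam b))) u)
      (tm_subst (tm_subst b 1 (tm_fix (tm_lam (tm_lam b)))) 0 u).
Proof.
move=> pw pu; apply: red_trans (red_fix pw pu) _.
have pf := proc_fix pw; move: (tm_fix _) pf => F pf.
exact: (@red_lams b [:: F; u] (conj pf (conj pu I))).
Qed.

Lemma computable_enc (T A : Type) (eT : Enc T) (RA : Rep A) (f : T -> A) F :
  proc F ->
  (forall x, exists2 v, tm_eval (tm_app F (enc x)) v & rep v (f x)) ->
  computable f.
Proof. by move=> pF h; exists F; split=> // _ x ->; apply: h. Qed.

Lemma rep_app (A B : Type) (RA : Rep A) (RB : Rep B) t (f : A -> B) s x :
  rep t f -> (exists2 u, tm_eval s u & rep u x) ->
  exists2 v, tm_eval (tm_app t s) v & rep v (f x).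
Proof.
move=> [pt h] [u hu ru]; have [v hv rv] := h u x ru; exists v => //.
exact: eval_app (eval_proc pt) hu pt (rep_proc ru) hv.
Qed.

Lemma rep_app2 (A B C : Type) (RA : Rep A) (RB : Rep B) (RC : Rep C) t
    (f : A -> B -> C) s x s' y :
  rep t f -> (exists2 u, tm_eval s u & rep u x) ->
  (exists2 u, tm_eval s' u & rep u y) ->
  exists2 v, tm_eval (tm_app (tm_app t s) s') v & rep v (f x y).
Proof.
move=> ht hs hs'; have [v hv rv] := rep_app ht hs.
have [w hw rw] := rep_app rv hs'; exists w => //.
exact: red_appl (eval_red hv (rep_proc rv).1) _ hw.
Qed.

Lemma rep_red (A : Type) (RA : Rep A) s s' (x : A) : red s s' ->
  (exists2 v, tm_eval s' v & rep v x) -> exists2 v, tm_eval s v & rep v x.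
Proof. by move=> h [v /h]; exists v. Qed.

Lemma rep_val (A : Type) (RA : Rep A) u (x : A) :
  rep u x -> exists2 v, tm_eval u v & rep v x.
Proof. by exists u => //; apply: eval_proc (rep_proc _); eassumption. Qed.

Fixpoint nat_fold (A : Type) (z : A) (s : nat -> A -> A) (n : nat) : A :=
  if n is m.+1 then s m (nat_fold z s m) else z.

Lemma computable_nat_fold (A : Type) (RA : Rep A) z (s : nat -> A -> A) :
  computable z -> computable s -> computable (nat_fold z s).
Proof.
move=> [tz hz] [ts hs]; have pz := rep_proc hz; have ps := rep_proc hs.
(* Variable 1 is the recursive function and variable 0 the number, which selects its branch by
   application. Inside the successor branch the recursive function becomes variable 2. *)
pose b := tm_app (tm_app (tm_var 0) tz)
  (tm_lam (tm_app (tm_app ts (tm_var 0)) (tm_app (tm_var 2) (tm_var 0)))).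
have pw : proc (tm_lam (tm_lam b)) by rewrite /b; proc_tac.
have := fun n => red_fix_lam pw (nat_proc n); have := proc_fix pw.
move: (tm_fix _) => F pF redF; apply: (computable_enc pF).
pose L := tm_lam (tm_app (tm_app ts (tm_var 0)) (tm_app F (tm_var 0))).
have pL : proc L by rewrite /L; proc_tac.
have {}redF n : red (tm_app F (enc_nat n)) (apps (enc_nat n) [:: tz; L]).
  move: (redF n); move: (enc_nat n) (nat_proc n) => t pt.
  by rewrite /b /L /= !pz.2 !ps.2 !pF.2.
elim=> [|n ih]; apply: (rep_red (redF _)).
  apply: (rep_red (@red_lams (tm_var 1) [:: tz; L] _)) => //=.
  by rewrite pz.2; apply: rep_val.
have pn := nat_proc n.
apply: (rep_red (@red_lams (tm_app (tm_var 0) (enc_nat n)) [:: tz; L] _)) => //=.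
have rt : exists2 v, tm_eval (enc_nat n) v & rep v n by apply: rep_val.
have {}ih : exists2 v, tm_eval (tm_app F (enc_nat n)) v & rep v (nat_fold z s n) := ih.
move: (enc_nat n) pn rt ih => t pt rt ih.
rewrite !pt.2; apply: (rep_red (red_beta pt)); rewrite /= !ps.2 !pF.2.
exact: (rep_app2 hs rt ih).
Qed.

Fixpoint bexp_fold (X A : Type) (v : X -> A) (t b : A) (n : A -> A)
    (a o : A -> A -> A) (p : bexp X) : A :=
  match p with
  | b_var x => v x
  | b_top => t
  | b_bot => b
  | b_not p => n (bexp_fold v t b n a o p)
  | b_and p q => a (bexp_fold v t b n a o p) (bexp_fold v t b n a o q)
  | b_or p q => o (bexp_fold v t b n a o p) (bexp_fold v t b n a o q)
  end.

Fixpoint regex_fold (X A : Type) (z o : A) (l : X -> A) (p d : A -> A -> A)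
    (s : A -> A) (e : regex X) : A :=
  match e with
  | re_zero => z
  | re_one => o
  | re_letter x => l x
  | re_plus e f => p (regex_fold z o l p d s e) (regex_fold z o l p d s f)
  | re_dot e f => d (regex_fold z o l p d s e) (regex_fold z o l p d s f)
  | re_star e => s (regex_fold z o l p d s e)
  end.

(* The branches of a fold for unary and binary constructors, where [f] is the
   recursive call. *)
Definition tm_br1 (f t : tm) := tm_lam (tm_app t (tm_app f (tm_var 0))).
Definition tm_br2 (f t : tm) := tm_lam (tm_lam
  (tm_app (tm_app t (tm_app f (tm_var 1))) (tm_app f (tm_var 0)))).

Lemma proc_br1 f t : proc f -> proc t -> proc (tm_br1 f t).
Proof. by move=> pf pt; rewrite /tm_br1; proc_tac. Qed.

Lemma proc_br2 f t : proc f -> proc t -> proc (tm_br2 f t).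
Proof. by move=> pf pt; rewrite /tm_br2; proc_tac. Qed.

Section Fold.
Variables (X A : Type) (eX : Enc X) (RA : Rep A).

Lemma rep_br1 (T : Type) (F t : tm) (f : T -> A) (g : A -> A) (enc : tm) (x : T) :
  proc F -> rep t g -> proc enc ->
  (exists2 v, tm_eval (tm_app F enc) v & rep v (f x)) ->
  exists2 v, tm_eval (tm_app (tm_br1 F t) enc) v & rep v (g (f x)).
Proof.
move=> pF rt pe ih; have pt := rep_proc rt; apply: (rep_red (red_beta pe)).
by rewrite /= pt.2 pF.2; apply: rep_app rt ih.
Qed.

Lemma rep_br2 (T : Type) (F t : tm) (f : T -> A) (g : A -> A -> A)
    (enc enc' : tm) (x y : T) :
  proc F -> rep t g -> proc enc -> proc enc' ->
  (exists2 v, tm_eval (tm_app F enc) v & rep v (f x)) ->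
  (exists2 v, tm_eval (tm_app F enc') v & rep v (f y)) ->
  exists2 v, tm_eval (tm_app (tm_app (tm_br2 F t) enc) enc') v & rep v (g (f x) (f y)).
Proof.
move=> pF rt pe pe' ih ih'; have pt := rep_proc rt.
apply: (rep_red (@red_lams (tm_app (tm_app t (tm_app F (tm_var 1)))
  (tm_app F (tm_var 0))) [:: enc; enc'] _)) => //=.
by rewrite !pt.2 !pF.2 pe.2; apply: rep_app2 rt ih ih'.
Qed.

Lemma computable_bexp_fold (v : X -> A) t b n a o :
  computable v -> computable t -> computable b -> computable n ->
  computable a -> computable o -> computable (bexp_fold v t b n a o).
Proof.
move=> [tv hv] [tt ht] [tb hb] [tn hn] [ta ha] [to ho].
have pv := rep_proc hv; have pt := rep_proc ht; have pb := rep_proc hb.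
have pn := rep_proc hn; have pa := rep_proc ha; have po := rep_proc ho.
(* The recursive function is variable 1, raised to 2 or 3 by the binders of a unary or binary
   branch. *)
pose B := apps (tm_var 0) [:: tv; tt; tb; tm_br1 (tm_var 2) tn;
  tm_br2 (tm_var 3) ta; tm_br2 (tm_var 3) to].
have pw : proc (tm_lam (tm_lam B)) by rewrite /B /tm_br1 /tm_br2 /=; proc_tac.
have := fun p => red_fix_lam pw (bexp_proc eX p); have := proc_fix pw.
move: (tm_fix _) => F pF redF; apply: (computable_enc pF).
pose L := [:: tv; tt; tb; tm_br1 F tn; tm_br2 F ta; tm_br2 F to].
have {}redF (p : bexp X) : red (tm_app F (enc p)) (apps (enc p) L).
  move: (redF p); change (enc_bexp (@enc X eX) p) with (@enc (bexp X) (Enc_bexp eX) p).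
  have := bexp_proc eX p; change (enc_bexp (@enc X eX) p) with (@enc (bexp X) (Enc_bexp eX) p).
  move: (@enc (bexp X) (Enc_bexp eX) p) => u pu.
  by rewrite /B /L /tm_br1 /tm_br2 /= !(pv.2, pt.2, pb.2, pn.2, pa.2, po.2, pF.2).
have p1 := proc_br1 pF pn; have p2 := proc_br2 pF pa; have p3 := proc_br2 pF po.
have pL : foldr (fun t P => proc t /\ P) True L.
  exact: (conj pv (conj pt (conj pb (conj p1 (conj p2 (conj p3 I)))))).
pose f := bexp_fold v t b n a o.
have b1 e x := @rep_br1 _ F tn f n e x pF hn.
have b2 e e' x y := @rep_br2 _ F ta f a e e' x y pF ha.
have b3 e e' x y := @rep_br2 _ F to f o e e' x y pF ho.
move: pL redF; rewrite {}/L.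
move: (tm_br1 F tn) p1 b1 (tm_br2 F ta) p2 b2 (tm_br2 F to) p3 b3.
move=> f1 p1 b1 f2 p2 b2 f3 p3 b3 pL redF.
elim=> [x|||p ih|p ihp q ihq|p ihp q ihq]; apply: (rep_red (redF _)).
- have px := @enc_proc X eX x.
  apply: (rep_red (@red_lams (tm_app (tm_var 5) (enc x)) _ pL)).
  rewrite /= !px.2 !pv.2; apply: rep_app hv _; exact: rep_val.
- by apply: (rep_red (@red_lams (tm_var 4) _ pL)); rewrite /= !pt.2; apply: rep_val.
- by apply: (rep_red (@red_lams (tm_var 3) _ pL)); rewrite /= !pb.2; apply: rep_val.
- have pe : proc (@enc (bexp X) (Enc_bexp eX) p) := bexp_proc eX p.
  apply: (rep_red (@red_lams (tm_app (tm_var 2) (enc p)) _ pL)).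
  by rewrite [substs _ _]/= !(p1.2, pe.2); exact: b1 pe ih.
- have pe : proc (@enc (bexp X) (Enc_bexp eX) p) := bexp_proc eX p.
  have pe' : proc (@enc (bexp X) (Enc_bexp eX) q) := bexp_proc eX q.
  apply: (rep_red (@red_lams (tm_app (tm_app (tm_var 1) (enc p)) (enc q)) _ pL)).
  by rewrite [substs _ _]/= !(p2.2, pe.2, pe'.2); exact: b2 pe pe' ihp ihq.
have pe : proc (@enc (bexp X) (Enc_bexp eX) p) := bexp_proc eX p.
  have pe' : proc (@enc (bexp X) (Enc_bexp eX) q) := bexp_proc eX q.
apply: (rep_red (@red_lams (tm_app (tm_app (tm_var 0) (enc p)) (enc q)) _ pL)).
by rewrite [substs _ _]/= !(p3.2, pe.2, pe'.2); exact: b3 pe pe' ihp ihq.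
Qed.

Lemma computable_regex_fold z o (l : X -> A) p d s :
  computable z -> computable o -> computable l -> computable p ->
  computable d -> computable s -> computable (regex_fold z o l p d s).
Proof.
move=> [tz hz] [to ho] [tl hl] [tp hp] [td hd] [ts hs].
have pz := rep_proc hz; have po := rep_proc ho; have pl := rep_proc hl.
have pp := rep_proc hp; have pd := rep_proc hd; have ps := rep_proc hs.
pose B := apps (tm_var 0) [:: tz; to; tl; tm_br2 (tm_var 3) tp;
  tm_br2 (tm_var 3) td; tm_br1 (tm_var 2) ts].
have pw : proc (tm_lam (tm_lam B)) by rewrite /B /tm_br1 /tm_br2 /=; proc_tac.
have := fun p => red_fix_lam pw (regex_proc eX p); have := proc_fix pw.
move: (tm_fix _) => F pF redF; apply: (computable_enc pF).
pose L := [:: tz; to; tl; tm_br2 F tp; tm_br2 F td; tm_br1 F ts].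
have {}redF (e : regex X) : red (tm_app F (enc e)) (apps (enc e) L).
  move: (redF e); change (enc_regex (@enc X eX) e) with (@enc (regex X) (Enc_regex eX) e).
  have := regex_proc eX e; change (enc_regex (@enc X eX) e) with (@enc (regex X) (Enc_regex eX) e).
  move: (@enc (regex X) (Enc_regex eX) e) => u pu.
  by rewrite /B /L /tm_br1 /tm_br2 /= !(pz.2, po.2, pl.2, pp.2, pd.2, ps.2, pF.2).
have p1 := proc_br2 pF pp; have p2 := proc_br2 pF pd; have p3 := proc_br1 pF ps.
have pL : foldr (fun t P => proc t /\ P) True L.
  exact: (conj pz (conj po (conj pl (conj p1 (conj p2 (conj p3 I)))))).
pose g := regex_fold z o l p d s.
have b1 e e' x y := @rep_br2 _ F tp g p e e' x y pF hp.
have b2 e e' x y := @rep_br2 _ F td g d e e' x y pF hd.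
have b3 e x := @rep_br1 _ F ts g s e x pF hs.
move: pL redF; rewrite {}/L.
move: (tm_br2 F tp) p1 b1 (tm_br2 F td) p2 b2 (tm_br1 F ts) p3 b3.
move=> f1 p1 b1 f2 p2 b2 f3 p3 b3 pL redF.
elim=> [||x|e ihe f ihf|e ihe f ihf|e ih]; apply: (rep_red (redF _)).
- by apply: (rep_red (@red_lams (tm_var 5) _ pL)); rewrite /= !pz.2; apply: rep_val.
- by apply: (rep_red (@red_lams (tm_var 4) _ pL)); rewrite /= !po.2; apply: rep_val.
- have px := @enc_proc X eX x.
  apply: (rep_red (@red_lams (tm_app (tm_var 3) (enc x)) _ pL)).
  rewrite /= !px.2 !pl.2; apply: rep_app hl _; exact: rep_val.
- have pe : proc (@enc (regex X) (Enc_regex eX) e) := regex_proc eX e.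
  have pf : proc (@enc (regex X) (Enc_regex eX) f) := regex_proc eX f.
  apply: (rep_red (@red_lams (tm_app (tm_app (tm_var 2) (enc e)) (enc f)) _ pL)).
  by rewrite [substs _ _]/= !(p1.2, pe.2, pf.2); exact: b1 pe pf ihe ihf.
- have pe : proc (@enc (regex X) (Enc_regex eX) e) := regex_proc eX e.
  have pf : proc (@enc (regex X) (Enc_regex eX) f) := regex_proc eX f.
  apply: (rep_red (@red_lams (tm_app (tm_app (tm_var 1) (enc e)) (enc f)) _ pL)).
  by rewrite [substs _ _]/= !(p2.2, pe.2, pf.2); exact: b2 pe pf ihe ihf.
have pe : proc (@enc (regex X) (Enc_regex eX) e) := regex_proc eX e.
apply: (rep_red (@red_lams (tm_app (tm_var 0) (enc e)) _ pL)).
by rewrite [substs _ _]/= !(p3.2, pe.2); exact: b3 pe ih.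
Qed.
End Fold.

Create HintDb computable.

(** Bracket abstraction guided by syntax: bound variables are collected into nested pairs forming
    the environment, and applications are split by [comp_app]. *)
Ltac comp_step := lazymatch goal with
  | |- computable (fun _ : ?E => ?c) => apply: comp_const
  | |- computable (fun x => x) => apply: comp_id
  | |- computable (fun x => (fun y => @?f x y)) =>
      apply: (comp_lam (f := fun env_ => f env_.1 env_.2)); cbv beta
  | |- computable (fun x : ?E => @?b x) =>
      let f := constr:(fun x_ : E => ltac:(let c := eval cbv beta in (b x_) in
                 lazymatch c with ?h _ => exact h end)) in
      let g := constr:(fun x_ : E => ltac:(let c := eval cbv beta in (b x_) in
                 lazymatch c with _ ?a => exact a end)) in
      apply: (comp_app (f := f) (g := g)); cbv beta
  | |- computable _ =>
      first [ assumption | solve [auto with computable] | exact: computable_val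
            | apply: computable_app ]
  end.
Ltac comp := repeat comp_step.

#[export] Hint Resolve computable_fst computable_snd computable_ifb
  computable_sum_case : computable.

Lemma computable_S : computable S.
Proof.
exists (tm_lam (tm_lam (tm_lam (tm_app (tm_var 0) (tm_var 2))))); split.
  by proc_tac.
move=> _ n ->; exists (enc n.+1) => //; apply: red_beta; first exact: nat_proc.
by rewrite /=; constructor.
Qed.
#[export] Hint Resolve computable_S : computable.

Section Folds.
Variables (E A X : Type) (RE : Rep E) (RA : Rep A) (eX : Enc X).

(** The basic fold takes fixed branches. Branches depending on the environment are obtained by
    folding at the type [E -> A] and applying the result to the environment. *)
Lemma comp_nat_fold (z : E -> A) (s : E -> nat -> A -> A) (n : E -> nat) :
  computable z -> computable s -> computable n ->
  computable (fun x => nat_fold (z x) (s x) (n x)).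
Proof.
move=> hz hs hn.
have hs' : computable (fun m (r : E -> A) x => s x m (r x)) by comp.
have hf := computable_nat_fold hz hs'.
apply: (computable_ext (f := fun x => nat_fold z (fun m r x => s x m (r x)) (n x) x)).
  by move=> x; elim: (n x) => //= m ->.
by comp.
Qed.

Lemma comp_bexp_fold (v : E -> X -> A) t b (n : E -> A -> A)
    (a o : E -> A -> A -> A) (p : E -> bexp X) :
  computable v -> computable t -> computable b -> computable n ->
  computable a -> computable o -> computable p ->
  computable (fun x => bexp_fold (v x) (t x) (b x) (n x) (a x) (o x) (p x)).
Proof.
move=> hv ht hb hn ha ho hp.
have hv' : computable (fun y x => v x y) by comp.
have hn' : computable (fun (r : E -> A) x => n x (r x)) by comp.
have ha' : computable (fun (r r' : E -> A) x => a x (r x) (r' x)) by comp.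
have ho' : computable (fun (r r' : E -> A) x => o x (r x) (r' x)) by comp.
have hf := computable_bexp_fold hv' ht hb hn' ha' ho'.
apply: (computable_ext (f := fun x => bexp_fold (fun y x => v x y) t b
  (fun r x => n x (r x)) (fun r r' x => a x (r x) (r' x))
  (fun r r' x => o x (r x) (r' x)) (p x) x)); last by comp.
by move=> x; elim: (p x) => //= [q -> | q -> r -> | q -> r ->].
Qed.

Lemma comp_regex_fold z o (l : E -> X -> A) (p d : E -> A -> A -> A)
    (s : E -> A -> A) (e : E -> regex X) :
  computable z -> computable o -> computable l -> computable p ->
  computable d -> computable s -> computable e ->
  computable (fun x => regex_fold (z x) (o x) (l x) (p x) (d x) (s x) (e x)).
Proof.
move=> hz ho hl hp hd hs he.
have hl' : computable (fun y x => l x y) by comp.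
have hs' : computable (fun (r : E -> A) x => s x (r x)) by comp.
have hp' : computable (fun (r r' : E -> A) x => p x (r x) (r' x)) by comp.
have hd' : computable (fun (r r' : E -> A) x => d x (r x) (r' x)) by comp.
have hf := computable_regex_fold hz ho hl' hp' hd' hs'.
apply: (computable_ext (f := fun x => regex_fold z o (fun y x => l x y)
  (fun r r' x => p x (r x) (r' x)) (fun r r' x => d x (r x) (r' x))
  (fun r x => s x (r x)) (e x) x)); last by comp.
by move=> x; elim: (e x) => //= [q -> r -> | q -> r -> | q ->].
Qed.
End Folds.

Ltac comp_step' := lazymatch goal with
  | |- computable (fun x => nat_fold (@?z x) (@?s x) (@?n x)) =>
      apply: (comp_nat_fold (z := z) (s := s) (n := n)); cbv beta
  | |- computable (fun x => bexp_fold (@?v x) (@?t x) (@?b x) (@?n x) (@?a x) (@?o x) (@?p x)) =>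
      apply: (comp_bexp_fold (v := v) (t := t) (b := b) (n := n) (a := a) (o := o) (p := p)); cbv beta
  | |- computable (fun x => regex_fold (@?z x) (@?o x) (@?l x) (@?p x) (@?d x) (@?s x) (@?e x)) =>
      apply: (comp_regex_fold (z := z) (o := o) (l := l) (p := p) (d := d) (s := s) (e := e)); cbv beta
  | |- computable _ => comp_step
  end.
Ltac comp_all := repeat comp_step'.

Definition notc b := ifb b false true.
Definition andc a b := ifb a b false.
Definition orc a b := ifb a true b.
Definition eqbc a b := ifb a b (notc b).
(** Recursion on [n] at a function type; the inner fold over [m] is only a case analysis. *)
Definition eqc : nat -> nat -> bool := fun n =>
  nat_fold (fun m => nat_fold true (fun _ _ => false) m)
           (fun _ r m => nat_fold false (fun m' _ => r m') m) n.
Definition lec : nat -> nat -> bool := fun n =>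
  nat_fold (fun _ => true) (fun _ r m => nat_fold false (fun m' _ => r m') m) n.
Definition addc n m := nat_fold m (fun _ r => r.+1) n.
Definition pow2c n := nat_fold 1 (fun _ r => addc r r) n.

Lemma computable_notc : computable notc. Proof. by rewrite /notc; comp_all. Qed.
#[export] Hint Resolve computable_notc : computable.
Lemma computable_andc : computable andc. Proof. by rewrite /andc; comp_all. Qed.
Lemma computable_orc : computable orc. Proof. by rewrite /orc; comp_all. Qed.
Lemma computable_eqbc : computable eqbc. Proof. by rewrite /eqbc; comp_all. Qed.
Lemma computable_eqc : computable eqc. Proof. by rewrite /eqc; comp_all. Qed.
Lemma computable_lec : computable lec. Proof. by rewrite /lec; comp_all. Qed.
Lemma computable_addc : computable addc. Proof. by rewrite /addc; comp_all. Qed.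
#[export] Hint Resolve computable_andc computable_orc computable_eqbc
  computable_eqc computable_lec computable_addc : computable.
Lemma computable_pow2c : computable pow2c. Proof. by rewrite /pow2c; comp_all. Qed.
#[export] Hint Resolve computable_pow2c : computable.

(** * The decision procedure *)

Section Program.
Variables (S O : finType).

Lemma fin_proc (T : finType) (x : T) : proc (enc_fin x).
Proof. exact: nat_proc. Qed.

#[local] Instance Enc_S : Enc S := {| enc_proc := @fin_proc S |}.
#[local] Instance Enc_O : Enc O := {| enc_proc := @fin_proc O |}.

Definition rankS (s : S) : nat := enum_rank s.
Definition rankO (o : O) : nat := enum_rank o.

Lemma computable_rankS : computable rankS.
Proof.
exists (tm_lam (tm_var 0)); split; first by proc_tac.
move=> _ s ->; exists (enc_nat (enum_rank s)) => //.
by apply: red_beta; [exact: nat_proc | exact: eval_proc (nat_proc _)].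
Qed.

Lemma computable_rankO : computable rankO.
Proof.
exists (tm_lam (tm_var 0)); split; first by proc_tac.
move=> _ s ->; exists (enc_nat (enum_rank s)) => //.
by apply: red_beta; [exact: nat_proc | exact: eval_proc (nat_proc _)].
Qed.
#[local] Hint Resolve computable_rankS computable_rankO : computable.

Notation letter := (dbl (S + bexp O)).

(* A guarded string is given by its length, its atoms, and the directions and
   letters of its edges. *)
Definition edgec (n : nat) (b : nat -> bool) (x : nat -> nat) i d k :=
  andc (lec i.+1 n) (andc (eqbc (b i) d) (eqc (x i) k)).
Definition stepc n b x d k i j :=
  orc (andc (eqc j i.+1) (edgec n b x i d k))
      (andc (eqc i j.+1) (edgec n b x j (notc d) k)).
Definition testc (a : nat -> nat -> bool) (p : bexp O) i j :=
  andc (eqc i j) (bexp_fold (fun o => a i (rankO o)) true false notc andc orc p).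
Definition letc n a b x (l : (S + bexp O) + (S + bexp O)) i j :=
  sum_case (sum_case (fun s => stepc n b x false (rankS s) i j) (fun p => testc a p i j))
           (sum_case (fun s => stepc n b x true (rankS s) i j) (fun p => testc a p i j)) l.
Definition exc n (P : nat -> bool) := nat_fold (P 0) (fun m r => orc (P m.+1) r) n.
Definition seqc n (R T : nat -> nat -> bool) i j := exc n (fun k => andc (R i k) (T k j)).
(** The vertices are 0 to [n], so a path without repetition has at most [n] steps and [n] iterations
    are enough. *)
Definition starc n (R : nat -> nat -> bool) :=
  nat_fold eqc (fun _ T i j => orc (eqc i j) (seqc n R T i j)) n.
Definition evc n a b x (e : regex ((S + bexp O) + (S + bexp O))) : nat -> nat -> bool :=
  regex_fold (fun _ _ => false) eqc (letc n a b x)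
    (fun R T i j => orc (R i j) (T i j)) (seqc n) (starc n) e.
Definition agreec e f n a b x := eqbc (evc n a b x e 0 n) (evc n a b x f 0 n).

Definition consb (v : bool) (a : nat -> bool) : nat -> bool :=
  fun i => nat_fold v (fun i' _ => a i') i.
Definition consn (v : nat) (a : nat -> nat) : nat -> nat :=
  fun i => nat_fold v (fun i' _ => a i') i.
Definition consa (v : nat -> bool) (a : nat -> nat -> bool) : nat -> nat -> bool :=
  fun i => nat_fold v (fun i' _ => a i') i.
Definition allc m (P : nat -> bool) := nat_fold true (fun k r => andc (P k) r) m.
(** Quantification over Boolean vectors of length [m], padded with [false]. Folding over predicates
    on vectors avoids encoding lists. *)
Definition allv m : ((nat -> bool) -> bool) -> bool :=
  nat_fold (fun P => P (fun _ => false))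
    (fun _ r P => andc (r (fun v => P (consb true v))) (r (fun v => P (consb false v)))) m.

(** The string grows at its front, as in [gst], by up to [K] edges. The alphabets being fixed,
    [#|S|] and [#|O|] are constants of the program. *)
Definition checkc e f K : nat -> (nat -> nat -> bool) -> (nat -> bool) -> (nat -> nat) -> bool :=
  nat_fold (agreec e f)
    (fun _ r n a b x => andc (agreec e f n a b x)
       (allc #|S| (fun k => allv #|O| (fun v =>
          andc (r n.+1 (consa v a) (consb true b) (consn k x))
               (r n.+1 (consa v a) (consb false b) (consn k x)))))) K.

(** A test expands to a sum of at most 2^|O| atoms with two states each; the other two states cover
    a letter of [S]. *)
Definition sizec (e : regex ((S + bexp O) + (S + bexp O))) : nat :=
  regex_fold 0 1 (fun _ => (2 ^ #|O|).*2.+2) addc addc Datatypes.S e.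
(** An expression of size n has at most 2^n subset states, hence 2^(2^(2n+1)) pairs of relations on
    them. With m the sum of both sizes, each of the two exponents is at most 2^(2m+2), which gives
    2^(2^(2m+3)) for the pair of expressions. *)
Definition boundc e f :=
  pow2c (pow2c (addc (addc (addc (sizec e) (sizec f)) (addc (sizec e) (sizec f))) 3)).

Definition decide e f := allv #|O| (fun v =>
  checkc e f (boundc e f) 0 (fun _ => v) (fun _ => false) (fun _ => 0)).

Lemma computable_edgec : computable edgec. Proof. by rewrite /edgec; comp_all. Qed.
#[local] Hint Resolve computable_edgec : computable.
Lemma computable_stepc : computable stepc. Proof. by rewrite /stepc; comp_all. Qed.
Lemma computable_testc : computable testc. Proof. by rewrite /testc; comp_all. Qed.
#[local] Hint Resolve computable_stepc computable_testc : computable.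
Lemma computable_letc : computable letc. Proof. by rewrite /letc; comp_all. Qed.
Lemma computable_exc : computable exc. Proof. by rewrite /exc; comp_all. Qed.
#[local] Hint Resolve computable_letc computable_exc : computable.
Lemma computable_seqc : computable seqc. Proof. by rewrite /seqc; comp_all. Qed.
#[local] Hint Resolve computable_seqc : computable.
Lemma computable_starc : computable starc. Proof. by rewrite /starc; comp_all. Qed.
#[local] Hint Resolve computable_starc : computable.
Lemma computable_evc : computable evc. Proof. by rewrite /evc; comp_all. Qed.
#[local] Hint Resolve computable_evc : computable.
Lemma computable_agreec : computable agreec. Proof. by rewrite /agreec; comp_all. Qed.
Lemma computable_consb : computable consb. Proof. by rewrite /consb; comp_all. Qed.
Lemma computable_consn : computable consn. Proof. by rewrite /consn; comp_all. Qed.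
Lemma computable_consa : computable consa. Proof. by rewrite /consa; comp_all. Qed.
Lemma computable_allc : computable allc. Proof. by rewrite /allc; comp_all. Qed.
#[local] Hint Resolve computable_agreec computable_consb computable_consn
  computable_consa computable_allc : computable.
Lemma computable_allv : computable allv. Proof. by rewrite /allv; comp_all. Qed.
#[local] Hint Resolve computable_allv : computable.
Lemma computable_checkc : computable checkc. Proof. by rewrite /checkc; comp_all. Qed.
Lemma computable_sizec : computable sizec. Proof. by rewrite /sizec; comp_all. Qed.
#[local] Hint Resolve computable_checkc computable_sizec : computable.
Lemma computable_boundc : computable boundc. Proof. by rewrite /boundc; comp_all. Qed.
#[local] Hint Resolve computable_boundc : computable.
Lemma computable_decide : computable decide. Proof. by rewrite /decide; comp_all. Qed.

Lemma decidable_of_decide (R : regex letter -> regex letter -> Prop) :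
  (forall e f, R e f <-> decide e f = true) ->
  decidable_rel (enc_regex (enc_katc_letter S O)) R.
Proof.
move=> hR; have [d [[_ cd] hd]] := computable_decide; exists d => // e f.
exists (decide e f) => //.
(* The [Enc] instances unfold to [enc_katc_letter], so [enc e] is the encoding used in the
   statement. *)
have [v1 h1 r1] := hd (enc e) e erefl.
have [v2 h2 r2] := r1.2 (enc f) f erefl.
have e2 : v2 = enc_bool (decide e f) := r2.
rewrite -e2.
exact: red_appl (eval_red h1 (rep_proc r1).1) _ h2.
Qed.

End Program.

Lemma notcE b : notc b = ~~ b. Proof. by case: b. Qed.
Lemma andcE a b : andc a b = a && b. Proof. by case: a. Qed.
Lemma orcE a b : orc a b = a || b. Proof. by case: a. Qed.
Lemma eqbcE a b : eqbc a b = (a == b). Proof. by case: a; case: b. Qed.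
Lemma eqcE n m : eqc n m = (n == m).
Proof. by elim: n m => [|n ih] [|m] //=; rewrite -[LHS]/(eqc n m) ih. Qed.
Lemma lecE n m : lec n m = (n <= m).
Proof. by elim: n m => [|n ih] [|m] //=; rewrite -[LHS]/(lec n m) ih. Qed.
Lemma addcE n m : addc n m = n + m.
Proof. by elim: n => //= n; rewrite /addc /= => ->. Qed.
Lemma pow2cE n : pow2c n = 2 ^ n.
Proof. by elim: n => //= n; rewrite /pow2c /= => ->; rewrite addcE addnn expnS mul2n. Qed.
Definition cE := (notcE, andcE, orcE, eqbcE, eqcE, lecE, addcE, pow2cE).

Lemma excP n (P : nat -> bool) : reflect (exists2 k, k <= n & P k) (exc n P).
Proof.
apply: (iffP idP).
  elim: n => [|n ih] /=; first by exists 0.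
  rewrite /exc /= -/(exc n P) orcE => /orP[h|/ih[k hk h]]; first by exists n.+1.
  by exists k => //; apply: leqW.
elim: n => [|n ih] [k hk h]; first by move: hk h; rewrite leqn0 => /eqP->.
rewrite /exc /= -/(exc n P) orcE; move: hk; rewrite leq_eqVlt => /orP[/eqP <-|].
  by rewrite h.
by rewrite ltnS => hk; rewrite ih ?orbT //; exists k.
Qed.

Lemma allcP m (P : nat -> bool) : reflect (forall k, k < m -> P k) (allc m P).
Proof.
apply: (iffP idP).
  elim: m => // m ih; rewrite /allc /= -/(allc m P) andcE => /andP[h /ih h'] k.
  by rewrite ltnS leq_eqVlt => /orP[/eqP->|/h'].
elim: m => // m ih h; rewrite /allc /= -/(allc m P) andcE h //=.
by apply: ih => k hk; apply: h; apply: leqW.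
Qed.

Lemma allv_all m (P : (nat -> bool) -> bool) : (forall v, P v) -> allv m P.
Proof.
elim: m P => [|m ih] P h; first exact: h.
by rewrite /allv /= -!/(allv m _) andcE !ih.
Qed.

Lemma allv_inst m (P : (nat -> bool) -> bool) v : allv m P -> exists2 v', (forall i, i < m -> v' i = v i) & P v'.
Proof.
elim: m P v => [|m ih] P v; first by exists (fun _ => false).
rewrite /allv /= -!/(allv m _) andcE => /andP[h1 h2].
have [v' hv' hP] : exists2 v', (forall i, i < m -> v' i = v i.+1) &
    P (consb (v 0) v').
  by case: (v 0); [apply: (ih _ (fun i => v i.+1) h1) | apply: (ih _ (fun i => v i.+1) h2)].
by exists (consb (v 0) v') => // -[|i] //= /hv'.
Qed.

(** * Correctness of the decision procedure *)

Section Spec.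
Variables (S O : finType).

Notation atom := {ffun O -> bool}.
Notation sym := (bool * S)%type.
Notation letter := (dbl (S + bexp O)).
Notation tail := (seq (sym * atom)).
Implicit Types (e f : regex letter) (al be : atom) (t : tail).

Definition repr n (a : nat -> nat -> bool) (b : nat -> bool) (x : nat -> nat) al t :=
  [/\ size t = n,
      forall i o, i <= n -> a i (rankO o) = atm al t i o &
      forall i y, i < n -> edge t i y = (b i == y.1) && (x i == rankS y.2)].

Lemma repr_cons n a b x al t v be k (y : sym) :
  repr n a b x al t -> (forall o, v (rankO o) = be o) -> k = rankS y.2 ->
  repr n.+1 (consa v a) (consb y.1 b) (consn k x) be ((y, al) :: t).
Proof.
move=> [h1 h2 h3] hv hk; split=> [|[|i] o hi|[|i] z hi] //=.
- by rewrite h1.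
- exact: h2.
- rewrite hk -pair_eqE /= /rankS; congr (_ && _).
  by apply/eqP/eqP => [-> //|/ord_inj/enum_rank_inj].
exact: h3.
Qed.

Lemma edge_size t i y : edge t i y -> i < size t.
Proof. by elim: t i => [|[z be] t ih] [|i] //= /ih. Qed.

Lemma grel_size al t g i j : i <= size t -> grel al t g i j -> j <= size t.
Proof.
move=> hi; case: g => [be|y] /=; first by move=> /andP[/eqP<-].
by case/orP => /andP[/eqP e1 /edge_size]; rewrite ?e1 //; lia.
Qed.

Lemma gletter_size al t l i j : i <= size t -> gletter al t l i j -> j <= size t.
Proof.
move=> hi; case: l => -[s|p] /=; try by [move=> [<- _] | apply: (grel_size (g := inr (false, s)))].
case/orP => /andP[/eqP e1 /edge_size]; lia.
Qed.

Lemma rrel_size al t e i j :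
  i <= size t -> rrel (gletter al t) e i j -> j <= size t.
Proof.
move=> + [w _]; elim: w i => [|l w ih] i hi /=; first by move<-.
by move=> [k /(gletter_size hi) hk /(ih _ hk)].
Qed.

Lemma evcP n a b x al t e i j : repr n a b x al t -> i <= n -> j <= n ->
  evc n a b x e i j <-> rrel (gletter al t) e i j.
Proof.
move=> hr; have [hn ha hx] := hr.
have edgeE i' d s : edgec n b x i' d (rankS s) = edge t i' (d, s).
  rewrite /edgec !cE; case: (ltnP i' n) => hi; first by rewrite hx.
  by apply/esym/negP => /edge_size; rewrite hn ltnNge hi.
have stepE d s i' j' :
    stepc n b x d (rankS s) i' j' = grel al t (inr (d, s)) i' j'.
  by rewrite /stepc !cE !edgeE.
have testE p i' j' : i' <= n ->
    testc a p i' j' <-> i' = j' /\ beval (atm al t i') p.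
  move=> hi; rewrite /testc !cE.
  have -> : bexp_fold (fun o => a i' (rankO o)) true false notc andc orc p =
      beval (atm al t i') p.
    by elim: p => //= [o|p ->|p -> q ->|p -> q ->]; rewrite ?cE ?ha.
  by split=> [/andP[/eqP]|[-> ->]] //; rewrite eqxx.
elim: e i j => [||l|e1 ih1 e2 ih2|e1 ih1 e2 ih2|e ih] i j hi hj.
- by rewrite rrel_zero.
- by rewrite rrel_one -[evc _ _ _ _ _ _ _]/(eqc i j) cE; split=> /eqP.
- rewrite rrel_letter -[evc _ _ _ _ _ _ _]/(letc n a b x l i j).
  case: l => -[s|p]; rewrite /letc /=; try exact: testE; rewrite stepE //=.
  by rewrite orbC.
- rewrite rrel_plus -[evc _ _ _ _ _ _ _]/(orc (evc n a b x e1 i j) (evc n a b x e2 i j)).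
  by rewrite cE -ih1 // -ih2 //; split=> /orP.
- rewrite rrel_dot -[evc _ _ _ _ _ _ _]/(seqc n (evc n a b x e1) (evc n a b x e2) i j).
  split=> [/excP[k hk]|[k h1 h2]].
    by rewrite cE => /andP[/ih1 h1 /ih2 h2]; exists k; [apply: h1 | apply: h2].
  have hk : k <= n by rewrite -hn; apply: rrel_size h1; rewrite hn.
  by apply/excP; exists k => //; rewrite cE; apply/andP; split; [apply/ih1 | apply/ih2].
rewrite -[evc _ _ _ _ _ _ _]/(starc n (evc n a b x e) i j).
set R := evc n a b x e in ih *; rewrite /starc.
set step := fun _ : nat => _; split.
  have key m i' : i' <= n -> nat_fold eqc step m i' j ->
      rrel (gletter al t) (re_star e) i' j.
    elim: m i' => [|m ihm] i' hi' /=.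
      by rewrite cE => /eqP->; apply: rrel_star_nil.
    rewrite /step !cE => /orP[/eqP->|/excP[k hk]]; first exact: rrel_star_nil.
    rewrite cE => /andP[/(ih _ _ hi' hk) h1 /(ihm _ hk)].
    exact: rrel_star_cons.
  exact: key.
pose R' : rel 'I_n.+1 := fun i j => R i j.
move=> h; have : connect R' (inord i) (inord j).
  have key i' j' : rrel (gletter al t) (re_star e) i' j' -> i' <= n ->
      connect R' (inord i') (inord j').
    apply: (rrel_star_ind (P := fun i j => i <= n ->
      connect R' (inord i) (inord j))) => [//|k l m h1 h2 hk].
    have hl : l <= n by rewrite -hn; apply: rrel_size h1; rewrite hn.
    apply: connect_trans (connect1 _) (h2 hl).
    by rewrite /R' !inordK ?ltnS //; apply/ih.
  exact: key.
move=> /connectP[p hp]; case/shortenP: hp => p' hp' up' _ hl.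
have sz : size p' <= n.
  by have := max_card (mem (inord i :: p')); rewrite (card_uniqP up') card_ord.
have -> : j = last (inord i : 'I_n.+1) p' by rewrite -hl inordK.
have {1}-> : i = (inord i : 'I_n.+1) by rewrite inordK.
have key m (u : 'I_n.+1) q : path R' u q -> size q <= m ->
    nat_fold eqc step m u (last u q).
  elim: q m u => [|u' q ihq] [|m] u //=; rewrite ?/step ?cE ?eqxx //.
  move=> /andP[h1 h2] sq; apply/orP; right; apply/excP.
  exists u'; first by rewrite -ltnS.
  by rewrite cE; apply/andP; split=> //; apply: ihq.
exact: key.
Qed.

Definition agree e f al t := gsem e al t <-> gsem f al t.

Lemma agreecP e f n a b x al t :
  repr n a b x al t -> agreec e f n a b x <-> agree e f al t.
Proof.
move=> hr; rewrite /agreec cE /agree /gsem; have [-> _ _] := hr.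
rewrite -!(evcP _ hr) //.
by case: evc; case: evc; split=> // h; have [h1 h2] := h; exfalso; intuition.
Qed.

(** Builds a guarded string from its last vertex backwards, in the order in which [checkc]
    explores. *)
Fixpoint extend (q : seq (atom * sym)) (g : atom * tail) : atom * tail :=
  if q is y :: q' then extend q' (y.1, (y.2, g.1) :: g.2) else g.

Lemma extend_all al t : exists q be, size q = size t /\ extend q (be, [::]) = (al, t).
Proof.
elim: t al => [|[y be] t ih] al; first by exists [::], al.
have [q [de [hq eq]]] := ih be; exists (rcons q (al, y)), de.
rewrite size_rcons hq; split=> //.
have cat q1 q2 g : extend (q1 ++ q2) g = extend q2 (extend q1 g).
  by elim: q1 g => /=.
by rewrite -cats1 cat eq.
Qed.

Lemma checkc_sound e f K n a b x al t q : repr n a b x al t ->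
  checkc e f K n a b x -> size q <= K ->
  agree e f (extend q (al, t)).1 (extend q (al, t)).2.
Proof.
elim: K n a b x al t q => [|K ih] n a b x al t q hr.
  by case: q => // h _; apply/(agreecP _ _ hr).
rewrite /checkc /= -/(checkc e f K) andcE => /andP[/(agreecP e f hr) h0 hall].
case: q => // -[be [d s]] q /= sq.
have hs : rankS s < #|S| by apply: ltn_ord.
pose v i := if insub i is Some k then be (enum_val (k : 'I_#|O|)) else false.
have [v' hv'] := allv_inst v (allcP _ _ hall _ hs).
have hvo o : v' (rankO o) = be o.
  rewrite hv' ?ltn_ord // /v /rankO; case: insubP => [k _ ek|/negP[]//].
  by rewrite (val_inj ek) enum_rankK.
rewrite andcE => /andP[h1 h2].
by case: d => /=; [apply: ih (repr_cons (y := (true, s)) hr hvo erefl) h1 sq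
  | apply: ih (repr_cons (y := (false, s)) hr hvo erefl) h2 sq].
Qed.

Lemma checkc_complete e f K n a b x al t : (forall al t, agree e f al t) ->
  repr n a b x al t -> checkc e f K n a b x.
Proof.
move=> h; elim: K n a b x al t => [|K ih] n a b x al t hr; first exact/(agreecP e f hr).
rewrite /checkc /= -/(checkc e f K) andcE; apply/andP; split.
  exact/(agreecP e f hr).
apply/allcP => k hk; apply: allv_all => v.
pose be : atom := [ffun o => v (rankO o)].
have hv o : v (rankO o) = be o by rewrite ffunE.
pose s : S := enum_val (Ordinal hk).
have hs : k = rankS s by rewrite /rankS enum_valK.
rewrite andcE; apply/andP; split.
  exact: ih (repr_cons (y := (true, s)) hr hv hs).
exact: ih (repr_cons (y := (false, s)) hr hv hs).
Qed.

Lemma nsize_gexp e : nsize (gexp e) <= sizec e.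
Proof.
elim: e => [||l|e1 ih1 e2 ih2|e1 ih1 e2 ih2|e ih] //=.
- have sz (P : pred atom) : nsize (re_sum (fun v => re_letter (inl v) : regex (atom + sym)) (enum P))
      <= (2 ^ #|O|).*2.
    have -> (s : seq atom) : nsize (re_sum (fun v => re_letter (inl v) : regex (atom + sym)) s)
        = (size s).*2 by elim: s => //= v s ->.
    rewrite leq_double -cardE; apply: leq_trans (max_card _) _.
    by rewrite card_ffun card_bool.
  by case: l => -[s|p] //=; rewrite -[sizec _]/((2 ^ #|O|).*2.+2); try exact: leqW (leqW (sz _)).
- by rewrite -[sizec _]/(addc (sizec e1) (sizec e2)) cE leq_add.
- by rewrite -[sizec _]/(addc (sizec e1) (sizec e2)) cE leq_add.
Qed.

Definition pstate e f := (gstate (gexp e) * gstate (gexp f))%type.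
Definition pst e f al t : pstate e f := (gst (gexp e) al t, gst (gexp f) al t).

Lemma card_gstate e : #|{: gstate (gexp e)}| <= 2 ^ (2 ^ (sizec e + sizec e).+1).
Proof.
rewrite card_prod card_set_type -expnD leq_exp2l // card_prod addnn -mul2n expnS.
rewrite leq_mul2l expnD.
have h : #|dst (gexp e)| <= 2 ^ sizec e.
  by apply: leq_trans (card_dst _) _; rewrite leq_exp2l // nsize_gexp.
by rewrite leq_mul.
Qed.

Lemma card_pstate e f : #|{: pstate e f}| <= boundc e f.
Proof.
rewrite card_prod; apply: leq_trans (leq_mul (card_gstate e) (card_gstate f)) _.
rewrite /boundc !cE -expnD leq_exp2l //.
set m := sizec e + sizec f; rewrite addn3.
have -> : 2 ^ (m + m).+3 = 2 ^ (m + m).+2 + 2 ^ (m + m).+2.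
  by rewrite (addnn (2 ^ _)) -mul2n -expnS.
by apply: leq_add; rewrite leq_exp2l // /m; lia.
Qed.

Lemma agree_pst e f al t al' t' :
  pst e f al t = pst e f al' t' -> agree e f al t -> agree e f al' t'.
Proof. by case=> h1 h2; rewrite /agree !gsem_gexp -!gaccP h1 h2. Qed.

(** States are computed from the end of the string, so a suffix may be exchanged for another one
    with the same states. *)
Lemma pst_suffix e f al t i be u : i <= size t ->
  pst e f be u = pst e f (atm al t i) (drop i t) ->
  exists al' t', size t' = i + size u /\ pst e f al' t' = pst e f al t.
Proof.
elim: t al i => [|[y de] t ih] al [|i] //.
- by move=> _ h; exists be, u.
- by move=> _ h; exists be, u.
move=> hi h; have [de' [t' [h1 [h2 h3]]]] := ih de i hi h.
exists al, ((y, de') :: t'); split; first by rewrite /= h1.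
rewrite -[RHS]/(gext al y (gst (gexp e) de t), gext al y (gst (gexp f) de t)).
by rewrite -h2 -h3; apply: erefl.
Qed.

Lemma shorten_gs e f al t : exists al' t',
  size t' <= boundc e f /\ pst e f al' t' = pst e f al t.
Proof.
have [n] := ubnP (size t); elim: n al t => // n ih al t; rewrite ltnS => hn.
case: (leqP (size t) (boundc e f)) => ht; first by exists al, t.
pose F (k : 'I_(size t).+1) := pst e f (atm al t k) (drop k t).
have : ~~ injectiveb F.
  apply/negP => /injectiveP/leq_card; rewrite card_ord => h.
  by have := leq_trans h (card_pstate e f); rewrite ltnNge (ltnW ht).
case/injectivePn => i [j ij hF].
wlog lij : i j ij hF / i < j.
  move=> W; case: (ltngtP i j) => [|lji|/val_inj eij]; first exact: W.
    by apply: (W j i) => //; rewrite eq_sym.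
  by rewrite eij eqxx in ij.
have hi : i <= size t by rewrite -ltnS.
have [al' [t' [sz h]]] := pst_suffix hi (esym hF).
have [|al2 [t2 [h1 h2]]] := ih al' t'.
  by rewrite sz size_drop; have := ltn_ord j; lia.
by exists al2, t2; rewrite h2.
Qed.

Lemma decideP e f : decide e f <-> forall al t, agree e f al t.
Proof.
split=> [h al t|h]; last first.
  apply: allv_all => v; pose al : atom := [ffun o => v (rankO o)].
  have hr : repr 0 (fun _ => v) (fun _ => false) (fun _ => 0) al [::].
    by split=> // -[|i] o //= _; rewrite ffunE.
  exact: checkc_complete h hr.
have [al' [t' [sz hp]]] := shorten_gs e f al t; apply: (agree_pst hp).
have [q [be [sq eq]]] := extend_all al' t'.
pose v i := if insub i is Some k then be (enum_val (k : 'I_#|O|)) else false.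
have [v' hv'] := allv_inst v h.
have hr : repr 0 (fun _ => v') (fun _ => false) (fun _ => 0) be [::].
  split=> // -[|i] o //= _; rewrite hv' ?ltn_ord // /v /rankO.
  by case: insubP => [k _ ek|/negP[]//]; rewrite (val_inj ek) enum_rankK.
move=> hc; have := checkc_sound (q := q) hr hc; rewrite eq; apply.
by rewrite sq.
Qed.

Lemma katc_decidable :
  decidable_rel (enc_regex (enc_katc_letter S O)) (ka_eq (H_katc S O)).
Proof.
apply: decidable_of_decide => e f; rewrite ka_eq_gsem.
exact: iff_sym (decideP e f).
Qed.

End Spec.

Theorem theorem8p5 (Sigma Omega : finType) :
  reduces_to_empty (H_katc Sigma Omega) /\
  ka_complete (H_katc Sigma Omega) /\
  decidable_rel (enc_regex (enc_katc_letter Sigma Omega))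
    (ka_eq (H_katc Sigma Omega)).
Proof.
split; first exact: katc_reduces.
by split; [exact: katc_complete | exact: katc_decidable].
Qed.
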